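(* There is a constant $C>0$ such that for every $f\in H^1(\mathscr U)$, $$\|f^*\|_{L^1(\mathscr H_1\times\mathscr H_2)}\le C\,\|f\|_{H^1(\mathscr U)}.$$
   Context: For $\alpha=1,2$ let $n_\alpha\ge1$ and let $\mathscr H_\alpha=\mathbb R\times\mathbb C^{n_\alpha}$ be the Heisenberg group with points $(s_\alpha,\mathbf z_\alpha)$ and multiplication $(s_\alpha,\mathbf z_\alpha)(s_\alpha',\mathbf z_\alpha')=(s_\alpha+s_\alpha'+2\,\mathrm{Im}\langle\mathbf z_\alpha,\mathbf z_\alpha'\rangle,\mathbf z_\alpha+\mathbf z_\alpha')$, where $\langle\mathbf z,\mathbf z'\rangle=\sum_jz_j\overline{z_j'}$, homogeneous norm $\|(s_\alpha,\mathbf z_\alpha)\|_\alpha=(|\mathbf z_\alpha|^4+s_\alpha^2)^{1/4}$, Lebesgue measure. $\mathscr U=\mathbb R_+^2\times\mathscr H_1\times\mathscr H_2$ ($\mathbb R_+=(0,\infty)$), points $(\mathbf t,\mathbf g)$, also written $(w_1,w_2,\mathbf z_1,\mathbf z_2)$ with $w_\alpha=s_\alpha+\mathbf i t_\alpha$. Let $\mathcal U=\mathcal U_1\times\mathcal U_2$, $\mathcal U_\alpha=\{(\widetilde w_\alpha,\widetilde{\mathbf z}_\alpha)\in\mathbb C\times\mathbb C^{n_\alpha}:\mathrm{Im}\,\widetilde w_\alpha>|\widetilde{\mathbf z}_\alpha|^2\}$, $\pi:\mathscr U\to\mathcal U$, $(w_1,w_2,\mathbf z_1,\mathbf z_2)\mapsto(w_1+\mathbf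 i|\mathbf z_1|^2,w_2+\mathbf i|\mathbf z_2|^2,\mathbf z_1,\mathbf z_2)$. A function $f$ on $\mathscr U$ is holomorphic if $f\circ\pi^{-1}$ is holomorphic on $\mathcal U$. $H^1(\mathscr U)$ is the space of holomorphic $f$ on $\mathscr U$ with $\|f\|_{H^1(\mathscr U)}=\sup_{\mathbf t\in\mathbb R_+^2}\int_{\mathscr H_1\times\mathscr H_2}|f(\mathbf t,\mathbf g)|d\mathbf g<\infty$. For a continuous function $u$ on $\mathscr U$, the maximal function is $u^*(\mathbf g)=\sup_{(\mathbf t,\mathbf h)\in\Gamma_{\mathbf g}}|u(\mathbf t,\mathbf h)|$, $\mathbf g\in\mathscr H_1\times\mathscr H_2$, with $\Gamma_{\mathbf g}=\{(\mathbf t,\mathbf h)\in\mathscr U:\|\mathbf h_1^{-1}\mathbf g_1\|_1^2<t_1,\ \|\mathbf h_2^{-1}\mathbf g_2\|_2^2<t_2\}$. *)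

(* Defs.v *)
From HB Require Import structures.
From mathcomp Require Import all_boot all_order all_algebra.
From mathcomp Require Import all_classical all_reals all_analysis.
From mathcomp Require Import complex.

Set Implicit Arguments.
Unset Strict Implicit.
Unset Printing Implicit Defensive.

Import Order.TTheory GRing.Theory Num.Theory.
Import numFieldNormedType.Exports.
Local Open Scope classical_set_scope.
Local Open Scope ring_scope.
Local Open Scope complex_scope.

(* [R[i]^o] is [R[i]] seen as a normed module over itself; the library attaches
   the topology to this alias only. *)
Notation Cplx R := (R[i]^o).

(* The product measure of the library, under a name from which its
   sigma-finiteness is inferred (for [\x] itself, inference only finds the
   instance for subprobability factors). *)
Definition sfprod d1 d2 (T1 : measurableType d1) (T2 : measurableType d2)
    (R : realType) (m1 : {sigma_finite_measure set T1 -> \bar R})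
    (m2 : {sigma_finite_measure set T2 -> \bar R}) : set (T1 * T2) -> \bar R :=
  (m1 \x m2)%E.

Section sfprod_sigma_finite.
Context d1 d2 (T1 : measurableType d1) (T2 : measurableType d2) (R : realType).
Variables (m1 : {sigma_finite_measure set T1 -> \bar R})
  (m2 : {sigma_finite_measure set T2 -> \bar R}).

HB.instance Definition _ := Measure.on (sfprod m1 m2).

Let sfprod_sigma_finite : sigma_finite setT (sfprod m1 m2).
Proof.
have /sigma_finiteP[F [TF ndF Foo]] := sigma_finiteT m1.
have /sigma_finiteP[G [TG ndG Goo]] := sigma_finiteT m2.
exists (fun n => F n `*` G n).
  rewrite -setXTT TF TG predeqE => -[x y]; split.
    move=> [/= [n _ Fnx] [k _ Gky]]; exists (maxn n k) => //; split.
    - by move: x Fnx; exact/subsetPset/ndF/leq_maxl.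
    - by move: y Gky; exact/subsetPset/ndG/leq_maxr.
  by move=> [n _ []/= ? ?]; split; exists n.
move=> k; have [? ?] := Foo k; have [? ?] := Goo k.
split; first exact: measurableX.
by rewrite /sfprod product_measure1E// lte_mul_pinfty// ge0_fin_numE.
Qed.

HB.instance Definition _ := Measure_isSigmaFinite.Build _ _ _ (sfprod m1 m2)
  sfprod_sigma_finite.

End sfprod_sigma_finite.

Section Cn_measurable.
Context {R : realType} (n : nat).

Definition Cn_coord (i : 'I_n) (v : 'rV[Cplx R]_n) :
    measurableTypeR R * measurableTypeR R :=
  (complex.Re (v ord0 i), complex.Im (v ord0 i)).

Let Cn_set0 : g_sigma_preimage Cn_coord set0.
Proof. exact: sigma_algebra0. Qed.

Let Cn_setC A :
  g_sigma_preimage Cn_coord A -> g_sigma_preimage Cn_coord (~` A).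
Proof. exact: sigma_algebraC. Qed.

Let Cn_bigcup (F : _^nat) : (forall i, g_sigma_preimage Cn_coord (F i)) ->
  g_sigma_preimage Cn_coord (\bigcup_i (F i)).
Proof. exact: sigma_algebra_bigcup. Qed.

(* The sigma-algebra generated by the 2n real coordinates, i.e., the Borel
   sigma-algebra of C^n = R^2n. *)
HB.instance Definition _ :=
  @isMeasurable.Build default_measure_display 'rV[Cplx R]_n
    (g_sigma_preimage Cn_coord) Cn_set0 Cn_setC Cn_bigcup.

Lemma measurable_Cn_coord (i : 'I_n) : measurable_fun setT (Cn_coord i).
Proof.
move=> _ Y mY; rewrite setTI; apply: sub_sigma_algebra => /=.
rewrite -bigcup_seq/=; exists i => /=; first by rewrite mem_index_enum.
by exists Y => //; rewrite setTI.
Qed.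

Lemma measurable_fun_CnP d (T : measurableType d) (f : T -> 'rV[Cplx R]_n) :
  (forall i, measurable_fun setT (Cn_coord i \o f)) -> measurable_fun setT f.
Proof.
move=> mf; apply: measurability; first by [].
move=> _ [A + <-]; rewrite -bigcup_seq/= => -[i _ [B mB <-]].
by rewrite !setTI -comp_preimage -[X in measurable X]setTI; exact: mf.
Qed.

End Cn_measurable.

Section sigma_finite_pushforward.
Context d1 d2 (T1 : measurableType d1) (T2 : measurableType d2) (R : realType).
Variables (m : {sigma_finite_measure set T1 -> \bar R}).
Variables (f : T1 -> T2) (g : T2 -> T1).

Lemma sigma_finite_pushforward : measurable_fun setT f ->
  measurable_fun setT g -> cancel f g -> sigma_finite setT (pushforward m f).
Proof.
move=> mf mg fK; have [F UF mF] := sigma_finiteT m.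
exists (fun k => g @^-1` F k).
  by rewrite -preimage_bigcup -UF preimage_setT.
move=> k; have [mFk Foo] := mF k; split.
  by rewrite -[X in measurable X]setTI; exact: mg.
rewrite /pushforward -comp_preimage (_ : g \o f = idfun) ?preimage_id//.
by apply/funext => x /=; rewrite fK.
Qed.

End sigma_finite_pushforward.

Section Cn_cons.
Context {R : realType} (n : nat).
Local Notation Rm := (measurableTypeR R).

Definition Cn_cons (p : (Rm * Rm) * 'rV[Cplx R]_n) : 'rV[Cplx R]_n.+1 :=
  \row_j oapp (p.2 ord0) (p.1.1 +i* p.1.2) (unlift ord0 j).

Definition Cn_uncons (v : 'rV[Cplx R]_n.+1) : (Rm * Rm) * 'rV[Cplx R]_n :=
  (Cn_coord ord0 v, \row_j v ord0 (lift ord0 j)).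

Lemma Cn_consK : cancel Cn_cons Cn_uncons.
Proof.
move=> [[x y] v]; rewrite /Cn_uncons /Cn_coord !mxE unlift_none/=; congr pair.
by apply/rowP => j; rewrite !mxE liftK.
Qed.

Lemma measurable_Cn_cons : measurable_fun setT Cn_cons.
Proof.
apply: measurable_fun_CnP => i; case: (unliftP ord0 i) => [j|] ->.
  rewrite (_ : _ \o _ = @Cn_coord R n j \o snd).
    by apply: measurableT_comp => //; exact: measurable_Cn_coord.
  by apply/funext => p; rewrite /= /Cn_coord !mxE liftK.
rewrite (_ : _ \o _ = fst)//.
by apply/funext => -[[x y] v]; rewrite /= /Cn_coord !mxE unlift_none.
Qed.

Lemma measurable_Cn_uncons : measurable_fun setT Cn_uncons.
Proof.
apply: measurable_fun_pair; first exact: measurable_Cn_coord.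
apply: measurable_fun_CnP => i.
rewrite (_ : _ \o _ = Cn_coord (lift ord0 i)); first exact: measurable_Cn_coord.
by apply/funext => v; rewrite /= /Cn_coord !mxE.
Qed.

Variable m : {sigma_finite_measure set 'rV[Cplx R]_n -> \bar R}.

Definition Cn_measureS : set 'rV[Cplx R]_n.+1 -> \bar R :=
  pushforward (sfprod (sfprod lebesgue_measure lebesgue_measure) m) Cn_cons.

#[local] Hint Extern 0 (measurable_fun _ Cn_cons) =>
  solve [exact: measurable_Cn_cons] : core.

Let Cn_measureS0 : Cn_measureS set0 = 0%E.
Proof. exact: measure0. Qed.

Let Cn_measureS_ge0 A : (0 <= Cn_measureS A)%E.
Proof. exact: measure_ge0. Qed.

Let Cn_measureS_sigma_additive : semi_sigma_additive Cn_measureS.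
Proof. exact: measure_semi_sigma_additive. Qed.

HB.instance Definition _ := isMeasure.Build _ _ _ Cn_measureS
  Cn_measureS0 Cn_measureS_ge0 Cn_measureS_sigma_additive.

Let Cn_measureS_sigma_finite : sigma_finite setT Cn_measureS.
Proof.
exact: (sigma_finite_pushforward _
  measurable_Cn_cons measurable_Cn_uncons Cn_consK).
Qed.

HB.instance Definition _ := Measure_isSigmaFinite.Build _ _ _ Cn_measureS
  Cn_measureS_sigma_finite.

End Cn_cons.

(* C^0 is a point, of mass 1. *)
Fixpoint lebesgue_Cn {R : realType} (n : nat) :
    {sigma_finite_measure set 'rV[Cplx R]_n -> \bar R} :=
  match n with
  | 0 => \d_(0 : 'rV[Cplx R]_0)
  | n'.+1 => Cn_measureS (lebesgue_Cn n')
  end.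

Section heisenberg.
Context {R : realType} (n : nat).

Definition heis : Type := (R * 'rV[Cplx R]_n)%type.

Definition hermitian (z w : 'rV[Cplx R]_n) : R[i] :=
  \sum_j z ord0 j * (w ord0 j)^*.

Definition Cn_norm (z : 'rV[Cplx R]_n) : R :=
  Num.sqrt (\sum_j Normc.normc (z ord0 j) ^+ 2).

Definition heis_mul (g h : heis) : heis :=
  (g.1 + h.1 + 2 * complex.Im (hermitian g.2 h.2), g.2 + h.2).

Definition heis_inv (g : heis) : heis := (- g.1, - g.2).

Definition heis_norm (g : heis) : R :=
  (Cn_norm g.2 ^+ 4 + g.1 ^+ 2) `^ (4^-1).

Definition lebesgue_heis :
    set (measurableTypeR R * 'rV[Cplx R]_n) -> \bar R :=
  sfprod lebesgue_measure (lebesgue_Cn n).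

HB.instance Definition _ := SigmaFiniteMeasure.on lebesgue_heis.

Let hermitian_self z : complex.Im (hermitian z z) = 0.
Proof.
rewrite raddf_sum big1// => j _.
by case: (z ord0 j) => a b /=; rewrite mulrN mulrC addNr.
Qed.

Lemma heis_mul0g g : heis_mul (0, 0) g = g.
Proof.
rewrite /heis_mul /= !add0r /hermitian big1 ?mulr0 ?addr0.
  by case: g.
by move=> j _; rewrite mxE mul0r.
Qed.

Lemma heis_mulVg g : heis_mul (heis_inv g) g = (0, 0).
Proof.
rewrite /heis_mul /= !addNr add0r.
rewrite (_ : hermitian _ _ = - hermitian g.2 g.2).
  by rewrite raddfN/= hermitian_self oppr0 mulr0.
by rewrite /hermitian -sumrN; apply: eq_bigr => j _; rewrite mxE mulNr.
Qed.

Definition siegel : set (Cplx R * 'rV[Cplx R]_n) :=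
  [set p | Cn_norm p.2 ^+ 2 < complex.Im p.1].

(* (s + i t, z) |-> (s + i t + i |z|^2, z), with t and (s, z) as arguments *)
Definition siegel_pi (t : R) (g : heis) : Cplx R * 'rV[Cplx R]_n :=
  (g.1 +i* (t + Cn_norm g.2 ^+ 2), g.2).

Definition siegel_height (p : Cplx R * 'rV[Cplx R]_n) : R :=
  complex.Im p.1 - Cn_norm p.2 ^+ 2.

Definition siegel_base (p : Cplx R * 'rV[Cplx R]_n) : heis :=
  (complex.Re p.1, p.2).

End heisenberg.
Arguments heis : clear implicits.
Arguments siegel : clear implicits.
Arguments lebesgue_heis : clear implicits.

Section product_domain.
Context {R : realType} {n1 n2 : nat}.

Local Notation H := (heis R n1 * heis R n2)%type.
Local Notation V :=
  ((Cplx R * 'rV[Cplx R]_n1) * (Cplx R * 'rV[Cplx R]_n2))%type.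

Definition pos_quadrant : set (R * R) := [set t | 0 < t.1 /\ 0 < t.2].

Definition U_dom : set ((R * R) * H) := pos_quadrant `*` setT.

Definition siegel2 : set V := siegel R n1 `*` siegel R n2.

Definition U_pi (x : (R * R) * H) : V :=
  (siegel_pi x.1.1 x.2.1, siegel_pi x.1.2 x.2.2).

Definition U_pi_inv (p : V) : (R * R) * H :=
  ((siegel_height p.1, siegel_height p.2), (siegel_base p.1, siegel_base p.2)).

Lemma U_piK : cancel U_pi U_pi_inv.
Proof.
move=> [[t1 t2] [[s1 z1] [s2 z2]]].
by rewrite /U_pi /U_pi_inv /siegel_height /siegel_base /= !addrK.
Qed.

Lemma U_pi_invK : cancel U_pi_inv U_pi.
Proof.
move=> [[[a1 b1] z1] [[a2 b2] z2]].
by rewrite /U_pi /U_pi_inv /siegel_pi /siegel_height /siegel_base /= !subrK.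
Qed.

Lemma U_pi_dom x : U_dom x <-> siegel2 (U_pi x).
Proof.
by split=> [[[? ?] _]|[]]; rewrite /siegel2 /siegel /= ?ltrDr; split.
Qed.

(* Functions on the domain are represented by total functions; no definition
   below depends on their values outside of [U_dom]. *)
Definition holomorphic_on_U (f : (R * R) * H -> Cplx R) : Prop :=
  forall p : V, siegel2 p -> differentiable (f \o U_pi_inv) p.

Definition lebesgue_H :
    set ((measurableTypeR R * 'rV[Cplx R]_n1) *
         (measurableTypeR R * 'rV[Cplx R]_n2)) -> \bar R :=
  sfprod (lebesgue_heis R n1) (lebesgue_heis R n2).

HB.instance Definition _ := SigmaFiniteMeasure.on lebesgue_H.

Definition hardy1_norm (f : (R * R) * H -> Cplx R) : \bar R :=
  ereal_sup [set \int[lebesgue_H]_g (Normc.normc (f (t, g)))%:E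
            | t in pos_quadrant]%E.

Definition hardy1 : set ((R * R) * H -> Cplx R) :=
  [set f | holomorphic_on_U f /\ (hardy1_norm f < +oo)%E].

Definition approach_region (g : H) : set ((R * R) * H) :=
  [set x | U_dom x /\
    heis_norm (heis_mul (heis_inv x.2.1) g.1) ^+ 2 < x.1.1 /\
    heis_norm (heis_mul (heis_inv x.2.2) g.2) ^+ 2 < x.1.2].

Definition maximal_fun (u : (R * R) * H -> Cplx R) (g : H) : \bar R :=
  ereal_sup [set (Normc.normc (u x))%:E | x in approach_region g].

End product_domain.

(* Main.v *)
(* The exponent 1/2 is what makes a maximal estimate in L^1 possible:
   F = |f(eps, .)|^(1/2) lies in L^2, and |f|^(1/2) at heights above eps is
   dominated pointwise by iterated one-dimensional maximal functions of F,
   taken along right translations in the Heisenberg factors.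

   Along the centre, w |-> f(eps + Im w, g.(Re w, 0)) is holomorphic and bounded
   in the upper half plane, so comparing it with an outer function and applying
   Jensen's inequality bounds |f|^(1/2) by the Poisson integral of F, hence by
   the maximal function of F along the centre. A horizontal displacement along
   the coordinate e_j is handled by the holomorphic curve
   z |-> f(t - |z|^2, h.(0, z e_j)) and the mean value inequality for |.|^(1/2)
   over a square of side comparable with t^(1/2): it costs two more maximal
   functions, along e_j and i e_j, and reduces to displacements with one
   coordinate fewer.

   Right translations preserve the measure, so by Calderon's transference these
   maximal operators inherit the L^2 bound of Hardy and Littlewood. Squaring
   bounds the integral of sup |f(. + eps)| over the cones by C ||f(eps, .)||_1,
   and Fatou's lemma lets eps tend to 0. *)
Require Import Defs.
From mathcomp Require Import all_boot all_order all_algebra.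
From mathcomp Require Import all_classical all_reals all_analysis.
From mathcomp Require Import complex.
From mathcomp Require Import measurable_realfun ring lra.
Import Order.TTheory GRing.Theory Num.Theory.
Import numFieldNormedType.Exports.
Local Open Scope classical_set_scope.
Local Open Scope ring_scope.
Local Open Scope complex_scope.

Set Implicit Arguments.
Unset Strict Implicit.
Unset Printing Implicit Defensive.

(** The shift by [eps] supplies what the boundary lacks. Nothing is known about values at height 0,
    while above any positive height a function of the Hardy space is bounded, by a mean value
    inequality whose average the L^1 norm controls. This bound makes [F] and its maximal functions
    finite, but it enters none of the constants, so that [eps] can be removed at the end.

    Maximal functions along lines need only the Hardy-Littlewood theorem on the line, in any
    dimension. The shape of the cones fits them: a horizontal move of size t^(1/2) disturbs the
    central coordinate by commutators of size t, which the nontangential bound in the half plane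
    absorbs. Since |z|^2 <= t/2 on the squares used, at least half of the height remains, and the
    parameters of the cone grow by controlled amounts at each of finitely many steps.

    The two factors are treated one after the other: the estimate in the second factor, valid over
    every point of the first at height [eps], is the input of the estimate in the first. This
    requires constants that do not depend on the function. *)

Notation nc := Normc.normc.

(** * Cauchy estimates and mean value inequalities on squares *)

Section modulus.
Context {R : realType}.
Implicit Types z w : R[i].

Lemma nc_ge0 z : 0 <= nc z.
Proof. by case: z => a b; exact: sqrtr_ge0. Qed.

Lemma ncE z : `|z| = (nc z)%:C.
Proof. by case: z => a b; rewrite normc_def. Qed.

Lemma ncM z w : nc (z * w) = nc z * nc w.
Proof. exact: Normc.normcM. Qed.

Lemma ncV z : nc z^-1 = (nc z)^-1.
Proof. exact: Normc.normcV. Qed.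

Lemma ncX z n : nc (z ^+ n) = nc z ^+ n.
Proof. by elim: n => [|n ih]; rewrite ?expr0 ?Normc.normc1// !exprS ncM ih. Qed.

Lemma ncD z w : nc (z + w) <= nc z + nc w.
Proof. exact: le_normcD. Qed.

Lemma ncN z : nc (- z) = nc z.
Proof. exact: normcN. Qed.

Lemma ncB z w : nc (z - w) <= nc z + nc w.
Proof. by rewrite -(ncN w) ncD. Qed.

Lemma nc_distC z w : nc (z - w) = nc (w - z).
Proof. by rewrite -ncN opprB. Qed.

Lemma nc_le_add z w : nc z <= nc w + nc (z - w).
Proof. by rewrite -[z in leLHS](subrK w) addrC ncD. Qed.

Lemma nc0 : nc (0 : R[i]) = 0.
Proof. exact: Normc.normc0. Qed.

Lemma nc_eq0 z : (nc z == 0) = (z == 0).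
Proof.
by apply/idP/idP => [/eqP/Normc.eq0_normc ->//|/eqP ->]; rewrite nc0.
Qed.

Lemma nc_gt0 z : (0 < nc z) = (z != 0).
Proof. by rewrite lt0r nc_ge0 andbT nc_eq0. Qed.

Lemma nc_sqr z : nc z ^+ 2 = complex.Re z ^+ 2 + complex.Im z ^+ 2.
Proof. by case: z => a b; rewrite /= sqr_sqrtr// addr_ge0// sqr_ge0. Qed.

Lemma nc_geRe z : `|complex.Re z| <= nc z.
Proof.
rewrite -(ler_pXn2r (n:=2))// ?nnegrE ?nc_ge0// nc_sqr real_normK ?num_real//.
by rewrite lerDl sqr_ge0.
Qed.

Lemma nc_geIm z : `|complex.Im z| <= nc z.
Proof.
rewrite -(ler_pXn2r (n:=2))// ?nnegrE ?nc_ge0// nc_sqr real_normK ?num_real//.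
by rewrite lerDr sqr_ge0.
Qed.

Lemma nc_real (x : R) : nc x%:C = `|x|.
Proof. by rewrite /= expr0n addr0 sqrtr_sqr. Qed.

Lemma nc_i (x : R) : nc (0 +i* x) = `|x|.
Proof. by rewrite /= expr0n add0r sqrtr_sqr. Qed.

Lemma nc_le_ReIm z : nc z <= `|complex.Re z| + `|complex.Im z|.
Proof.
case: z => a b.
have -> : a +i* b = a%:C + 0 +i* b by rewrite -[RHS]/((_ +i* _)) addr0 add0r.
rewrite (le_trans (ncD _ _))// nc_real nc_i.
by rewrite -[a%:C + _]/((_ +i* _)) /= addr0 add0r.
Qed.

Lemma posC_real (d : R[i]) : 0 < d -> d = (complex.Re d)%:C /\ 0 < complex.Re d.
Proof. by case: d => d di; rewrite ltcE /= => /andP[/eqP -> d0]. Qed.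

End modulus.

Section cdiff.
Context {R : realType}.
Local Notation C := (Cplx R).
Implicit Types f g : C -> C.

(* [Cplx R] carries the topology, [R[i]] the arithmetic: this names the
   differentiability of a function between plain [R[i]]'s. *)
Definition cdiff (g : R[i] -> R[i]) (z : R[i]) : Prop :=
  differentiable (g : C -> C) (z : C).

(** First-order expansion with real radii and the modulus [nc]: the form in which differentiability
    enters Goursat's argument and the continuity estimates. *)
Lemma cdiff_taylor (f : R[i] -> R[i]) (z : R[i]) : cdiff f z ->
  exists l : R[i], forall e : R, 0 < e -> exists2 d : R, 0 < d &
    forall h : R[i], nc h < d -> nc (f (z + h) - f z - l * h) <= e * nc h.
Proof.
move=> /derivable1_diffP /cvg_ex[/= l].
move=> /cvgrPdist_le fl; exists l => e e0.
have /fl : 0 < (e%:C : R[i]) by rewrite ltcR.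
move=> /nbhs_ballP[d /= /posC_real[-> d0] fd].
exists (complex.Re d) => // h hd.
have [->|h0] := eqVneq h 0.
  by rewrite addr0 subrr mulr0 subr0 nc0 mulr0.
have := fd h; rewrite /ball /= sub0r normrN ncE ltcR => /(_ hd h0).
rewrite ncE lecR => H.
rewrite (_ : _ - _ - _ = - (h * (l - h^-1 * (f (h + z) - f z)))).
  by rewrite ncN ncM mulrC ler_wpM2r ?nc_ge0//; move: H; rewrite /GRing.scale/= mulr1.
by rewrite mulrBr mulVKf// (addrC h z); ring.
Qed.

(** Serves to differentiate the Herglotz integral, whose remainder is bounded explicitly by the
    square of the increment. *)
Lemma cdiff_quad (f : R[i] -> R[i]) (z l : R[i]) (K d : R) : 0 < d ->
  (forall h : R[i], nc h < d -> nc (f (z + h) - f z - l * h) <= K * nc h ^+ 2) ->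
  cdiff f z.
Proof.
move=> d0 H; apply/derivable1_diffP/cvg_ex; exists l => /=.
apply/cvgrPdist_le => ee /posC_real[-> e0]; set e := complex.Re ee in e0 *.
have K1 : 0 < `|K| + 1 by rewrite ltr_wpDl.
apply/nbhs_ballP; exists (Num.min d (e / (`|K| + 1)))%:C => /=.
  by rewrite ltcR lt_min d0 divr_gt0.
move=> h; rewrite /ball /= sub0r normrN ncE ltcR lt_min => /andP[hd he] h0.
rewrite ncE lecR -(ler_pM2r (x := nc h)) ?nc_gt0// -ncM.
rewrite (_ : _ * h = - (f (z + h) - f z - l * h)); last first.
  rewrite /GRing.scale/= mulr1 mulrBl mulrAC mulVf// mul1r (addrC z h); ring.
rewrite ncN (le_trans (H _ hd))// expr2 mulrA ler_wpM2r ?nc_ge0//.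
have := he; rewrite ltr_pdivlMr// => /ltW; apply: le_trans.
rewrite mulrC ler_wpM2l ?nc_ge0//.
by rewrite (le_trans (ler_norm _))// lerDl.
Qed.

Lemma cdiff_modcont (f : R[i] -> R[i]) (z : R[i]) : cdiff f z ->
  forall e : R, 0 < e -> exists2 d : R, 0 < d &
    forall h : R[i], nc h < d -> nc (f (z + h) - f z) <= e.
Proof.
move=> /cdiff_taylor[l /(_ 1 ltr01)[d d0 fd]] e e0.
have l1 : 0 < nc l + 1 by rewrite ltr_wpDl ?nc_ge0.
exists (Num.min d (e / (nc l + 1))); first by rewrite lt_min d0 divr_gt0.
move=> h; rewrite lt_min => /andP[hd he].
have := nc_le_add (f (z + h) - f z) (l * h); move/le_trans; apply.
rewrite (le_trans (lerD (lexx _) (fd _ hd)))// ncM -mulrDl mulrC.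
by rewrite -ler_pdivlMr// ltW.
Qed.

Lemma cdiff_cst (k z : R[i]) : cdiff (fun=> k) z.
Proof. exact: differentiable_cst. Qed.

Lemma cdiff_id (z : R[i]) : cdiff id z.
Proof. by have /(_ z) := @linear_differentiable R[i] C C idfun; apply => x; exact: cvg_id. Qed.

Lemma cdiffD (f g : R[i] -> R[i]) z : cdiff f z -> cdiff g z ->
  cdiff (fun w => f w + g w) z.
Proof. by move=> df dg; exact: differentiableD df dg. Qed.

Lemma cdiffN (f : R[i] -> R[i]) z : cdiff f z -> cdiff (fun w => - f w) z.
Proof. by move=> df; exact: differentiableN df. Qed.

Lemma cdiffB (f g : R[i] -> R[i]) z : cdiff f z -> cdiff g z ->
  cdiff (fun w => f w - g w) z.
Proof. by move=> df dg; exact: differentiableB df dg. Qed.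

Lemma cdiffM (f g : R[i] -> R[i]) z : cdiff f z -> cdiff g z ->
  cdiff (fun w => f w * g w) z.
Proof. by move=> df dg; exact: differentiableM df dg. Qed.

Lemma cdiffX (f : R[i] -> R[i]) n z : cdiff f z -> cdiff (fun w => f w ^+ n) z.
Proof.
move=> df; elim: n => [|n ih]; first exact: cdiff_cst.
by under eq_fun do rewrite exprS; exact: cdiffM.
Qed.

Lemma cdiffV (f : R[i] -> R[i]) z : cdiff f z -> f z != 0 ->
  cdiff (fun w => (f w)^-1) z.
Proof. by move=> df f0; exact: differentiableV df f0. Qed.

Lemma cdiff_comp (f g : R[i] -> R[i]) z : cdiff f z -> cdiff g (f z) ->
  cdiff (g \o f) z.
Proof. by move=> df dg; exact: differentiable_comp df dg. Qed.

Lemma cdiff_line (V : normedModType (Cplx R)) (F : V -> Cplx R) (p d : V) (z : R[i]) :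
  differentiable F (p + (z : Cplx R) *: d) -> cdiff (fun w => F (p + (w : Cplx R) *: d)) z.
Proof.
move=> dF; rewrite /cdiff.
apply: (@differentiable_comp _ (Cplx R) V (Cplx R) (fun w => p + w *: d) F) => //.
Qed.

End cdiff.

(** * Integrals of complex-valued functions over segments *)

Section cint.
Context {R : realType}.
Notation mu := (@lebesgue_measure R).
Implicit Types (a b : R) (F G : R -> R[i]).

Lemma measurable_segment a b : measurable (`[a, b] : set (measurableTypeR R)).
Proof. exact: measurable_itv. Qed.

Lemma lebesgue_segment a b : a <= b -> mu `[a, b] = (b - a)%:E.
Proof.
by rewrite lebesgue_measure_itv/= lte_fin; case: ltgtP => //= -> _; rewrite subrr.
Qed.

Lemma Rintegral_segment_cst a b r : a <= b ->
  (\int[mu]_(x in `[a, b]) r = r * (b - a))%R.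
Proof.
move=> ab; have -> := @Rintegral_cst _ _ _ mu _ (measurable_segment a b) r.
exact: (congr1 (fun m => r * fine m) (lebesgue_segment ab)).
Qed.

(** Continuity on a segment, in terms of [nc] only, so that it can be stated for values in plain
    [R[i]]. *)
Definition segcont a b F := forall x, x \in `[a, b] -> forall e : R, 0 < e ->
  exists2 d : R, 0 < d & forall y, y \in `[a, b] -> `|y - x| < d ->
    nc (F y - F x) <= e.

(** [k] stands for the real part, the imaginary part and the modulus, all of them 1-Lipschitz. *)
Lemma segcont_within a b F (k : R[i] -> R) :
  (forall z w, `|k z - k w| <= nc (z - w)) ->
  segcont a b F -> {within `[a, b], continuous (k \o F)}.
Proof.
move=> kL cF; apply/subspace_continuousP => x /= xab.
apply/cvgrPdist_le => e e0.
have [d d0 H] := cF x xab e e0.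
rewrite near_withinE; apply/nbhs_ballP; exists d => // y.
rewrite /ball /= distrC => yx yab.
by rewrite (le_trans (kL _ _))// nc_distC H.
Qed.

Lemma segcont_integrable a b F (k : R[i] -> R) :
  (forall z w, `|k z - k w| <= nc (z - w)) ->
  segcont a b F -> mu.-integrable `[a, b] (EFin \o (k \o F)).
Proof.
move=> kL cF; apply: continuous_compact_integrable; first exact: segment_compact.
exact: segcont_within.
Qed.

Lemma Re_lip (z w : R[i]) : `|complex.Re z - complex.Re w| <= nc (z - w).
Proof. by rewrite -raddfB nc_geRe. Qed.

Lemma Im_lip (z w : R[i]) : `|complex.Im z - complex.Im w| <= nc (z - w).
Proof. by rewrite -raddfB nc_geIm. Qed.

Lemma nc_lip (z w : R[i]) : `|nc z - nc w| <= nc (z - w).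
Proof.
rewrite ler_norml lerBrDl (addrC (nc w)) lerBlDl nc_le_add andbT.
by rewrite addrC lerBlDr nc_distC nc_le_add.
Qed.

Lemma segcontD a b F G : segcont a b F -> segcont a b G ->
  segcont a b (fun x => F x + G x).
Proof.
move=> cF cG x xab e e0; have e2 : 0 < e / 2 by rewrite divr_gt0.
have [d1 d10 H1] := cF x xab _ e2; have [d2 d20 H2] := cG x xab _ e2.
exists (Num.min d1 d2); first by rewrite lt_min d10.
move=> y yab; rewrite lt_min => /andP[y1 y2].
rewrite (_ : _ - _ = (F y - F x) + (G y - G x)); last by ring.
by rewrite (le_trans (ncD _ _))// [leRHS](splitr e) lerD ?H1 ?H2.
Qed.

Lemma segcontZ a b F k : segcont a b F -> segcont a b (fun x => k * F x).
Proof.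
move=> cF x xab e e0.
have k1 : 0 < nc k + 1 by rewrite ltr_wpDl ?nc_ge0.
have [d d0 H] := cF x xab (e / (nc k + 1)) (divr_gt0 e0 k1).
exists d => // y yab yx; rewrite -mulrBr ncM.
rewrite (le_trans (ler_wpM2l (nc_ge0 _) (H _ yab yx)))// mulrCA ler_piMr ?ltW//.
by rewrite ltr_pdivrMr// mul1r ltrDl.
Qed.

Lemma segcont_cst a b k : segcont a b (fun=> k).
Proof. by move=> x _ e e0; exists 1 => // y _ _; rewrite subrr nc0 ltW. Qed.

Definition cint a b F : R[i] :=
  (\int[mu]_(x in `[a, b]) complex.Re (F x))%R +i*
  (\int[mu]_(x in `[a, b]) complex.Im (F x))%R.

Lemma eq_cint a b F G : (forall x, x \in `[a, b] -> F x = G x) ->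
  cint a b F = cint a b G.
Proof.
by move=> FG; rewrite /cint; congr (_ +i* _); apply: eq_Rintegral => x;
  rewrite inE => /FG ->.
Qed.

Lemma cintD a b F G : segcont a b F -> segcont a b G ->
  cint a b (fun x => F x + G x) = cint a b F + cint a b G.
Proof.
move=> cF cG; rewrite /cint -[RHS]/(_ +i* _).
have iF k kL := @segcont_integrable a b F k kL cF.
have iG k kL := @segcont_integrable a b G k kL cG.
congr (_ +i* _).
  rewrite -(@RintegralD _ _ _ mu _ _ _ (measurable_segment _ _) (iF _ Re_lip) (iG _ Re_lip)).
  by apply: eq_Rintegral => x _; rewrite raddfD.
rewrite -(@RintegralD _ _ _ mu _ _ _ (measurable_segment _ _) (iF _ Im_lip) (iG _ Im_lip)).
by apply: eq_Rintegral => x _; rewrite raddfD.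
Qed.

Lemma cintZ a b F k : segcont a b F ->
  cint a b (fun x => k * F x) = k * cint a b F.
Proof.
move=> cF; case: k => p q; rewrite /cint -[RHS]/(_ +i* _).
have iF k kL := @segcont_integrable a b F k kL cF.
have mI := measurable_segment a b.
have iFz (k : R[i] -> R) (kL : forall z w, `|k z - k w| <= nc (z - w)) c : mu.-integrable `[a, b] (EFin \o (fun x => c * k (F x))).
  by have := integrableZl mI c (iF k kL).
congr (_ +i* _).
  rewrite -(RintegralZl p mI (iF _ Re_lip)) -(RintegralZl q mI (iF _ Im_lip)).
  rewrite -(RintegralB mI (iFz _ Re_lip _) (iFz _ Im_lip _)).
  by apply: eq_Rintegral => x _; case: (F x).
rewrite -(RintegralZl p mI (iF _ Im_lip)) -(RintegralZl q mI (iF _ Re_lip)).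
rewrite -(RintegralD mI (iFz _ Im_lip _) (iFz _ Re_lip _)).
by apply: eq_Rintegral => x _; case: (F x) => ? ? /=; rewrite addrC.
Qed.

Lemma cintB a b F G : segcont a b F -> segcont a b G ->
  cint a b (fun x => F x - G x) = cint a b F - cint a b G.
Proof.
move=> cF cG; rewrite -[in RHS]mulN1r -(cintZ _ cG) -cintD//; last exact: segcontZ.
by apply: eq_cint => x _; rewrite mulN1r.
Qed.

Lemma cint_cst a b k : a <= b -> cint a b (fun=> k) = (b - a)%:C * k.
Proof.
move=> ab; case: k => p q; rewrite /cint -[RHS]/(_ +i* _) /=.
by rewrite !Rintegral_segment_cst// !mul0r subr0 addr0 !(mulrC (b - a)).
Qed.

Lemma cint_split a m b F : a <= m -> m <= b -> segcont a b F ->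
  cint a b F = cint a m F + cint m b F.
Proof.
move=> am mb cF; rewrite /cint -[RHS]/(_ +i* _).
have iF k kL := @segcont_integrable a b F k kL cF.
have E k : mu.-integrable `[a, b] (EFin \o (k \o F)) ->
    (\int[mu]_(x in `[a, b]) k (F x) =
    \int[mu]_(x in `[a, m]) k (F x) + \int[mu]_(x in `[m, b]) k (F x))%R.
  move=> ik; have := @Rintegral_itvB R (k \o F) (BLeft a) (BRight b) m ik.
  rewrite !bnd_simp => /(_ am mb) /eqP; rewrite subr_eq => /eqP ->.
  rewrite addrC; congr (_ + _); apply: (@Rintegral_itv_obnd_cbnd _ _ _ (k \o F)).
  apply: integrableS ik => //; apply: subset_itv; rewrite bnd_simp//.
by congr (_ +i* _); apply: E; apply: iF; [exact: Re_lip|exact: Im_lip].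
Qed.

(** Real and imaginary parts are bounded separately; this is the source of the factor 2, which is
    harmless below. *)
Lemma nc_cint a b F : segcont a b F ->
  nc (cint a b F) <= 2 * (\int[mu]_(x in `[a, b]) nc (F x))%R.
Proof.
move=> cF; rewrite (le_trans (nc_le_ReIm _))// mulr_natl mulr2n.
have iF k kL := @segcont_integrable a b F k kL cF.
have mI := measurable_segment a b.
have in_ := iF _ nc_lip.
have E (k : R[i] -> R) (kL : forall z w, `|k z - k w| <= nc (z - w)) :
    (forall z, `|k z| <= nc z) ->
    `|\int[mu]_(x in `[a, b]) k (F x)| <= \int[mu]_(x in `[a, b]) nc (F x).
  move=> kn; rewrite (le_trans (@le_normr_Rintegral _ _ _ mu _ _ mI (iF _ kL)))//.
  apply: (@le_Rintegral _ _ _ mu) => //; first exact: (integrable_norm (iF _ kL)).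
  by move=> x _; exact: kn.
by rewrite lerD//=; apply: E; (exact: Re_lip || exact: Im_lip ||
  exact: nc_geRe || exact: nc_geIm).
Qed.

Lemma nc_cint_le a b F M : a <= b -> segcont a b F ->
  (forall x, x \in `[a, b] -> nc (F x) <= M) ->
  nc (cint a b F) <= 2 * M * (b - a).
Proof.
move=> ab cF FM; rewrite (le_trans (nc_cint cF))// -mulrA ler_wpM2l//.
have mI := measurable_segment a b.
rewrite -Rintegral_segment_cst//.
apply: (@le_Rintegral _ _ _ mu) => //.
- exact: (segcont_integrable nc_lip cF).
- by have := @segcont_integrable a b (fun=> 0) (fun=> M);
    apply; [move=> ? ?; rewrite subrr normr0 nc_ge0|exact: segcont_cst].
Qed.

Lemma Im_cint a b (F : R -> R[i]) : complex.Im (cint a b F) =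
  (\int[mu]_(x in `[a, b]) complex.Im (F x))%R.
Proof. by []. Qed.

End cint.

#[local] Opaque cint cdiff.

(** * Goursat, Cauchy and the maximum modulus principle on rectangles *)

Section goursat.
Context {R : realType}.
Implicit Types (f g : R[i] -> R[i]) (a b c d x y : R).

(** The contour integral around the rectangle, counterclockwise: bottom minus top, then ['i] times
    right minus left. *)
Definition rint (g : R[i] -> R[i]) a b c d : R[i] :=
  cint a b (fun x => g (x +i* c)) - cint a b (fun x => g (x +i* d)) +
  'i * (cint c d (fun y => g (b +i* y)) - cint c d (fun y => g (a +i* y))).

Definition rectangle a b c d : set R[i] :=
  [set z | complex.Re z \in `[a, b] /\ complex.Im z \in `[c, d]].

Lemma rectangleE a b c d z : rectangle a b c d z ->
  [/\ a <= complex.Re z, complex.Re z <= b, c <= complex.Im z & complex.Im z <= d].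
Proof. by rewrite /rectangle/= !in_itv/= => -[/andP[? ?] /andP[? ?]]. Qed.

Definition rcont (g : R[i] -> R[i]) a b c d := [/\
  segcont a b (fun x => g (x +i* c)), segcont a b (fun x => g (x +i* d)),
  segcont c d (fun y => g (b +i* y)) & segcont c d (fun y => g (a +i* y))].

Lemma ncBh (x x' y : R) : nc ((x +i* y) - (x' +i* y)) = `|x - x'|.
Proof. by rewrite -[_ - _]/(_ +i* _) subrr -nc_real. Qed.

Lemma ncBv (x y y' : R) : nc ((x +i* y) - (x +i* y')) = `|y - y'|.
Proof. by rewrite -[_ - _]/(_ +i* _) subrr nc_i. Qed.

Lemma segcont_h (g : R[i] -> R[i]) a b y :
  (forall x, x \in `[a, b] -> cdiff g (x +i* y)) ->
  segcont a b (fun x => g (x +i* y)).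
Proof.
move=> dg x xab e e0.
have [d d0 H] := cdiff_modcont (dg x xab) e0.
exists d => // x' _ xx.
have := H ((x' +i* y) - (x +i* y)); rewrite ncBh => /(_ xx).
by rewrite [X in g X](_ : _ = x' +i* y)//; ring.
Qed.

Lemma segcont_v (g : R[i] -> R[i]) x c d :
  (forall y, y \in `[c, d] -> cdiff g (x +i* y)) ->
  segcont c d (fun y => g (x +i* y)).
Proof.
move=> dg y yab e e0.
have [r r0 H] := cdiff_modcont (dg y yab) e0.
exists r => // y' _ yy.
have := H ((x +i* y') - (x +i* y)); rewrite ncBv => /(_ yy).
by rewrite [X in g X](_ : _ = x +i* y')//; ring.
Qed.

Definition frame a b c d : set R[i] := rectangle a b c d `&`
  [set z | [|| complex.Re z == a, complex.Re z == b,
               complex.Im z == c | complex.Im z == d]].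

Lemma rcont_frame (g : R[i] -> R[i]) a b c d : a <= b -> c <= d ->
  (forall z, frame a b c d z -> cdiff g z) -> rcont g a b c d.
Proof.
move=> ab cd dg; split; [apply: (segcont_h (g := g))|apply: (segcont_h (g := g))|
  apply: (segcont_v (g := g))|apply: (segcont_v (g := g))] => x xab; apply: dg;
  by split; rewrite /= ?eqxx ?orbT//; split; rewrite //= in_itv/= ?lexx ?ab ?cd.
Qed.

Lemma rcont_diff (g : R[i] -> R[i]) a b c d : a <= b -> c <= d ->
  (forall z, rectangle a b c d z -> cdiff g z) -> rcont g a b c d.
Proof. by move=> ab cd dg; apply: rcont_frame ab cd _ => z [/dg]. Qed.

Lemma rint_splitx (g : R[i] -> R[i]) a m b c d : a <= m -> m <= b ->
  rcont g a b c d -> rint g a b c d = rint g a m c d + rint g m b c d.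
Proof.
move=> am mb [c1 c2 c3 c4].
by rewrite /rint (cint_split am mb c1) (cint_split am mb c2); ring.
Qed.

Lemma rint_splity (g : R[i] -> R[i]) a b c m d : c <= m -> m <= d ->
  rcont g a b c d -> rint g a b c d = rint g a b c m + rint g a b m d.
Proof.
move=> am mb [c1 c2 c3 c4].
by rewrite /rint (cint_split am mb c3) (cint_split am mb c4); ring.
Qed.

Lemma rintD f g a b c d : rcont f a b c d -> rcont g a b c d ->
  rint (fun z => f z + g z) a b c d = rint f a b c d + rint g a b c d.
Proof.
move=> [? ? ? ?] [? ? ? ?].
by rewrite /rint !cintD//; ring.
Qed.

Lemma nc_rint_le g a b c d M : a <= b -> c <= d -> rcont g a b c d ->
  (forall z, frame a b c d z -> nc (g z) <= M) ->
  nc (rint g a b c d) <= 4 * M * ((b - a) + (d - c)).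
Proof.
move=> ab cd [c1 c2 c3 c4] gM; rewrite /rint.
have ain : a \in `[a, b] by rewrite in_itv/= lexx.
have bin : b \in `[a, b] by rewrite in_itv/= lexx ab.
have cin : c \in `[c, d] by rewrite in_itv/= lexx.
have din : d \in `[c, d] by rewrite in_itv/= lexx cd.
have h1 : nc (cint a b (fun x => g (x +i* c))) <= 2 * M * (b - a).
  by apply: nc_cint_le => // x xab; apply: gM; split; rewrite /= ?eqxx ?orbT.
have h2 : nc (cint a b (fun x => g (x +i* d))) <= 2 * M * (b - a).
  by apply: nc_cint_le => // x xab; apply: gM; split; rewrite /= ?eqxx ?orbT.
have h3 : nc (cint c d (fun y => g (b +i* y))) <= 2 * M * (d - c).
  by apply: nc_cint_le => // x xab; apply: gM; split; rewrite /= ?eqxx ?orbT.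
have h4 : nc (cint c d (fun y => g (a +i* y))) <= 2 * M * (d - c).
  by apply: nc_cint_le => // x xab; apply: gM; split; rewrite /= ?eqxx ?orbT.
rewrite (le_trans (ncD _ _))// ncM nc_i normr1 mul1r.
rewrite (le_trans (lerD (ncB _ _) (ncB _ _)))//.
rewrite (le_trans (lerD (lerD h1 h2) (lerD h3 h4)))//.
by rewrite le_eqVlt; apply/orP; left; apply/eqP; ring.
Qed.

(** On opposite sides the values differ by a constant, and the two products of side lengths cancel.
    This removes the first-order part in Goursat's argument without appeal to primitives. *)
Lemma rint_affine (k l : R[i]) a b c d : a <= b -> c <= d ->
  rint (fun z => k + l * z) a b c d = 0.
Proof.
move=> ab cd.
have cl : rcont (fun z => k + l * z) a b c d.
  apply: rcont_diff ab cd _ => z _; apply: cdiffD; first exact: cdiff_cst.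
  by apply: cdiffM; [exact: cdiff_cst|exact: cdiff_id].
case: cl => ? ? ? ?; rewrite /rint -!cintB//.
rewrite (@eq_cint _ _ _ _ (fun=> l * (0 +i* (c - d)))); last first.
  by move=> x _; rewrite opprD addrACA subrr add0r -mulrBr -[_ - _]/(_ +i* _) subrr.
rewrite (@eq_cint _ c d _ (fun=> l * (b - a)%:C)); last first.
  by move=> x _; rewrite opprD addrACA subrr add0r -mulrBr -[_ - _]/(_ +i* _) subrr.
rewrite !cint_cst// (_ : 0 +i* (c - d) = - ('i * (d - c)%:C)); last first.
  by apply/eqP; rewrite eq_complex /=; apply/andP; split; apply/eqP; ring.
by ring.
Qed.

Lemma rectangleS a b c d a' b' c' d' : a <= a' -> b' <= b -> c <= c' -> d' <= d ->
  rectangle a' b' c' d' `<=` rectangle a b c d.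
Proof.
move=> aa bb cc dd [x y]; rewrite /rectangle/= !in_itv/=.
move=> [/andP[? ?] /andP[? ?]]; rewrite (le_trans aa)// (le_trans cc)//.
by rewrite (le_trans _ bb)// (le_trans _ dd).
Qed.

(** The integrals over the four quarters add up to the whole one, so one of them has at least a
    quarter of its modulus. *)
Lemma rint_quarter g a b c d M : a <= b -> c <= d ->
  (forall z, rectangle a b c d z -> cdiff g z) -> M <= nc (rint g a b c d) ->
  exists r : R * R, [/\ a <= r.1, r.1 + (b - a) / 2 <= b,
    c <= r.2, r.2 + (d - c) / 2 <= d &
    M / 4 <= nc (rint g r.1 (r.1 + (b - a) / 2) r.2 (r.2 + (d - c) / 2))].
Proof.
move=> ab cd dg hM.
have amb : a <= a + (b - a) / 2 <= b by lra.
have cmd : c <= c + (d - c) / 2 <= d by lra.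
set m := a + (b - a) / 2 in amb; set n := c + (d - c) / 2 in cmd.
have [am mb] := andP amb; have [cn nd] := andP cmd.
have cg a' b' c' d' : a <= a' -> a' <= b' -> b' <= b -> c <= c' -> c' <= d' ->
    d' <= d -> rcont g a' b' c' d'.
  by move=> *; apply: rcont_diff => // z zr; apply: dg; apply: rectangleS zr.
have E : rint g a b c d = rint g a m c n + rint g a m n d +
    (rint g m b c n + rint g m b n d).
  rewrite (rint_splitx am mb); last exact: cg.
  by rewrite !(rint_splity cn nd)//; exact: cg.
have [|h1] := leP (M / 4) (nc (rint g a m c n)).
  by exists (a, c).
have mE : b = m + (b - a) / 2 by rewrite /m; clear; lra.
have nE : d = n + (d - c) / 2 by rewrite /n; clear; lra.
have [h|h2] := leP (M / 4) (nc (rint g a m n d)).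
  by exists (a, n); rewrite /= -nE; split.
have [h|h3] := leP (M / 4) (nc (rint g m b c n)).
  by exists (m, c); rewrite /= -mE; split.
have [h|h4] := leP (M / 4) (nc (rint g m b n d)).
  by exists (m, n); rewrite /= -nE -mE; split.
have := le_trans (ncD _ _) (lerD (ncD (rint g a m c n) (rint g a m n d)) (ncD (rint g m b c n) (rint g m b n d))).
rewrite -E => h; have := le_lt_trans (le_trans hM h) (ltrD (ltrD h1 h2) (ltrD h3 h4)).
by move=> M4; exfalso; move: M4; clear; lra.
Qed.

(* Goursat: quarter the rectangle repeatedly. *)
Lemma rint_eq0 g a b c d : a <= b -> c <= d ->
  (forall z, rectangle a b c d z -> cdiff g z) -> rint g a b c d = 0.
Proof.
move=> ab cd dg; apply/eqP; rewrite -nc_eq0; apply/negPn/negP => /eqP/eqP I0.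
have {I0} : 0 < nc (rint g a b c d) by rewrite lt0r I0 nc_ge0.
set I := nc _ => I0; set p := b - a; set q := d - c.
have p0 : 0 <= p by rewrite subr_ge0.
have q0 : 0 <= q by rewrite subr_ge0.
have h2 n : 0 <= (2^-1 : R) ^+ n by rewrite exprn_ge0// invr_ge0.
pose good (n : nat) (r : R * R) := [/\ a <= r.1, r.1 + p * 2^-1 ^+ n <= b,
    c <= r.2, r.2 + q * 2^-1 ^+ n <= d &
    I * 4^-1 ^+ n <= nc (rint g r.1 (r.1 + p * 2^-1 ^+ n) r.2 (r.2 + q * 2^-1 ^+ n))].
have step (n : nat) (r : R * R) : good n r -> {s | good n.+1 s /\
  [/\ r.1 <= s.1, s.1 + p * 2^-1 ^+ n.+1 <= r.1 + p * 2^-1 ^+ n,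
     r.2 <= s.2 & s.2 + q * 2^-1 ^+ n.+1 <= r.2 + q * 2^-1 ^+ n]}.
  move=> [g1 g2 g3 g4 g5]; apply: cid.
  have := @rint_quarter g r.1 (r.1 + p * 2^-1 ^+ n) r.2 (r.2 + q * 2^-1 ^+ n)
     (I * 4^-1 ^+ n).
  rewrite !lerDl !mulr_ge0// => /(_ isT isT).
  case=> // [z zr|s]; first by apply: dg; apply: rectangleS zr.
  rewrite !(addrAC _ (_ * _)) !subrr !add0r.
  have hE (x : R) : x * 2^-1 ^+ n / 2 = x * 2^-1 ^+ n.+1 by rewrite exprSr mulrA.
  rewrite !hE -mulrA -exprSr => -[s1 s2 s3 s4 s5]; exists s; split; split => //.
  - exact: le_trans s1.
  - exact: le_trans g2.
  - exact: le_trans s3.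
  - exact: le_trans g4.
have g0 : good 0 (a, c).
  have aE : a + (b - a) = b by rewrite addrC subrK.
  have cE : c + (d - c) = d by rewrite addrC subrK.
  by rewrite /good/= !expr0 !mulr1 /p /q aE cE; split; exact: lexx.
(* The recursion runs in a sigma type: each stage carries the invariant [good] that [step]
   consumes. *)
pose sq := fix sq n : {r | good n r} := if n is m.+1 then
    let: exist r gr := sq m in let: exist s (conj gs _) := step m r gr in exist _ s gs
  else exist _ (a, c) g0.
pose u n := sval (sq n).
have ug n : good n (u n) by rewrite /u; case: (sq n).
have us n : [/\ (u n).1 <= (u n.+1).1,
     (u n.+1).1 + p * 2^-1 ^+ n.+1 <= (u n).1 + p * 2^-1 ^+ n,
     (u n).2 <= (u n.+1).2 &
     (u n.+1).2 + q * 2^-1 ^+ n.+1 <= (u n).2 + q * 2^-1 ^+ n].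
  by rewrite /u /=; case: (sq n) => r gr /=; case: (step n r gr) => s [].
have mono (v : nat -> R) : (forall n, v n <= v n.+1) -> forall n m, (n <= m)%N -> v n <= v m.
  by move=> vS n m nm; apply: (homo_leq (r := fun x y : R => x <= y)) => //;
     [move=> ? ? ?; exact: le_trans].
(* Nested intervals: left ends increase, right ends decrease, and the supremum of the left ends lies
   in all of them. *)
have lim (v : nat -> R) (L : R) : (forall n, v n <= v n.+1) ->
    (forall n, v n.+1 + L * 2^-1 ^+ n.+1 <= v n + L * 2^-1 ^+ n) -> 0 <= L ->
    exists x, forall n, v n <= x <= v n + L * 2^-1 ^+ n.
  move=> v1 v2 L0.
  have m1 := mono _ v1.
  have m2 n m : (n <= m)%N -> v m + L * 2^-1 ^+ m <= v n + L * 2^-1 ^+ n.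
    move=> nm; rewrite -lerN2.
    by apply: (mono (fun n => - (v n + L * 2^-1 ^+ n))) => // k; rewrite lerN2.
  have b1 n m : v n <= v m + L * 2^-1 ^+ m.
    have [nm|/ltnW mn] := leqP n m.
      by rewrite (le_trans (m1 _ _ nm))// lerDl mulr_ge0.
    by rewrite (le_trans _ (m2 _ _ mn))// lerDl mulr_ge0.
  have hs : has_sup (range v).
    by split; [exists (v 0%N); exists 0%N|exists (v 0%N + L * 2^-1 ^+ 0) => _ [n _ <-]].
  exists (sup (range v)) => n; apply/andP; split.
    by apply: ub_le_sup; [case: hs|exists n].
  by apply: ge_sup; [case: hs|move=> _ [k _ <-]].
have [x xP] := lim (fun n => (u n).1) p (fun n => let: And4 h _ _ _ := us n in h)
  (fun n => let: And4 _ h _ _ := us n in h) p0.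
have [y yP] := lim (fun n => (u n).2) q (fun n => let: And4 _ _ h _ := us n in h)
  (fun n => let: And4 _ _ _ h := us n in h) q0.
have zr : rectangle a b c d (x +i* y).
  have := xP 0%N; have := yP 0%N; rewrite /u/= !expr0 !mulr1 /p /q.
  by rewrite !(addrC _ (_ - _)) !subrK /rectangle /= !in_itv.
have [l tl] := cdiff_taylor (dg _ zr).
(* At stage [n] the length estimate gives at most [4 (p + q)^2 e 4^-n], against the lower bound
   [I 4^-n]. The added 1 makes this strictly contradictory, also when [p + q = 0]. *)
have K0 : 0 < 4 * (p + q) ^+ 2 + 1 by rewrite ltr_wpDl// mulr_ge0// sqr_ge0.
have e0 : 0 < I / (4 * (p + q) ^+ 2 + 1) by rewrite divr_gt0.
have [r r0 H] := tl _ e0; set e := I / _ in e0 H.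
have [n hn] : exists n, (p + q) * 2^-1 ^+ n < r.
  have : `|2^-1 : R| < 1 by rewrite ger0_norm ?invr_ge0// invf_lt1// ltr1n.
  move=> /(@cvg_geometric _ (p + q))/cvgrPdist_lt/(_ r r0)[N _ /(_ N (leqnn N))/=].
  rewrite sub0r normrN ger0_norm; first by exists N.
  by rewrite mulr_ge0// addr_ge0.
have [g1 g2 g3 g4 g5] := ug n.
(* The remainder of the expansion of [g] at the limit point; it has the same contour integrals as
   [g], since it differs from it by an affine function. *)
pose h (z : R[i]) := g z - (g (x +i* y) - l * (x +i* y)) - l * z.
have hE z : h z = g ((x +i* y) + (z - (x +i* y))) - g (x +i* y) - l * (z - (x +i* y)).
  by rewrite /h [(_ +i* _) + _]addrC subrK; ring.
have sub z : rectangle (u n).1 ((u n).1 + p * 2^-1 ^+ n) (u n).2 ((u n).2 + q * 2^-1 ^+ n) z ->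
   nc (z - (x +i* y)) <= (p + q) * 2^-1 ^+ n.
  move=> /rectangleE[s1 s2 t1 t2].
  have /andP[x1 x2] := xP n; have /andP[y1 y2] := yP n.
  by rewrite (le_trans (nc_le_ReIm _))// !raddfB mulrDl lerD// ler_norml /=; clear -s1 s2 t1 t2 x1 x2 y1 y2; lra.
have dh z : rectangle a b c d z -> cdiff h z.
  move=> /dg dgz.
  exact: (cdiffB (cdiffB dgz (cdiff_cst _ _)) (cdiffM (cdiff_cst _ _) (cdiff_id _))).
have ab' : (u n).1 <= (u n).1 + p * 2^-1 ^+ n by rewrite lerDl mulr_ge0.
have cd' : (u n).2 <= (u n).2 + q * 2^-1 ^+ n by rewrite lerDl mulr_ge0.
have rh : rcont h (u n).1 ((u n).1 + p * 2^-1 ^+ n) (u n).2 ((u n).2 + q * 2^-1 ^+ n).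
  by apply: rcont_diff ab' cd' _ => z zz; apply: dh; apply: rectangleS zz.
have := nc_rint_le ab' cd' rh (M := e * ((p + q) * 2^-1 ^+ n)).
rewrite !(addrAC _ (_ * _)) !subrr !add0r => B.
have {B} : nc (rint h (u n).1 ((u n).1 + p * 2^-1 ^+ n) (u n).2 ((u n).2 + q * 2^-1 ^+ n)) <=
    4 * (e * ((p + q) * 2^-1 ^+ n)) * (q * 2^-1 ^+ n + p * 2^-1 ^+ n).
  apply: B => z [/sub zz _]; rewrite hE (le_trans (H _ _))//; first exact: le_lt_trans hn.
  by rewrite ler_wpM2l// ltW.
have -> : rint h (u n).1 ((u n).1 + p * 2^-1 ^+ n) (u n).2 ((u n).2 + q * 2^-1 ^+ n) =
    rint g (u n).1 ((u n).1 + p * 2^-1 ^+ n) (u n).2 ((u n).2 + q * 2^-1 ^+ n).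
  have -> : h = (fun z => g z + ((l * (x +i* y) - g (x +i* y)) + (- l) * z)).
    by apply/funext => z; rewrite /h; ring.
  rewrite rintD ?rint_affine ?addr0//.
    by apply: rcont_diff ab' cd' _ => z zz; apply: dg; apply: rectangleS zz.
  apply: rcont_diff ab' cd' _ => z zz.
  exact: (cdiffD (cdiff_cst _ _) (cdiffM (cdiff_cst _ _) (cdiff_id _))).
move=> /(le_trans g5).
have -> : 4^-1 ^+ n = (2^-1 ^+ n) ^+ 2 :> R.
  by rewrite -exprM mulnC exprM; congr (_ ^+ _); rewrite exprVn -natrX.
have -> : 4 * (e * ((p + q) * 2^-1 ^+ n)) * (q * 2^-1 ^+ n + p * 2^-1 ^+ n) =
   (4 * (p + q) ^+ 2) * e * (2^-1 ^+ n) ^+ 2 by ring.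
rewrite ler_pM2r ?exprn_gt0 ?invr_gt0//.
by rewrite /e mulrCA ler_pMr// ler_pdivlMr// mul1r gerDl ler10.
Qed.

Lemma cdiff_cauchy_kernel g (z0 z : R[i]) : z != z0 -> cdiff g z ->
  cdiff (fun w => g w / (w - z0)) z.
Proof.
move=> zz0 dg; apply: (cdiffM dg); apply: cdiffV; last by rewrite subr_eq0.
by apply: cdiffB; [exact: cdiff_id|exact: cdiff_cst].
Qed.

(* Up to the value of the constant, this is the Cauchy integral over a centred
   square. *)
Lemma rint_inv_ge (p q e : R) : 0 < e ->
  4 <= nc (rint (fun w => (w - (p +i* q))^-1) (p - e) (p + e) (q - e) (q + e)).
Proof.
move=> e0; set k := fun w => _.
have ab : p - e <= p + e by lra.
have cd : q - e <= q + e by lra.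
have e2 x : 0 < (x - p) ^+ 2 + e ^+ 2 by rewrite ltr_wpDl ?sqr_ge0// exprn_gt0.
have e3 x : 0 < (x - q) ^+ 2 + e ^+ 2 by rewrite ltr_wpDl ?sqr_ge0// exprn_gt0.
have dk z : z != p +i* q -> cdiff k z.
  move=> zpq; apply: cdiffV; last by rewrite subr_eq0.
  by apply: cdiffB; [exact: cdiff_id|exact: cdiff_cst].
have ch y : y != q -> segcont (p - e) (p + e) (fun x => k (x +i* y)).
  move=> yq; apply: segcont_h => x _; apply: dk.
  by apply: contra yq => /eqP[_ ->].
have cv x : x != p -> segcont (q - e) (q + e) (fun y => k (x +i* y)).
  move=> xp; apply: segcont_v => y _; apply: dk.
  by apply: contra xp => /eqP[->].
have n1 : q - e != q by rewrite lt_eqF// ltrBlDr ltrDl.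
have n2 : q + e != q by rewrite gt_eqF// ltrDl.
have n3 : p - e != p by rewrite lt_eqF// ltrBlDr ltrDl.
have n4 : p + e != p by rewrite gt_eqF// ltrDl.
have kE (x y : R) : k (x +i* y) = ((x - p) / ((x - p) ^+ 2 + (y - q) ^+ 2)) +i*
    (- (y - q) / ((x - p) ^+ 2 + (y - q) ^+ 2)).
  by rewrite /k -[(_ +i* _) - _]/(_ +i* _) -[LHS]/((_ +i* _)) mulNr.
rewrite /rint -!cintB//; try by [exact: ch|exact: cv].
rewrite (@eq_cint _ _ _ _ (fun x => 0 +i* (2 * e / ((x - p) ^+ 2 + e ^+ 2)))); last first.
  move=> x _; rewrite !kE -[_ - _]/(_ +i* _); congr (_ +i* _).
    by rewrite [q - e]addrC [q + e]addrC !addrK sqrrN subrr.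
  rewrite [q - e]addrC [q + e]addrC !addrK sqrrN opprK -mulrBl.
  by congr (_ / _); ring.
rewrite (@eq_cint _ (q - e) _ _ (fun y => (2 * e / ((y - q) ^+ 2 + e ^+ 2)) +i* 0)); last first.
  move=> y _; rewrite !kE [p - e]addrC [p + e]addrC !addrK sqrrN [e ^+ 2 + _]addrC.
  rewrite -[_ - _]/(_ +i* _); congr (_ +i* _); last by rewrite subrr.
  by rewrite -mulrBl; congr (_ / _); ring.
apply: (le_trans _ (nc_geIm _)).
Transparent cint.
rewrite /cint /=.
rewrite mul0r add0r mul1r (le_trans _ (ler_norm _))//.
(* Here [(x - r)^2 <= e^2], so the integrand is at least [1 / e] on a segment of length [2 e]. The
   two pairs of sides contribute 2 each. *)
have E (r : R) : (\int[@lebesgue_measure R]_(x in `[(r - e)%R, (r + e)%R]) (2 * e / ((x - r) ^+ 2 + e ^+ 2)) >= 2)%R.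
  have rr : r - e <= r + e by lra.
  have er : 0 < 2 * e by lra.
  rewrite [leLHS](_ : _ = e^-1 * (r + e - (r - e))); last first.
    by rewrite opprB addrC addrA subrK -mulr2n mulrnAr mulVf ?gt_eqF.
  rewrite -Rintegral_segment_cst//.
  have pos x : 0 < (x - r) ^+ 2 + e ^+ 2 by rewrite ltr_wpDl ?sqr_ge0// exprn_gt0.
  have cc (f : R -> R) : continuous f -> (@lebesgue_measure R).-integrable `[r - e, r + e] (EFin \o f).
    move=> cf; apply: continuous_compact_integrable; first exact: segment_compact.
    by apply: continuous_subspaceT => x; exact: cf.
  apply: (@le_Rintegral _ _ _ (@lebesgue_measure R)) => //.
  - by apply: cc => x; exact: cvg_cst.
  - apply: cc => x; apply: cvgM; first exact: cvg_cst.
    apply: cvgV; first by rewrite gt_eqF.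
    apply: cvgD; last exact: cvg_cst.
    by rewrite expr2; apply: cvgM; apply: cvgB; (exact: cvg_id || exact: cvg_cst).
  - move=> x; rewrite /= in_itv/= => /andP[x1 x2].
    rewrite ler_pdivlMr// -ler_pdivlMl ?invr_gt0// invrK.
    by have : (x - r) ^+ 2 <= e ^+ 2; [rewrite -ler_sqrt ?sqr_ge0// !sqrtr_sqr (gtr0_norm e0) ler_norml; lra|nra].
by have := E p; have := E q; lra.
Qed.

(** Goursat shrinks the contour to a small square around the point. There [g] is its central value
    plus a small error, and 4 is the lower bound for the integral of the kernel, in place of 2
    pi. *)
Lemma cauchy_rectangle g (a b c d p q : R) : p \in `]a, b[ -> q \in `]c, d[ ->
  (forall z, rectangle a b c d z -> cdiff g z) ->
  4 * nc (g (p +i* q)) <= nc (rint (fun z => g z / (z - (p +i* q))) a b c d).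
Proof.
move=> pI qI dg.
have /andP[ap pb] : a < p < b by move: pI; rewrite in_itv.
have /andP[cq qd] : c < q < d by move: qI; rewrite in_itv.
set z0 := p +i* q; set k := fun z : R[i] => g z / (z - z0).
have rz0 : rectangle a b c d z0 by rewrite /rectangle /= !in_itv/= !ltW.
have dk z : rectangle a b c d z -> z != z0 -> cdiff k z.
  by move=> zr zz; apply: cdiff_cauchy_kernel => //; exact: dg.
(* Four rectangles are cut away in turn, on the left, on the right, below and above; the kernel is
   holomorphic on each. *)
have red e : 0 < e -> a <= p - e -> p + e <= b -> c <= q - e -> q + e <= d ->
    rint k a b c d = rint k (p - e) (p + e) (q - e) (q + e).
  move=> e0 h1 h2 h3 h4.
  have n1 : p - e < p by lra.
  have n2 : p < p + e by lra.
  have n3 : q - e < q by lra.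
  have n4 : q < q + e by lra.
  have ne (x y : R) : (x != p) || (y != q) -> x +i* y != z0.
    by rewrite -negb_and; apply: contra => /eqP[-> ->]; rewrite !eqxx.
  have ck a' b' c' d' : a <= a' -> a' <= b' -> b' <= b ->
      c <= c' -> c' <= d' -> d' <= d -> a' != p -> b' != p -> c' != q -> d' != q ->
      rcont k a' b' c' d'.
    move=> i1 i2 i3 i4 i5 i6 m1 m2 m3 m4.
    have S z := @rectangleS a b c d a' b' c' d' i1 i3 i4 i6 z.
    apply: rcont_frame i2 i5 _ => z [zr o]; apply: dk; first exact: S.
    case: z o {zr} => x y /= o; apply: ne.
    by case/or4P: o => /eqP ->; rewrite ?m1 ?m2 ?m3 ?m4 ?orbT.
  have zer a' b' c' d' : a <= a' -> a' <= b' -> b' <= b ->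
      c <= c' -> c' <= d' -> d' <= d -> [|| b' < p, p < a', d' < q | q < c'] ->
      rint k a' b' c' d' = 0.
    move=> i1 i2 i3 i4 i5 i6 o; apply: rint_eq0 => // -[x y] zr.
    apply: dk; first exact: rectangleS zr.
    apply: ne; move: zr; rewrite /rectangle/= !in_itv/= => -[/andP[j1 j2] /andP[j3 j4]].
    case/or4P: o => o; apply/orP; [left|left|right|right].
    - by rewrite lt_eqF// (le_lt_trans j2).
    - by rewrite gt_eqF// (lt_le_trans o).
    - by rewrite lt_eqF// (le_lt_trans j4).
    - by rewrite gt_eqF// (lt_le_trans o).
  have [m1 m2] : p - e != p /\ p + e != p by rewrite lt_eqF// gt_eqF.
  have [m3 m4] : q - e != q /\ q + e != q by rewrite lt_eqF// gt_eqF.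
  have [l1 l2] : a != p /\ b != p by rewrite lt_eqF// gt_eqF.
  have [l3 l4] : c != q /\ d != q by rewrite lt_eqF// gt_eqF.
  have o1 : a <= p + e by lra.
  have o2 : p - e <= b by lra.
  have o3 : c <= q + e by lra.
  have o4 : q - e <= d by lra.
  have o5 : p - e <= p + e by lra.
  have o6 : q - e <= q + e by lra.
  have o7 : a <= b by clear -ap pb; lra.
  have o8 : c <= d by clear -cq qd; lra.
  rewrite (rint_splitx h1 o2 (ck _ _ _ _ _ _ _ _ _ _ _ _ _ _)); try exact: lexx; try by [].
  rewrite (zer a (p - e) c d _ _ _ _ _ _ _) ?n1 ?lexx// add0r.
  rewrite (rint_splitx o5 h2 (ck _ _ _ _ _ _ _ _ _ _ _ _ _ _)); try exact: lexx; try by [].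
  rewrite (zer (p + e) b c d _ _ _ _ _ _ _) ?n2 ?lexx ?orbT// addr0.
  rewrite (rint_splity h3 o4 (ck _ _ _ _ _ _ _ _ _ _ _ _ _ _)); try exact: lexx; try by [].
  rewrite (zer (p - e) (p + e) c (q - e) _ _ _ _ _ _ _) ?n3 ?lexx ?orbT// add0r.
  rewrite (rint_splity o6 h4 (ck _ _ _ _ _ _ _ _ _ _ _ _ _ _)); try exact: lexx; try by [].
  by rewrite (zer (p - e) (p + e) (q + e) d _ _ _ _ _ _ _) ?n4 ?lexx ?orbT// addr0.
apply/ler_addgt0Pr => e e0.
(* The length estimate on a square of side [2 s] will give [4 (e / 32 / s) (4 s) = e / 2]. *)
have e320 : 0 < e / 32 by rewrite divr_gt0.
have [r r0 H] := cdiff_modcont (dg _ rz0) e320.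
(* With [s <= r / 3] all points of the square are within [2 s < r] of the centre; the other terms
   keep the square inside the rectangle. *)
pose s := Num.min (r / 3) (Num.min (Num.min (p - a) (b - p)) (Num.min (q - c) (d - q))).
have s0 : 0 < s by rewrite !lt_min !subr_gt0 ap pb cq qd divr_gt0.
have : s <= s by [].
rewrite {2}/s !le_min => /andP[sr /andP[/andP[s1 s2] /andP[s3 s4]]].
rewrite (red s s0 ltac:(clear -s1; lra) ltac:(clear -s2; lra)
  ltac:(clear -s3; lra) ltac:(clear -s4; lra)).
have ps : p - s <= p + s by lra.
have qs : q - s <= q + s by lra.
have bdne (z : R[i]) : frame (p - s) (p + s) (q - s) (q + s) z -> s <= nc (z - z0).
  move=> [_ /= o]; have [j|j] : s <= `|complex.Re (z - z0)| \/ s <= `|complex.Im (z - z0)|.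
    rewrite !raddfB /=; case/or4P: o => /eqP ->; [left|left|right|right].
    - by rewrite addrAC subrr add0r normrN ler_norm.
    - by rewrite addrAC subrr add0r ler_norm.
    - by rewrite addrAC subrr add0r normrN ler_norm.
    - by rewrite addrAC subrr add0r ler_norm.
  - exact: le_trans (nc_geRe _).
  - exact: le_trans (nc_geIm _).
have S z := @rectangleS a b c d (p - s) (p + s) (q - s) (q + s)
  ltac:(clear -s1; lra) ltac:(clear -s2; lra) ltac:(clear -s3; lra) ltac:(clear -s4; lra) z.
have ck (h : R[i] -> R[i]) : (forall z, rectangle a b c d z -> cdiff h z) ->
    rcont (fun z => h z / (z - z0)) (p - s) (p + s) (q - s) (q + s).
  move=> dh; apply: rcont_frame ps qs _ => z zf.
  apply: cdiff_cauchy_kernel (dh _ (S _ (proj1 zf))).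
  by rewrite -subr_eq0 -nc_gt0 (lt_le_trans s0)// bdne.
have kE : k = fun z => (g z - g z0) / (z - z0) + g z0 * (z - z0)^-1.
  by apply/funext => z; rewrite /k mulrBl subrK.
have rk0 : rcont (fun z => g z0 * (z - z0)^-1) (p - s) (p + s) (q - s) (q + s).
  by apply: (ck (fun=> g z0)) => z _; exact: cdiff_cst.
have rk1 : rcont (fun z => (g z - g z0) / (z - z0)) (p - s) (p + s) (q - s) (q + s).
  by apply: (ck (fun z => g z - g z0)) => z zr; apply: cdiffB; [exact: dg|exact: cdiff_cst].
have rk2 : rcont (fun z => (z - z0)^-1) (p - s) (p + s) (q - s) (q + s).
  have := ck (fun=> 1) (fun z _ => cdiff_cst 1 z).
  by under eq_fun do rewrite mul1r.
have -> : rint k (p - s) (p + s) (q - s) (q + s) =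
    rint (fun z => (g z - g z0) / (z - z0)) (p - s) (p + s) (q - s) (q + s) +
    g z0 * rint (fun z => (z - z0)^-1) (p - s) (p + s) (q - s) (q + s).
  rewrite kE rintD//; congr (_ + _).
  by case: rk2 => ? ? ? ?; rewrite /rint !cintZ//; ring.
set I1 := rint _ _ _ _ _; set I0 := rint _ _ _ _ _.
have hI1 : nc I1 <= e.
  apply: (le_trans (nc_rint_le ps qs rk1 (M := e / 32 / s) _)).
    move=> z /[dup] -[zr _] /bdne zb; rewrite ncM ncV.
    rewrite ler_pM ?invr_ge0 ?nc_ge0 ?lef_pV2 ?posrE// ?(lt_le_trans s0)//.
    have := H (z - z0); rewrite [z0 + _]addrC subrK; apply.
    have [x1 x2 y1 y2] := rectangleE zr.
    rewrite (le_lt_trans (nc_le_ReIm _))// !raddfB.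
    have : `|complex.Re z - complex.Re z0| <= s by rewrite ler_norml /=; clear -x1 x2; lra.
    have : `|complex.Im z - complex.Im z0| <= s by rewrite ler_norml /=; clear -y1 y2; lra.
    by move: (`|_|) (`|_|) => u v; clear -sr s0; lra.
  rewrite [leLHS](_ : _ = e / 2); last by field; rewrite gt_eqF.
  by lra.
have := rint_inv_ge p q s0; rewrite -/z0 -/I0 => hI0.
have : nc (g z0 * I0) <= nc (I1 + g z0 * I0) + nc I1.
  by rewrite -{1}(addKr I1 (g z0 * I0)) addrC (le_trans (ncB _ _))//.
rewrite ncM; have : nc (g z0) * 4 <= nc (g z0) * nc I0 by rewrite ler_wpM2l ?nc_ge0.
by move: hI1; move: (nc I1) (nc I0) (nc (g z0)) (nc _); clear => *; lra.
Qed.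

(** Cauchy's estimate for [g ^+ n] has a constant [K] that does not depend on [n]. If the value [u]
    at the point exceeded [M], the powers of [u / M] would be unbounded, although all are at most
    [K]. *)
Lemma max_modulus g (a b c d p q M : R) : p \in `]a, b[ -> q \in `]c, d[ ->
  (forall z, rectangle a b c d z -> cdiff g z) ->
  (forall z, frame a b c d z -> nc (g z) <= M) ->
  nc (g (p +i* q)) <= M.
Proof.
move=> /[dup] pab + /[dup] qcd; rewrite !in_itv/= => /andP[ap pb] /andP[cq qd] dg gM.
have ab : a <= b by rewrite ltW// (lt_trans ap).
have cd : c <= d by rewrite ltW// (lt_trans cq).
set s := Num.min (Num.min (p - a) (b - p)) (Num.min (q - c) (d - q)).
have s0 : 0 < s by rewrite !lt_min !subr_gt0 ap pb cq qd.
have [s1 s2 s3 s4] : [/\ s <= p - a, s <= b - p, s <= q - c & s <= d - q].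
  by have : s <= s by []; rewrite {2}/s !le_min => /andP[/andP[? ?] /andP[? ?]].
have M0 : 0 <= M.
  rewrite (le_trans (nc_ge0 (g (a +i* q))))// gM //; split; rewrite /= ?eqxx//.
  by split; rewrite /= in_itv/= ?lexx// !ltW.
rewrite leNgt; apply/negP => Mg.
pose K := 4 * s^-1 * ((b - a) + (d - c)).
have bound n : 4 * nc (g (p +i* q)) ^+ n <= K * M ^+ n.
  have dgn z : rectangle a b c d z -> cdiff (fun z => g z ^+ n) z by move=> /dg; exact: cdiffX.
  rewrite -ncX (le_trans (cauchy_rectangle pab qcd dgn))//.
  have bdne (z : R[i]) : frame a b c d z -> s <= nc (z - (p +i* q)).
    move=> [_ /= o]; have [j|j] : s <= `|complex.Re (z - (p +i* q))| \/ s <= `|complex.Im (z - (p +i* q))|.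
      rewrite !raddfB /=; case/or4P: o => /eqP ->; [left|left|right|right].
      - by rewrite distrC (le_trans s1)// ler_norm.
      - by rewrite (le_trans s2)// ler_norm.
      - by rewrite distrC (le_trans s3)// ler_norm.
      - by rewrite (le_trans s4)// ler_norm.
    - exact: le_trans (nc_geRe _).
    - exact: le_trans (nc_geIm _).
  rewrite /K (_ : 4 * _ * _ * _ = 4 * (M ^+ n / s) * (b - a + (d - c))); last by ring.
  apply: (nc_rint_le ab cd).
    apply: (rcont_frame ab cd) => z /[dup] -[zr _] /bdne o.
    apply: cdiff_cauchy_kernel (dgn _ zr).
    by rewrite -subr_eq0 -nc_gt0 (lt_le_trans s0).
  move=> z zf; rewrite ncM ncV ncX.
  have zn := bdne _ zf.
  rewrite ler_pM ?exprn_ge0 ?invr_ge0 ?nc_ge0//; last first.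
    by rewrite lef_pV2 ?posrE// (lt_le_trans s0).
  by rewrite lerXn2r ?nnegrE ?nc_ge0// gM.
have K0 : 0 <= K.
  by rewrite /K !mulr_ge0 ?invr_ge0 ?(ltW s0)// addr_ge0// subr_ge0.
have [M00|Mpos] := eqVneq M 0.
  have := bound 1%N; rewrite !expr1 M00 mulr0.
  by move: Mg; rewrite M00 => Mg; rewrite leNgt mulr_gt0.
have {Mpos M0} M0 : 0 < M by rewrite lt0r Mpos.
set u := nc (g _) in bound Mg.
have uM : 1 < u / M by rewrite ltr_pdivlMr// mul1r.
have B n : (u / M) ^+ n <= K.
  rewrite expr_div_n ler_pdivrMr ?exprn_gt0// (le_trans _ (bound n))//.
  by rewrite ler_peMl// ?exprn_ge0 ?nc_ge0// ler1n.
have [n hn] : exists n : nat, K < n%:R * (u / M - 1).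
  have um1 : 0 < u / M - 1 by rewrite subr_gt0.
  exists (Num.truncn (K / (u / M - 1))).+1.
  by rewrite -ltr_pdivrMr// truncnS_gt.
have := le_trans (ltW (lt_le_trans hn _)) (B n).
(* Bernoulli's inequality. *)
have : 1 + n%:R * (u / M - 1) <= (u / M) ^+ n.
  have -> : (u / M) ^+ n = (1 + (u / M - 1)) ^+ n by rewrite addrCA subrr addr0.
  elim: (n) => [|k ih]; first by rewrite expr0 mul0r addr0.
  rewrite exprS -natr1 (le_trans _ (ler_wpM2l _ ih))//; last by lra.
  by have := sqr_ge0 (u / M - 1); have := ler0n R k; move: (u / M) (k%:R) => *; nra.
by move=> h _; have := B n; move: hn h; move: (_ * _) (_ ^+ _) => *; lra.
Qed.

End goursat.

(** * Measurability by rounding, and extension from rectangles *)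

Section rounding.
Context d (T : measurableType d) (R : realType).

Lemma measurable_fun_countable (I : countType) (k : T -> I) (v : I -> R) :
  (forall i, measurable (k @^-1` [set i])) -> measurable_fun setT (v \o k).
Proof.
move=> mk _ Y mY; rewrite setTI.
rewrite (_ : _ @^-1` Y = \bigcup_(i in v @^-1` Y) k @^-1` [set i]).
  rewrite bigcup_mkcond; apply: countable_bigcupT_measurable.
    exact: countableP.
  by move=> i; case: ifPn.
by apply/seteqP; split=> [x /= Yx|x [i Yi /= kx]]; [exists (k x)|rewrite /= kx].
Qed.

(* A function that is continuous along a roundoff of its argument to a
   countable set is measurable: no comparison of the sigma-algebra with the
   Borel sets is needed. *)
Lemma measurable_fun_rounding (I : countType) (k : nat -> T -> I)
    (v : nat -> I -> R) (f : T -> R) :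
  (forall n i, measurable (k n @^-1` [set i])) ->
  (forall x, v n (k n x) @[n --> \oo] --> f x) -> measurable_fun setT f.
Proof.
move=> mk vf; apply/measurable_EFinP.
apply: (measurable_realfun.emeasurable_fun_cvg (fun n => EFin \o (v n \o k n))).
  by move=> n; apply/measurable_EFinP; exact: measurable_fun_countable.
by move=> x _; apply: cvg_EFin; [exact: nearW|exact: vf].
Qed.

End rounding.

Section grid.
Context {R : realType}.
Notation Rm := (measurableTypeR R).

Definition grid (n : nat) (x : R) : int := Num.floor (n.+1%:R * x).
Definition grid_pt (n : nat) (i : int) : R := i%:~R / n.+1%:R.

Lemma grid_ptP n x : `|x - grid_pt n (grid n x)| <= n.+1%:R^-1.
Proof.
have /andP[h1 h2] := floor_itv (n.+1%:R * x).
have n0 : 0 < n.+1%:R :> R by rewrite ltr0n.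
have n0' : 0 < n.+1%:R^-1 :> R by rewrite invr_gt0.
rewrite -(ler_pM2l n0) divff ?gt_eqF// -[in leLHS](gtr0_norm n0) -normrM mulrBr.
rewrite /grid_pt /grid mulrCA divff ?gt_eqF// mulr1 ler_norml.
by move: h1 h2; rewrite intrD; move: (Num.floor _)%:~R => u h1 h2; lra.
Qed.

Lemma measurable_grid n i : measurable (grid n @^-1` [set i] : set Rm).
Proof.
have n0 : 0 < n.+1%:R :> R by rewrite ltr0n.
rewrite (_ : _ @^-1` _ = `[i%:~R / n.+1%:R, (i + 1)%:~R / n.+1%:R[%classic).
  exact: measurable_itv.
apply/seteqP; split => x /=; rewrite in_itv/= ler_pdivrMr// ltr_pdivlMr// mulrC.
  by move=> <-; exact: floor_itv.
by move=> h; apply/floor_def.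
Qed.

Lemma cvg_grid_err : (fun n => n.+1%:R^-1 : R) @ \oo --> (0 : R).
Proof. exact: cvg_harmonic. Qed.

(** Rounding both coordinates to the grid reduces joint continuity to measurability for the product
    sigma-algebra. *)
Lemma measurable_fun_plane (G : R * R -> R) :
  (forall p e, 0 < e -> exists2 d, 0 < d & forall q, `|q.1 - p.1| < d ->
     `|q.2 - p.2| < d -> `|G q - G p| <= e) ->
  measurable_fun setT (G : Rm * Rm -> R).
Proof.
move=> cG; apply: (@measurable_fun_rounding _ _ _ _
  (fun n (p : Rm * Rm) => (grid n p.1, grid n p.2))
  (fun n ij => G (grid_pt n ij.1, grid_pt n ij.2))).
  move=> n [i j]; rewrite (_ : _ @^-1` _ =
    (grid n @^-1` [set i]) `*` (grid n @^-1` [set j])).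
    by apply: measurableX; exact: measurable_grid.
  by apply/seteqP; split=> [[x y] [/= -> ->]|[x y] [/= -> ->]].
move=> p; apply/cvgrPdist_le => e e0; have [d d0 H] := cG p e e0.
have /cvgrPdist_lt/(_ _ d0) := cvg_grid_err; apply: filterS => n.
rewrite sub0r normrN ger0_norm ?invr_ge0// => nd.
by rewrite distrC H//= distrC (le_lt_trans (grid_ptP _ _)).
Qed.

End grid.

Section clamp.
Context {R : realType}.
Implicit Types a b x y : R.

(** The projection of the line onto the segment. Composing with it extends a function on a rectangle
    continuously to the plane, which yields total measurable integrands. *)
Definition clamp a b x : R := Num.max a (Num.min b x).

Lemma clamp_in a b x : a <= b -> clamp a b x \in `[a, b].
Proof. by move=> ab; rewrite in_itv/= /clamp le_max lexx/= ge_max ab ge_min lexx. Qed.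

Lemma clamp_id a b x : x \in `[a, b] -> clamp a b x = x.
Proof. by rewrite in_itv/= => /andP[ax xb]; rewrite /clamp (min_idPr xb) (max_idPr ax). Qed.

Lemma clamp_lip a b x y : `|clamp a b x - clamp a b y| <= `|x - y|.
Proof.
have M u v : `|Num.max a u - Num.max a v| <= `|u - v|.
  have := ler_norm (u - v); have := lerNnormlW (lexx `|u - v|).
  move: (`|u - v|) => m m1 m2; rewrite ler_norml.
  by case: (leP a u) => ?; case: (leP a v) => ?; lra.
have N u v : `|Num.min b u - Num.min b v| <= `|u - v|.
  have := ler_norm (u - v); have := lerNnormlW (lexx `|u - v|).
  move: (`|u - v|) => m m1 m2; rewrite ler_norml.
  by case: (leP b u) => ?; case: (leP b v) => ?; lra.
by rewrite /clamp (le_trans (M _ _)).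
Qed.

Lemma clamp_continuous g a b c d : a <= b -> c <= d ->
  (forall z, rectangle a b c d z -> cdiff g z) ->
  forall (p : R * R) e, 0 < e -> exists2 r, 0 < r & forall q : R * R,
   `|q.1 - p.1| < r -> `|q.2 - p.2| < r ->
   `|nc (g (clamp a b q.1 +i* clamp c d q.2)) -
     nc (g (clamp a b p.1 +i* clamp c d p.2))| <= e.
Proof.
move=> ab cd dg p e e0; set z := clamp a b p.1 +i* clamp c d p.2.
have zr : rectangle a b c d z by split; exact: clamp_in.
have [r r0 H] := cdiff_modcont (dg _ zr) e0.
exists (r / 2) => [|q q1 q2]; first by rewrite divr_gt0.
apply: le_trans (nc_lip _ _) _; set w := _ +i* _.
rewrite [X in g X](_ : w = z + (w - z)); last by ring.
apply: H; rewrite (le_lt_trans (nc_le_ReIm _))// !raddfB [ltRHS]splitr ltrD//.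
  exact: le_lt_trans (clamp_lip _ _ _ _) q1.
exact: le_lt_trans (clamp_lip _ _ _ _) q2.
Qed.

Lemma plane_continuous (G : R * R -> R) :
  (forall p e, 0 < e -> exists2 d, 0 < d & forall q, `|q.1 - p.1| < d ->
     `|q.2 - p.2| < d -> `|G q - G p| <= e) -> continuous G.
Proof.
move=> cG p; apply/cvgrPdist_le => e e0; have [d d0 H] := cG p e e0.
apply: (@nbhs_ballP R (R * R)%type p _).2; exists d => //= q [/= q1 q2].
by rewrite distrC H// distrC.
Qed.

Lemma rectangle_bounded g a b c d : a <= b -> c <= d ->
  (forall z, rectangle a b c d z -> cdiff g z) ->
  exists B, forall z, rectangle a b c d z -> nc (g z) <= B.
Proof.
move=> ab cd dg; pose G (p : R * R) := nc (g (clamp a b p.1 +i* clamp c d p.2)).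
have cG : continuous G by apply: plane_continuous; exact: clamp_continuous.
have := @compact_EVT_max _ R G (`[a, b] `*` `[c, d]).
case.
- by exists (a, c); split; rewrite /= in_itv/= lexx.
- by apply: compact_setX; exact: segment_compact.
- exact: continuous_subspaceT.
move=> w _ H; exists (G w) => -[x y] [/= xr yr].
have := H (x, y); rewrite {1}/G /= !clamp_id//; apply.
by rewrite inE.
Qed.

End clamp.

(** * Mean value inequalities for the modulus and for its square root *)

Section submean.
Context {R : realType}.
Notation mu := (@lebesgue_measure R).
Implicit Types (g : R[i] -> R[i]) (p q r : R).
Local Open Scope ereal_scope.

Lemma segment_average (T : measurableTypeR R -> \bar R) (a b a' b' c : R) (J : \bar R) :
  (a <= a')%R -> (a' <= b')%R -> (b' <= b)%R -> (0 <= c)%R ->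
  measurable_fun setT T -> (forall x, 0 <= T x) ->
  (forall x, (x \in `[a', b'])%R -> c%:E <= T x) ->
  \int[mu]_(x in `[a, b]) T x <= J -> (c * (b' - a'))%:E <= J.
Proof.
move=> aa ab bb c0 mT T0 cT; apply: le_trans.
have mT' D : measurable_fun (D : set (measurableTypeR R)) T by exact: measurable_funS mT.
rewrite EFinM -(lebesgue_segment ab) -(@integral_cst _ _ _ mu _ (measurable_segment a' b') c%:E).
apply: (@le_trans _ _ (\int[mu]_(x in `[a', b']) T x)).
  apply: ge0_le_integral => //; exact: measurable_segment.
apply: ge0_subset_integral => //; try exact: measurable_segment.
by apply: subset_itv; rewrite bnd_simp.
Qed.

Lemma Rintegral_segcont (a b : R) (F : R -> R[i]) : segcont a b F ->
  (\int[mu]_(x in `[a, b]) nc (F x))%:E = \int[mu]_(x in `[a, b]) (nc (F x))%:E.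
Proof.
move=> cF; rewrite /Rintegral fineK//.
apply: integrable_fin_num; first exact: measurable_segment.
exact: (segcont_integrable (@nc_lip R) cF).
Qed.

Definition square p q r := @rectangle R (p - r) (p + r) (q - r) (q + r).

(** The four sides move independently in the outer part of the square, where the kernel is at most
    [2 / r]. Each side is enlarged to the full width of the square, so that its integral depends on
    one parameter only; this prepares the averaging over frames. *)
Lemma cauchy_frame_le g p q r (x0 x1 y0 y1 : R) : (0 < r)%R ->
  (forall z, square p q r z -> cdiff g z) ->
  (x0 \in `[p - r, p - r / 2])%R -> (x1 \in `[p + r / 2, p + r])%R ->
  (y0 \in `[q - r, q - r / 2])%R -> (y1 \in `[q + r / 2, q + r])%R ->
  (r * nc (g (p +i* q)))%:E <=
    \int[mu]_(x in `[(p - r)%R, (p + r)%R]) (nc (g (x +i* y0)))%:E +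
    \int[mu]_(x in `[(p - r)%R, (p + r)%R]) (nc (g (x +i* y1)))%:E +
   (\int[mu]_(y in `[(q - r)%R, (q + r)%R]) (nc (g (x1 +i* y)))%:E +
    \int[mu]_(y in `[(q - r)%R, (q + r)%R]) (nc (g (x0 +i* y)))%:E).
Proof.
move=> r0 dg; rewrite !in_itv/= => /andP[a1 a2] /andP[b1 b2] /andP[c1 c2] /andP[d1 d2].
have S z : rectangle x0 x1 y0 y1 z -> square p q r z by apply: rectangleS.
have X : (x0 <= x1)%R by lra.
have Y : (y0 <= y1)%R by lra.
have pin : (p \in `]x0, x1[)%R by rewrite in_itv/=; lra.
have qin : (q \in `]y0, y1[)%R by rewrite in_itv/=; lra.
have dg' z : rectangle x0 x1 y0 y1 z -> cdiff g z by move=> /S/dg.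
pose k z := (g z / (z - (p +i* q)))%R.
have fr z : frame x0 x1 y0 y1 z -> (r / 2 <= nc (z - (p +i* q)))%R.
  move=> [_ /= o]; have [j|j] : (r / 2 <= `|complex.Re (z - (p +i* q))|)%R \/ (r / 2 <= `|complex.Im (z - (p +i* q))|)%R.
    rewrite !raddfB /=; case/or4P: o => /eqP ->; [left|left|right|right].
    - by rewrite distrC (le_trans _ (ler_norm _))//; lra.
    - by rewrite (le_trans _ (ler_norm _))//; lra.
    - by rewrite distrC (le_trans _ (ler_norm _))//; lra.
    - by rewrite (le_trans _ (ler_norm _))//; lra.
  - exact: le_trans (nc_geRe _).
  - exact: le_trans (nc_geIm _).
have dk z : frame x0 x1 y0 y1 z -> cdiff k z.
  move=> /[dup] -[zr _] /fr o; apply: cdiff_cauchy_kernel (dg' _ zr).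
  by rewrite -subr_eq0 -nc_gt0 (lt_le_trans _ o)// divr_gt0.
have kle z : frame x0 x1 y0 y1 z -> (nc (k z) <= 2 / r * nc (g z))%R.
  move=> /fr o; rewrite /k ncM ncV mulrC ler_wpM2r ?nc_ge0//.
  by rewrite -[(2 / r)%R]invf_div lef_pV2// posrE ?divr_gt0// (lt_le_trans _ o)// divr_gt0.
have [k1 k2 k3 k4] := rcont_frame X Y dk.
have cgh y : (y \in `[y0, y1])%R -> segcont (p - r) (p + r) (fun x => g (x +i* y)).
  rewrite in_itv/= => yy; apply: (segcont_h (g := g)) => x xx; apply: dg; split => //=.
  by rewrite in_itv/=; lra.
have cgv x : (x \in `[x0, x1])%R -> segcont (q - r) (q + r) (fun y => g (x +i* y)).
  rewrite in_itv/= => yy; apply: (segcont_v (g := g)) => y yyy; apply: dg; split => //=.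
  by rewrite in_itv/=; lra.
(* The 2 of [nc_cint] times the bound [2 / r] of the kernel; the resulting 4 cancels that of
   [cauchy_rectangle]. *)
have side (a b a' b' : R) (F G : R -> R[i]) : (a <= a')%R -> (b' <= b)%R ->
    segcont a' b' F -> segcont a b G ->
    (forall x, x \in `[a', b'] -> nc (F x) <= 2 / r * nc (G x))%R ->
    (nc (cint a' b' F) <= 4 / r * \int[mu]_(x in `[a, b]) nc (G x))%R.
  move=> aa bb cF cG FG; rewrite (le_trans (nc_cint cF))//.
  rewrite (_ : (4 / r = 2 * (2 / r))%R); last by ring.
  rewrite -mulrA ler_wpM2l//.
  have iG := segcont_integrable (@nc_lip R) cG.
  have iF := segcont_integrable (@nc_lip R) cF.
  have r2 : (0 <= 2 / r)%R by rewrite divr_ge0// ltW.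
  rewrite -lee_fin EFinM !Rintegral_segcont// -ge0_integralZl_EFin//; last 2 first.
  - by move=> *; rewrite lee_fin nc_ge0.
  - exact: measurable_int iG.
  have mG : measurable_fun (`[a, b] : set (measurableTypeR R)) (fun x => (2 / r)%:E * (nc (G x))%:E).
    by apply: emeasurable_funM => //; exact: measurable_int iG.
  have sub : `[a', b']%classic `<=` `[a, b]%classic by apply: subset_itv; rewrite bnd_simp.
  apply: (@le_trans _ _ (\int[mu]_(x in `[a', b']) ((2 / r)%:E * (nc (G x))%:E))).
    apply: ge0_le_integral => //.
    - by move=> *; rewrite lee_fin nc_ge0.
    - exact: measurable_int iF.
    - by apply: measurable_funS sub mG; exact: measurable_segment.
  apply: ge0_subset_integral => //; try exact: measurable_segment.
  by move=> *; rewrite mule_ge0// lee_fin// nc_ge0.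
have x0in : (x0 \in `[x0, x1])%R by rewrite in_itv/= lexx X.
have x1in : (x1 \in `[x0, x1])%R by rewrite in_itv/= lexx X.
have y0in : (y0 \in `[y0, y1])%R by rewrite in_itv/= lexx Y.
have y1in : (y1 \in `[y0, y1])%R by rewrite in_itv/= lexx Y.
have px : (x1 <= p + r)%R by [].
have h1 : (nc (cint x0 x1 (fun x => k (x +i* y0))) <= 4 / r * \int[mu]_(x in `[(p - r)%R, (p + r)%R]) nc (g (x +i* y0)))%R.
  by apply: side (cgh _ y0in) _ => // x xx; apply: kle; split; rewrite /= ?eqxx ?orbT//.
have h2 : (nc (cint x0 x1 (fun x => k (x +i* y1))) <= 4 / r * \int[mu]_(x in `[(p - r)%R, (p + r)%R]) nc (g (x +i* y1)))%R.
  by apply: side (cgh _ y1in) _ => // x xx; apply: kle; split; rewrite /= ?eqxx ?orbT//.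
have h3 : (nc (cint y0 y1 (fun y => k (x1 +i* y))) <= 4 / r * \int[mu]_(y in `[(q - r)%R, (q + r)%R]) nc (g (x1 +i* y)))%R.
  by apply: side (cgv _ x1in) _ => // x xx; apply: kle; split; rewrite /= ?eqxx ?orbT//.
have h4 : (nc (cint y0 y1 (fun y => k (x0 +i* y))) <= 4 / r * \int[mu]_(y in `[(q - r)%R, (q + r)%R]) nc (g (x0 +i* y)))%R.
  by apply: side (cgv _ x0in) _ => // x xx; apply: kle; split; rewrite /= ?eqxx ?orbT//.
rewrite -!Rintegral_segcont; try by [exact: cgh|exact: cgv].
rewrite -!EFinD lee_fin.
have := cauchy_rectangle pin qin dg'; rewrite -/k /rint.
move=> /le_trans/(_ (ncD _ _)); rewrite ncM nc_i normr1 mul1r.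
move=> /le_trans/(_ (lerD (ncB _ _) (ncB _ _))).
move=> /le_trans/(_ (lerD (lerD h1 h2) (lerD h3 h4))).
rewrite -!mulrDr; move: (_ + _)%R => U.
by rewrite -mulrA ler_pM2l// -ler_pdivrMl ?invr_gt0// invrK.
Qed.

Definition square_integral (h : R -> R -> \bar R) p q r :=
  \int[mu]_(x in `[(p - r)%R, (p + r)%R])
    \int[mu]_(y in `[(q - r)%R, (q + r)%R]) h x y.

Let sq p q r : set (measurableTypeR R * measurableTypeR R) :=
  `[(p - r)%R, (p + r)%R] `*` `[(q - r)%R, (q + r)%R].

Let msq p q r : measurable (sq p q r).
Proof. by apply: measurableX; exact: measurable_segment. Qed.

Lemma eq_square_integral (h k : R -> R -> \bar R) p q r :
  (forall x y, square p q r (x +i* y) -> h x y = k x y) ->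
  square_integral h p q r = square_integral k p q r.
Proof.
move=> hk; apply: eq_integral => x /set_mem/= xi; apply: eq_integral => y /set_mem/= yi.
by rewrite hk.
Qed.

Lemma square_integralE (H : measurableTypeR R * measurableTypeR R -> \bar R) p q r :
  measurable_fun setT H -> (forall w, 0 <= H w) ->
  square_integral (fun x y => H (x, y)) p q r = \int[mu \x mu]_(w in sq p q r) H w.
Proof.
move=> mH H0; rewrite [RHS]integral_mkcond fubini_tonelli1; last 2 first.
- exact: ((measurable_restrictT _ (msq p q r)).1 (measurable_funTS mH)).
- by move=> w; rewrite erestrict_ge0.
rewrite /square_integral integral_mkcond; apply: eq_integral => x _.
rewrite /fubini_F /patch mem_setE; case: ifPn => xin.
  rewrite [LHS]integral_mkcond; apply: eq_integral => y _; rewrite /patch mem_setE.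
  rewrite (_ : ((x, y) \in sq p q r) = (y \in `[(q - r)%R, (q + r)%R]))//.
  by apply/idP/idP => [/set_mem[]//|yi]; apply/mem_set; split.
rewrite [RHS]integral0_eq// => y _; case: ifPn => //; rewrite inE => -[/= xi].
by rewrite xi in xin.
Qed.

Lemma le_square_integral (h k : R -> R -> \bar R)
    (H K : measurableTypeR R * measurableTypeR R -> \bar R) (c p q r p' q' r' : R) :
  measurable_fun setT H -> measurable_fun setT K ->
  (forall w, 0 <= H w) -> (forall w, 0 <= K w) -> (0 <= c)%R ->
  square p' q' r' `<=` square p q r ->
  (forall x y, square p' q' r' (x +i* y) -> h x y = H (x, y)) ->
  (forall x y, square p q r (x +i* y) -> k x y = K (x, y)) ->
  (forall x y, square p' q' r' (x +i* y) -> h x y <= c%:E * k x y) ->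
  square_integral h p' q' r' <= c%:E * square_integral k p q r.
Proof.
move=> mH mK H0 K0 c0 sub hH kK hk.
rewrite (eq_square_integral hH) (eq_square_integral kK) !square_integralE//.
rewrite -ge0_integralZl_EFin//; last exact: measurable_funTS.
have mcK D : measurable_fun D (fun w => c%:E * K w).
  by apply: measurable_funTS; exact: emeasurable_funM.
apply: (@le_trans _ _ (\int[mu \x mu]_(w in sq p' q' r') (c%:E * K w))).
  apply: ge0_le_integral => //; first exact: measurable_funTS.
  move=> [x y] [/= xi yi]; have s : square p' q' r' (x +i* y) by split.
  by rewrite -hH// -kK; [exact: hk|exact: sub].
apply: ge0_subset_integral => //.
  by move=> w _; rewrite mule_ge0// lee_fin.
by move=> [x y] [/= xi yi]; have [] := sub (x +i* y) (conj xi yi).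
Qed.

Lemma clamp_square g p q r : (0 <= r)%R -> (forall z, square p q r z -> cdiff g z) ->
  measurable_fun setT (fun w : measurableTypeR R * measurableTypeR R =>
   nc (g (clamp (p - r) (p + r) w.1 +i* clamp (q - r) (q + r) w.2))).
Proof.
move=> r0 dg; apply: (@measurable_fun_plane R (fun w => nc (g (clamp (p - r) (p + r) w.1 +i* clamp (q - r) (q + r) w.2)))).
by apply: clamp_continuous => //; lra.
Qed.

(** Each of the four positions ranges over a segment of length [r / 2], and the integral of a line
    integral over its position is at most [J]. Averaging out one side thus costs [2 / r] times [J],
    and the four sides cost [8 / r]. *)
Lemma four_averages (S T : measurableTypeR R -> \bar R) (p q r m : R) (J : \bar R) :
  (0 < r)%R -> measurable_fun setT S -> measurable_fun setT T ->
  (forall x, 0 <= S x) -> (forall x, 0 <= T x) ->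
  (forall x, x \in `[p - r, p + r] -> S x \is a fin_num)%R ->
  (forall y, y \in `[q - r, q + r] -> T y \is a fin_num)%R ->
  (forall a b, \int[mu]_(x in `[a, b]) S x <= J) ->
  (forall a b, \int[mu]_(x in `[a, b]) T x <= J) ->
  (forall x0 x1 y0 y1, x0 \in `[p - r, p - r / 2] -> x1 \in `[p + r / 2, p + r] ->
    y0 \in `[q - r, q - r / 2] -> y1 \in `[q + r / 2, q + r] ->
    m <= fine (T y0) + fine (T y1) + (fine (S x1) + fine (S x0)))%R ->
  (r * m)%:E <= 8%:E * J.
Proof.
move=> r0 mS mT S0 T0 cS cT SJ TJ key.
have J0 : 0 <= J by apply: le_trans (SJ 0%R 0%R); exact: integral_ge0.
have [->|Jfin] := eqVneq J +oo; first by rewrite gt0_muley ?leey ?lte_fin ?ltr0n.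
have {Jfin} JR : J \is a fin_num by rewrite ge0_fin_numE// ltey.
(* The lower bound [c] may be negative, since it is [m] minus the contributions of the other sides;
   in that case the claim is trivial. *)
have avg (F : measurableTypeR R -> \bar R) (a b c : R) : (a <= b)%R -> measurable_fun setT F ->
   (forall x, 0 <= F x) -> (forall x, (x \in `[a, b])%R -> F x \is a fin_num) ->
   (forall a b, \int[mu]_(x in `[a, b]) F x <= J) ->
   (forall x, x \in `[a, b] -> c <= fine (F x))%R -> (c * (b - a) <= fine J)%R.
  move=> ab mF F0 Ff FJ cF; have [c0|c0] := leP 0%R c; last first.
    rewrite (@le_trans _ _ 0%R) ?fine_ge0//.
    by rewrite mulr_le0_ge0 ?(ltW c0)// subr_ge0.
  rewrite -lee_fin fineK//.
  apply: (@segment_average F a b a b c) => //.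
  by move=> x xi; rewrite -(fineK (Ff _ xi)) lee_fin cF.
have r2 : (0 < r / 2)%R by rewrite divr_gt0.
have cE : (2 / r * fine J = fine J / (r / 2))%R by field; rewrite gt_eqF.
have xE : (p - r / 2 - (p - r) = r / 2)%R by lra.
have xE' : (p + r - (p + r / 2) = r / 2)%R by lra.
have yE : (q - r / 2 - (q - r) = r / 2)%R by lra.
have yE' : (q + r - (q + r / 2) = r / 2)%R by lra.
have k1 x0 x1 y0 : (x0 \in `[p - r, p - r / 2])%R -> (x1 \in `[p + r / 2, p + r])%R ->
    (y0 \in `[q - r, q - r / 2])%R ->
    (m - (fine (T y0) + (fine (S x1) + fine (S x0))) <= 2 / r * fine J)%R.
  move=> h1 h2 h3; rewrite [leRHS]cE ler_pdivlMr// -yE'.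
  apply: (avg T) => //; first by lra.
    by move=> x xi; apply: cT; move: xi; rewrite !in_itv/=; lra.
  by move=> y yi; have := key _ _ _ _ h1 h2 h3 yi; lra.
have k2 x0 x1 : (x0 \in `[p - r, p - r / 2])%R -> (x1 \in `[p + r / 2, p + r])%R ->
    (m - ((fine (S x1) + fine (S x0))) - 2 / r * fine J <= 2 / r * fine J)%R.
  move=> h1 h2; rewrite [leRHS]cE ler_pdivlMr// -yE.
  apply: (avg T) => //; first by lra.
    by move=> x xi; apply: cT; move: xi; rewrite !in_itv/=; lra.
  by move=> y yi; have := k1 _ _ _ h1 h2 yi; move: (2 / r * _)%R => u; lra.
have k3 x0 : (x0 \in `[p - r, p - r / 2])%R ->
    (m - fine (S x0) - 2 / r * fine J - 2 / r * fine J <= 2 / r * fine J)%R.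
  move=> h1; rewrite [leRHS]cE ler_pdivlMr// -xE'.
  apply: (avg S) => //; first by lra.
    by move=> x xi; apply: cS; move: xi; rewrite !in_itv/=; lra.
  by move=> y yi; have := k2 _ _ h1 yi; move: (2 / r * _)%R => u; lra.
have k4 : (m - 2 / r * fine J - 2 / r * fine J - 2 / r * fine J <= 2 / r * fine J)%R.
  rewrite [leRHS]cE ler_pdivlMr// -xE.
  apply: (avg S) => //; first by lra.
    by move=> x xi; apply: cS; move: xi; rewrite !in_itv/=; lra.
  by move=> y yi; have := k3 _ yi; move: (2 / r * _)%R => u; lra.
rewrite -(fineK JR) -EFinM lee_fin.
have : (m <= 8 / r * fine J)%R.
  have -> : (8 / r = 4 * (2 / r))%R by ring.
  by rewrite -mulrA; move: k4; move: (2 / r * _)%R => u; lra.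
move=> h; have -> : (8 * fine J = r * (8 / r * fine J))%R.
  by field; rewrite gt_eqF.
by rewrite ler_pM2l.
Qed.

(** Cauchy's bound averaged over all frames. Fubini turns averages of line integrals, [S] over
    vertical and [T] over horizontal segments, into the area integral. *)
Lemma square_mean_ineq g p q r : (0 < r)%R ->
  (forall z, square p q r z -> cdiff g z) ->
  (r ^+ 2 * nc (g (p +i* q)))%:E <=
    8%:E * square_integral (fun x y => (nc (g (x +i* y)))%:E) p q r.
Proof.
move=> r0 dg; set J := square_integral _ p q r.
pose G w : R := nc (g (clamp (p - r) (p + r) w.1 +i* clamp (q - r) (q + r) w.2)).
have mG : measurable_fun setT (fun w : measurableTypeR R * measurableTypeR R => (G w)%:E).
  by apply/measurable_EFinP; apply: clamp_square => //; exact: ltW.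
have G0 w : 0 <= (G w)%:E by rewrite lee_fin nc_ge0.
pose GD := (fun w => (G w)%:E) \_ (sq p q r).
have mGD : measurable_fun setT GD.
  exact: ((measurable_restrictT _ (msq p q r)).1 (measurable_funTS mG)).
have GD0 w : 0 <= GD w by rewrite /GD /patch; case: ifP.
have GDE x y : sq p q r (x, y) -> GD (x, y) = (nc (g (x +i* y)))%:E.
  by move=> Dxy; rewrite /GD /patch mem_set//= /G; case: Dxy => /= ? ?; rewrite !clamp_id.
have JE : J = \int[mu]_x \int[mu]_y GD (x, y).
  rewrite -[RHS](fubini_tonelli1 _ mGD GD0) -integral_mkcond -(square_integralE _ _ _ mG G0).
  apply: eq_square_integral => x y [/= xi yi].
  by rewrite /G /= !clamp_id.
have JE2 : J = \int[mu]_y \int[mu]_x GD (x, y) by rewrite JE; exact: (fubini_tonelli _ mGD GD0).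
pose S x := \int[mu]_y GD (x, y).
pose T y := \int[mu]_x GD (x, y).
have mS : measurable_fun setT S by exact: measurable_fun_fubini_tonelli_F.
have mT : measurable_fun setT T by exact: measurable_fun_fubini_tonelli_G.
have S0 x : 0 <= S x by exact: integral_ge0.
have T0 y : 0 <= T y by exact: integral_ge0.
have SE x : (x \in `[p - r, p + r])%R -> S x = \int[mu]_(y in `[(q - r)%R, (q + r)%R]) (nc (g (x +i* y)))%:E.
  move=> xi; rewrite /S [RHS]integral_mkcond; apply: eq_integral => y _.
  rewrite [RHS]/patch mem_setE; case: ifPn => yi; first exact: GDE.
  by rewrite /GD /patch memNset// => -[_ /= yy]; rewrite yy in yi.
have TE y : (y \in `[q - r, q + r])%R -> T y = \int[mu]_(x in `[(p - r)%R, (p + r)%R]) (nc (g (x +i* y)))%:E.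
  move=> yi; rewrite /T [RHS]integral_mkcond; apply: eq_integral => x _.
  rewrite [RHS]/patch mem_setE; case: ifPn => xi; first exact: GDE.
  by rewrite /GD /patch memNset// => -[/= xx _]; rewrite xx in xi.
have SJ a b : \int[mu]_(x in `[a, b]) S x <= J.
  by rewrite JE; apply: ge0_subset_integral => //; exact: measurable_segment.
have TJ a b : \int[mu]_(x in `[a, b]) T x <= J.
  by rewrite JE2; apply: ge0_subset_integral => //; exact: measurable_segment.
have cT y : (y \in `[q - r, q + r])%R -> T y \is a fin_num.
  move=> yi; rewrite (TE _ yi) -Rintegral_segcont; first by [].
  by apply: (segcont_h (g := g)) => x xi; apply: dg; split.
have cS x : (x \in `[p - r, p + r])%R -> S x \is a fin_num.
  move=> xi; rewrite (SE _ xi) -Rintegral_segcont; first by [].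
  by apply: (segcont_v (g := g)) => y yi; apply: dg; split.
have key x0 x1 y0 y1 : (x0 \in `[p - r, p - r / 2])%R -> (x1 \in `[p + r / 2, p + r])%R ->
  (y0 \in `[q - r, q - r / 2])%R -> (y1 \in `[q + r / 2, q + r])%R ->
  (r * nc (g (p +i* q)) <= fine (T y0) + fine (T y1) + (fine (S x1) + fine (S x0)))%R.
  move=> h1 h2 h3 h4; have := cauchy_frame_le r0 dg h1 h2 h3 h4.
  move: h1 h2 h3 h4; rewrite !in_itv/= => h1 h2 h3 h4.
  have [i1 i2] : (x0 \in `[p - r, p + r])%R /\ (x1 \in `[p - r, p + r])%R.
    by rewrite !in_itv/=; lra.
  have [i3 i4] : (y0 \in `[q - r, q + r])%R /\ (y1 \in `[q - r, q + r])%R.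
    by rewrite !in_itv/=; lra.
  rewrite -(TE _ i3) -(TE _ i4) -(SE _ i1) -(SE _ i2) -(fineK (cT _ i3)) -(fineK (cT _ i4)).
  by rewrite -(fineK (cS _ i1)) -(fineK (cS _ i2)) -!EFinD lee_fin.
have -> : (r ^+ 2 * nc (g (p +i* q)) = r * (r * nc (g (p +i* q))))%R by rewrite mulrA.
exact: (four_averages r0 mS mT S0 T0 cS cT SJ TJ key).
Qed.

(* Fefferman-Stein: at a point where d^4 |g| is almost maximal, d being the
   distance to the boundary, the mean inequality for |g| gives the one for
   |g|^(1/2). *)
Lemma square_mean_sqrt g p q r : (0 < r)%R ->
  (forall z, square p q r z -> cdiff g z) ->
  (r ^+ 2 * Num.sqrt (nc (g (p +i* q))))%:E <=
    256%:E * square_integral (fun x y => (Num.sqrt (nc (g (x +i* y))))%:E) p q r.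
Proof.
move=> r0 dg; set J := square_integral _ p q r.
have J0 : 0 <= J.
  by apply: integral_ge0 => x _; apply: integral_ge0 => y _; rewrite lee_fin sqrtr_ge0.
have [->|Jfin] := eqVneq J +oo; first by rewrite gt0_muley ?leey ?lte_fin ?ltr0n.
have {Jfin} JR : J \is a fin_num by rewrite ge0_fin_numE// ltey.
pose d x y : R := (r - Num.max `|x - p| `|y - q|)%R.
(* The weight [d ^+ 4] is the square of the factor [r ^+ 2] in the statement; at the centre
   [d = r]. *)
pose E := [set (d xy.1 xy.2 ^+ 4 * nc (g (xy.1 +i* xy.2)))%R | xy in
   [set xy : R * R | square p q r (xy.1 +i* xy.2)]].
have pr : (p - r <= p + r)%R by lra.
have qr : (q - r <= q + r)%R by lra.
have [B hB] := rectangle_bounded pr qr dg.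
have dr x y : square p q r (x +i* y) -> (0 <= d x y <= r)%R.
  move=> /rectangleE[/= ? ? ? ?]; rewrite /d subr_ge0 gerBl ge_max le_max normr_ge0 andbT.
  by rewrite !ler_norml; lra.
have sq0 : square p q r (p +i* q) by split; rewrite /= in_itv/=; lra.
have hE : has_sup E.
  split; first by exists (d p q ^+ 4 * nc (g (p +i* q)))%R; exists (p, q).
  exists (r ^+ 4 * B)%R => _ [[x y]/= xys <-]; have /andP[d0 dr'] := dr _ _ xys.
  by rewrite ler_pM ?exprn_ge0 ?nc_ge0 ?hB// lerXn2r ?nnegrE// ltW.
set A := sup E.
have AE x y : square p q r (x +i* y) -> (d x y ^+ 4 * nc (g (x +i* y)) <= A)%R.
  by move=> s; apply: ub_le_sup; [case: hE|exists (x, y)].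
have d00 : d p q = r by rewrite /d !subrr normr0 maxxx subr0.
have A0 : (0 <= A)%R by rewrite (le_trans _ (AE _ _ sq0))// mulr_ge0 ?exprn_ge0 ?nc_ge0// d00 ltW.
suff AJ : (A <= (256 * fine J) ^+ 2)%R.
  rewrite -(fineK JR) -EFinM lee_fin.
  have J0' : (0 <= 256 * fine J)%R by rewrite mulr_ge0 ?ler0n ?fine_ge0.
  rewrite -(@ler_pXn2r _ 2)// ?nnegrE ?mulr_ge0 ?sqrtr_ge0 ?sqr_ge0 ?(ltW r0)//.
  rewrite (le_trans _ AJ)// exprMn -exprM sqr_sqrtr ?nc_ge0//.
  by rewrite (le_trans _ (AE _ _ sq0))// d00.
have [A00|Ane] := eqVneq A 0%R; first by rewrite A00 sqr_ge0.
have {Ane A0} A0 : (0 < A)%R by rewrite lt0r Ane.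
have A2 : (0 < A / 2)%R by rewrite divr_gt0.
have [_ [[x y]/= xys <-] hA] := sup_adherent A2 hE.
rewrite -/A in hA; have /andP[d0 dler] := dr _ _ xys.
set e := d x y in hA d0 dler.
have e0 : (0 < e)%R.
  rewrite lt0r d0 andbT; apply/eqP => e0; move: hA.
  by rewrite e0 expr0n mul0r; lra.
have e20 : (0 < e / 2)%R by rewrite divr_gt0.
have near s t : square x y (e / 2) (s +i* t) -> square p q r (s +i* t) /\ (e / 2 <= d s t)%R.
  move=> /rectangleE[/= s1 s2 t1 t2].
  have hx : (`|x - p| <= r - e)%R by rewrite /e /d opprB addrCA subrr addr0 le_max lexx.
  have hy : (`|y - q| <= r - e)%R by rewrite /e /d opprB addrCA subrr addr0 le_max lexx orbT.
  move: hx hy; rewrite !ler_norml => hx hy.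
  split; first by split; rewrite /= in_itv/=; lra.
  by rewrite /d lerBrDr -lerBrDl ge_max !ler_norml; lra.
have dg' z : square x y (e / 2) z -> cdiff g z by case: z => s t /near[/dg].
have := square_mean_ineq e20 dg'; set J1 := square_integral _ _ _ _ => J1le.
(* On the square of half-width [e / 2] around the near-maximal point, [d >= e / 2], so
   [|g| <= 16 A / e^4 = c^2]. Hence [|g| <= c |g|^(1/2)] there, which converts the mean of [|g|]
   into the mean of its square root. *)
pose c := (4 * Num.sqrt A / e ^+ 2)%R.
have c0 : (0 <= c)%R by rewrite !mulr_ge0 ?invr_ge0 ?sqr_ge0 ?sqrtr_ge0.
have gle s t : square x y (e / 2) (s +i* t) ->
    (nc (g (s +i* t)) <= c * Num.sqrt (nc (g (s +i* t))))%R.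
  move=> /near[st ed]; have := AE _ _ st => hst.
  have gA : (nc (g (s +i* t)) <= c ^+ 2)%R.
    rewrite /c !exprMn exprVn -exprM sqr_sqrtr ?(ltW A0)// ler_pdivlMr ?exprn_gt0//.
    rewrite mulrC -ler_pdivrMl ?exprn_gt0//.
    apply: le_trans hst; rewrite mulrA ler_wpM2r ?nc_ge0//.
    rewrite (_ : (_ * _ = (e / 2) ^+ 4)%R); last by field.
    by rewrite lerXn2r ?nnegrE ?(ltW e20)// (le_trans (ltW e20)).
  rewrite -{1}(sqr_sqrtr (nc_ge0 _)) expr2 ler_wpM2r ?sqrtr_ge0//.
  by rewrite -(ger0_norm c0) -sqrtr_sqr ler_wsqrtr.
have J1J : J1 <= c%:E * J.
  pose G w : R := nc (g (clamp (p - r) (p + r) w.1 +i* clamp (q - r) (q + r) w.2)).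
  have mG := clamp_square (ltW r0) dg.
  apply: (@le_square_integral _ _ (fun w => (G w)%:E) (fun w => (Num.sqrt (G w))%:E)) => //.
  - exact/measurable_EFinP.
  - apply/measurable_EFinP; apply: (@measurableT_comp _ _ _ _ _ _ (@Num.sqrt R)) => //.
    apply: continuous_measurable_fun; exact: sqrt_continuous.
  - by move=> w; rewrite lee_fin nc_ge0.
  - by case=> s t /near[].
  - by move=> s t /near[[/= ? ?] _]; rewrite /G /= !clamp_id.
  - by move=> s t [/= ? ?]; rewrite /G /= !clamp_id.
have : (e ^+ 2 / 4 * nc (g (x +i* y)))%:E <= 8%:E * (c%:E * J).
  rewrite (_ : (_ / 4 = (e / 2) ^+ 2)%R); last by field.
  by apply: le_trans J1le _; rewrite lee_wpmul2l.
rewrite -{1}(fineK JR) -!EFinM lee_fin => H.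
(* [4 e^2] times 8 times [c] equals [128 sqrt A]; near-maximality up to a factor 2 then gives the
   constant 256. *)
have H2 : (A / 2 <= 128 * Num.sqrt A * fine J)%R.
  have -> : (128 * Num.sqrt A * fine J = 4 * e ^+ 2 * (8 * (c * fine J)))%R.
    by rewrite /c; field; rewrite gt_eqF.
  apply: (@le_trans _ _ (e ^+ 4 * nc (g (x +i* y)))%R); first by lra.
  rewrite (_ : (e ^+ 4 * _ = 4 * e ^+ 2 * (e ^+ 2 / 4 * nc (g (x +i* y))))%R); last by field.
  by rewrite ler_wpM2l// mulr_ge0// sqr_ge0.
have sA : (0 < Num.sqrt A)%R by rewrite sqrtr_gt0.
have H3 : (Num.sqrt A <= 256 * fine J)%R.
  rewrite -(ler_pM2l sA) -expr2 sqr_sqrtr ?(ltW A0)//.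
  by rewrite (_ : (_ * _ = 2 * (128 * Num.sqrt A * fine J))%R); [lra|ring].
have H4 := le_trans (ltW sA) H3.
by rewrite -[leLHS](sqr_sqrtr (ltW A0)) lerXn2r ?nnegrE ?(ltW sA).
Qed.

End submean.

(** * The half plane *)

Section cexp.
Context {R : realType}.

Definition cexp (z : R[i]) : R[i] :=
  (expR (complex.Re z))%:C * (cos (complex.Im z) +i* sin (complex.Im z)).

Lemma cexp0 : cexp 0 = 1.
Proof. by rewrite /cexp /= expR0 cos0 sin0 mul1r. Qed.

Lemma cexpD z w : cexp (z + w) = cexp z * cexp w.
Proof.
rewrite /cexp !raddfD /= expRD cosD sinD.
apply/eqP; rewrite eq_complex /=; apply/andP; split; apply/eqP; ring.
Qed.

Lemma nc_cexp z : nc (cexp z) = expR (complex.Re z).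
Proof.
rewrite /cexp ncM nc_real ger0_norm ?expR_ge0//.
by rewrite /= cos2Dsin2 sqrtr1 mulr1.
Qed.

Lemma is_derive_taylor (f : R -> R) (x l : R) : is_derive x 1 f l ->
  forall e, 0 < e -> exists2 d, 0 < d &
    forall h, `|h| < d -> `|f (x + h) - f x - l * h| <= e * `|h|.
Proof.
move=> [/cvg_ex[k kP] fl] e e0.
have kl : k = l by rewrite -fl /derive; apply/esym/cvg_lim.
move: kP; rewrite {}kl => /cvgrPdist_le/(_ _ e0).
move=> /nbhs_ballP[d /= d0 fd]; exists d => // h hd.
have [->|h0] := eqVneq h 0; first by rewrite addr0 subrr mulr0 subr0 normr0 mulr0.
have := fd h; rewrite /ball /= sub0r normrN => /(_ hd h0) H.
rewrite (_ : _ - _ - _ = - (h * (l - h^-1 * (f (h + x) - f x)))).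
  rewrite normrN normrM mulrC ler_wpM2r//; move: H.
  by rewrite /GRing.scale/= mulr1.
by rewrite mulrBr mulVKf// (addrC h x); ring.
Qed.

Lemma cdiff_of_taylor (f : R[i] -> R[i]) z l :
  (forall e : R, 0 < e -> exists2 d : R, 0 < d &
    forall h : R[i], nc h < d -> nc (f (z + h) - f z - l * h) <= e * nc h) ->
  cdiff f z.
Proof.
move=> H; apply/derivable1_diffP/cvg_ex; exists l => /=.
apply/cvgrPdist_le => ee /posC_real[-> e0]; set e := complex.Re ee in e0 *.
have [d d0 Hd] := H e e0.
apply/nbhs_ballP; exists d%:C => /=; first by rewrite ltcR.
move=> h; rewrite /ball /= sub0r normrN ncE ltcR => hd h0.
rewrite ncE lecR -(ler_pM2r (x := nc h)) ?nc_gt0// -ncM.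
rewrite (_ : _ * h = - (f (z + h) - f z - l * h)); last first.
  by rewrite /GRing.scale/= mulr1 mulrBl mulrAC mulVf// mul1r (addrC z h); ring.
by rewrite ncN Hd.
Qed.

Lemma cdiff_cexp0 : cdiff cexp 0.
Proof.
apply: (@cdiff_of_taylor _ _ 1) => e e0.
(* The four error terms [t1] to [t4] below are at most 1, 2, 4 and 1 times [k n], 8 in all. *)
have e8 : 0 < Num.min (e / 8) 1 by rewrite lt_min ltr01 divr_gt0.
set k := Num.min _ _ in e8.
have k1 : k <= 1 by rewrite ge_min lexx orbT.
have ke : 8 * k <= e by rewrite mulrC -ler_pdivlMr// ge_min lexx.
have [d1 d10 H1] := is_derive_taylor (is_derive_expR (0 : R)) e8.
have [d2 d20 H2] := is_derive_taylor (is_derive_cos (0 : R)) e8.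
have [d3 d30 H3] := is_derive_taylor (is_derive_sin (0 : R)) e8.
exists (Num.min (Num.min d1 d2) (Num.min d3 k)); first by rewrite !lt_min d10 d20 d30 ltr01 divr_gt0.
case=> x y; rewrite !lt_min => /andP[/andP[n1 n2] /andP[n3 n4']].
rewrite add0r cexp0 mul1r; set n := nc (x +i* y) in n1 n2 n3 n4' *.
have n4 : n < k by rewrite lt_min n4'.
have xn : `|x| <= n by exact: (nc_geRe (x +i* y)).
have yn : `|y| <= n by exact: (nc_geIm (x +i* y)).
have h1 := H1 x (le_lt_trans xn n1).
have h2 := H2 y (le_lt_trans yn n2).
have h3 := H3 y (le_lt_trans yn n3).
move: h1 h2 h3; rewrite !add0r expR0 cos0 sin0 !(oppr0, mul0r, mul1r, subr0, addr0) => h1 h2 h3.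
have n0 : 0 <= n by exact: nc_ge0.
have kx : k * `|x| <= k * n by rewrite ler_wpM2l// ltW.
have ky : k * `|y| <= k * n by rewrite ler_wpM2l// ltW.
have kn : n * n <= k * n by rewrite ler_wpM2r// ltW.
have cl : `|cos y| <= 1 by rewrite ler_norml cos_geN1 cos_le1.
have kn1 : k * n <= n by rewrite ler_piMl.
have nk1 : n <= 1 by rewrite (le_trans (ltW n4)).
have exn : `|expR x - 1| <= 2 * n.
  rewrite (_ : _ - 1 = (expR x - 1 - x) + x); last by ring.
  by rewrite (le_trans (ler_normD _ _))//; clear -h1 kx kn1 xn; lra.
have syn : `|sin y| <= 2 * n.
  rewrite (_ : sin y = (sin y - y) + y); last by ring.
  by rewrite (le_trans (ler_normD _ _))//; clear -h3 ky kn1 yn; lra.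
rewrite (le_trans (nc_le_ReIm _))// /cexp /=.
rewrite (_ : _ - 1 - x = (expR x - 1 - x) * cos y + (1 + x) * (cos y - 1)); last by ring.
rewrite (_ : _ - 0 - y = (expR x - 1) * sin y + (sin y - y)); last by ring.
have t1 : `|(expR x - 1 - x) * cos y| <= k * n.
  by rewrite normrM (le_trans (ler_wpM2l _ cl))// mulr1 (le_trans h1).
have t2 : `|(1 + x) * (cos y - 1)| <= 2 * (k * n).
  rewrite normrM ler_pM// ?(le_trans h2)// (le_trans (ler_normD _ _))// normr1.
  by have := le_trans xn nk1; clear; lra.
have t3 : `|(expR x - 1) * sin y| <= 4 * (k * n).
  rewrite normrM (le_trans (ler_pM _ _ exn syn))//.
  by rewrite [leLHS](_ : _ = 4 * (n * n)); [clear -kn; lra|ring].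
have t4 := le_trans h3 ky.
have : 8 * (k * n) <= e * n by rewrite mulrA ler_wpM2r.
have := ler_normD ((expR x - 1 - x) * cos y) ((1 + x) * (cos y - 1)).
have := ler_normD ((expR x - 1) * sin y) (sin y - y).
by clear -t1 t2 t3 t4; lra.
Qed.

(** The functional equation transports differentiability from 0 to [z]. *)
Lemma cdiff_cexp z : cdiff cexp z.
Proof.
have -> : cexp = (fun w => cexp z * cexp (w - z)).
  by apply/funext => w; rewrite -cexpD addrC subrK.
apply: (cdiffM (cdiff_cst _ _)).
apply: (@cdiff_comp _ (fun w => w - z) cexp); last by rewrite subrr; exact: cdiff_cexp0.
exact: (cdiffB (cdiff_id _) (cdiff_cst _ _)).
Qed.

End cexp.

(** * Translation invariance, the Poisson kernel, uniform continuity *)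

Section translation.
Context {R : realType}.
Notation mu := (@lebesgue_measure R).
Notation Rm := (measurableTypeR R).
Local Open Scope ereal_scope.

Lemma measurable_shift (a : R) : measurable_fun setT (fun x : Rm => (x + a)%R : Rm).
Proof. exact: measurable_funD. Qed.

Lemma lebesgue_measure_shift (a : R) A : measurable A ->
  pushforward mu (fun x : Rm => (x + a)%R : Rm) A = mu A.
Proof.
move=> mA.
pose m := pushforward mu (fun x : Rm => (x + a)%R : Rm).
apply/esym; apply: (@lebesgue_measure_unique R
   (pushforward mu (fun x : Rm => (x + a)%R : Rm))) => //.
  exact: measurable_shift.
move=> mf _ [[b c]] _ <-.
change (mu `]b, c] = mu ((fun x : Rm => (x + a)%R) @^-1` `]b, c])).
rewrite (_ : _ @^-1` _ = `](b - a)%R, (c - a)%R]%classic).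
  rewrite !lebesgue_measure_itv/= !lte_fin ltrD2r; case: ifP => // _.
  by rewrite -!EFinB opprB addrA subrK.
by apply/seteqP; split => x /=; rewrite !in_itv/= ltrBlDr lerBrDr.
Qed.

Lemma integral_shift (f : Rm -> \bar R) (a : R) : measurable_fun setT f ->
  (forall x, 0 <= f x) -> \int[mu]_x f (x + a)%R = \int[mu]_x f x.
Proof.
move=> mf f0; have := @ge0_integral_pushforward _ _ _ _ R _ (measurable_shift a) mu setT f
   measurableT mf (fun x _ => f0 x).
rewrite preimage_setT => <-; apply: eq_measure_integral => [|? A mA _]; first exact: measurable_shift.
exact: lebesgue_measure_shift.
Qed.

Lemma integral_shift_segment (f : Rm -> \bar R) (a b c : R) : measurable_fun setT f ->
  (forall x, 0 <= f x) ->
  \int[mu]_(x in `[b, c]) f (x + a)%R = \int[mu]_(x in `[(b + a)%R, (c + a)%R]) f x.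
Proof.
move=> mf f0; rewrite integral_mkcond [RHS]integral_mkcond.
rewrite -[RHS](@integral_shift _ a).
- apply: eq_integral => x _; rewrite /patch !mem_setE !in_itv/=.
  by rewrite !lerD2r.
- exact: ((measurable_restrictT _ (measurable_segment _ _)).1 (measurable_funTS mf)).
- by move=> x; rewrite erestrict_ge0.
Qed.

End translation.

Section poisson.
Context {R : realType}.
Notation mu := (@lebesgue_measure R).

(** The Poisson kernel of the upper half plane without its factor [pi^-1], so that its total mass is
    [pi]. *)
Definition poisson (t x : R) : R := t / (x ^+ 2 + t ^+ 2).

Lemma poisson_den (t x : R) : 0 < t -> 0 < x ^+ 2 + t ^+ 2.
Proof. by move=> t0; rewrite ltr_wpDl ?sqr_ge0// exprn_gt0. Qed.

Lemma poisson_ge0 t x : 0 < t -> 0 <= poisson t x.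
Proof. by move=> t0; rewrite divr_ge0 ?ltW// ?poisson_den. Qed.

Lemma poisson_continuous t s : 0 < t -> continuous (fun x => poisson t (x - s)).
Proof.
move=> t0 x; apply: cvgM; first exact: cvg_cst.
apply: cvgV; first by rewrite gt_eqF// poisson_den.
apply: cvgD; last exact: cvg_cst.
by rewrite expr2; apply: cvgM; apply: cvgB; (exact: cvg_id || exact: cvg_cst).
Qed.

Lemma continuous_integrable (f : R -> R) a b : continuous f ->
  mu.-integrable `[a, b] (EFin \o f).
Proof.
move=> cf; apply: continuous_compact_integrable; first exact: segment_compact.
by apply: continuous_subspaceT => x; exact: cf.
Qed.

Lemma EFin_Rintegral_continuous (f : R -> R) a b : continuous f ->
  (\int[mu]_(x in `[a, b]) f x)%:E = (\int[mu]_(x in `[a, b]) (f x)%:E)%E.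
Proof.
move=> cf; rewrite /Rintegral fineK//; apply: integrable_fin_num => //.
exact: continuous_integrable.
Qed.

Lemma Rintegral_segment_sub (f : R -> R) a b a' b' : continuous f ->
  (forall x, 0 <= f x) -> a <= a' -> b' <= b ->
  (\int[mu]_(x in `[a', b']) f x <= \int[mu]_(x in `[a, b]) f x)%R.
Proof.
move=> cf f0 aa bb; rewrite -lee_fin !EFin_Rintegral_continuous//.
apply: ge0_subset_integral => //.
- by have := @continuous_integrable f a b cf; exact: measurable_int.
- by move=> x _; rewrite lee_fin.
- by apply: subset_itv; rewrite bnd_simp.
Qed.

Lemma le_Rintegral_continuous (f g : R -> R) a b : continuous f -> continuous g ->
  (forall x, x \in `[a, b] -> f x <= g x) ->
  (\int[mu]_(x in `[a, b]) f x <= \int[mu]_(x in `[a, b]) g x)%R.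
Proof.
move=> cf cg fg; apply: (@le_Rintegral _ _ _ mu) => //; exact: continuous_integrable.
Qed.

Lemma is_derive_poisson (t s x : R) : 0 < t ->
  is_derive x 1 (fun y => atan ((y - s) / t)) (poisson t (x - s)).
Proof.
move=> t0.
have d1 : is_derive x 1 (fun y : R => (y - s) / t) t^-1.
  rewrite (_ : (fun y => _) = t^-1 \*: (@id R - cst s)).
    by apply: is_derive_eq; rewrite subr0 /GRing.scale/= mulr1.
  by apply/funext => y; rewrite /= mulrC.
apply: (@is_derive_eq _ _ _ _ _ _ _ _ (is_derive1_comp (is_derive1_atan _) d1)).
rewrite /poisson /GRing.scale/=; field.
by rewrite (gt_eqF t0) andbT gt_eqF// poisson_den.
Qed.

Lemma integral_poisson t s a b : 0 < t -> a <= b ->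
  (\int[mu]_(x in `[a, b]) poisson t (x - s))%R =
  atan ((b - s) / t) - atan ((a - s) / t).
Proof.
move=> t0; rewrite le_eqVlt => /predU1P[->|ab].
  by rewrite set_itv1 Rintegral_set1 subrr.
have dF x := is_derive_poisson s x t0.
have cF : continuous (fun y => atan ((y - s) / t)).
  by move=> x; apply/differentiable_continuous/derivable1_diffP; case: (dF x).
rewrite /Rintegral (@continuous_FTC2 _ _ (fun y => atan ((y - s) / t)))//.
- by apply: continuous_subspaceT; exact: poisson_continuous.
- split.
  + by move=> x _; case: (dF x).
  + by apply: cvg_at_right_filter; exact: cF.
  + by apply: cvg_at_left_filter; exact: cF.
- by move=> x _; rewrite derive1E; case: (dF x).
Qed.

Lemma integral_poisson_le t s a b : 0 < t -> a <= b ->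
  (\int[mu]_(x in `[a, b]) poisson t (x - s))%R <= pi.
Proof.
move=> t0 ab; rewrite integral_poisson//.
by have := atan_ltpi2 ((b - s) / t); have := atan_gtNpi2 ((a - s) / t); lra.
Qed.

(** The mass within distance [r] of the centre is twice the arctangent of [r / u], whatever the
    centre, and tends to [pi] as [u] decreases to 0. *)
Lemma poisson_mass (r e t : R) : 0 < r -> 0 < e -> 0 < t -> exists u, [/\ 0 < u, u <= t &
  forall s, pi - e <= (\int[mu]_(x in `[(s - r)%R, (s + r)%R]) poisson u (x - s))%R].
Proof.
move=> r0 e0 t0.
have /cvgrPdist_lt/(_ (e / 2)) := @cvgy_atan R.
rewrite divr_gt0// => /(_ isT)[M [Mr HM]].
pose N := Num.max (Num.max (M + 1) 1) (r / t).
have N0 : 0 < N by rewrite !lt_max ltr01 orbT.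
exists (r / N); split; first by rewrite divr_gt0.
  by rewrite ler_pdivrMr// -ler_pdivrMl// mulrC le_max lexx orbT.
move=> s; rewrite integral_poisson ?divr_gt0//; last lra.
have -> : (s + r - s) / (r / N) = N by field; rewrite !gt_eqF.
have -> : (s - r - s) / (r / N) = - N by field; rewrite !gt_eqF.
have := HM N; rewrite atanN => /(_ _); have -> : M < N.
  by rewrite !lt_max ltrDl ltr01.
move=> /(_ isT); rewrite ltr_norml => /andP[_].
by lra.
Qed.

End poisson.

Section heine.
Context {R : realType}.

(** Only [x] is confined to the segment: [y] may leave it, as needed for windows centred near its
    ends. *)
Lemma heine (f : R -> R) (a b e : R) : continuous f -> 0 < e ->
  exists2 r, 0 < r & forall x y, x \in `[a, b] -> `|y - x| <= r -> `|f y - f x| <= e.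
Proof.
move=> cf e0.
have /compact_near_coveringP cK := @segment_compact R a b.
have := cK R (0^'+) (fun r x => forall y, `|y - x| <= r -> `|f y - f x| <= e) _.
case.
  move=> x _; have e2 : 0 < e / 2 by rewrite divr_gt0.
  have /cvgrPdist_le/(_ _ e2)/nbhs_ballP[d /= d0 H] := cf x.
  exists (ball x (d / 2), [set r | r < d / 2]); first split.
  - by apply/nbhs_ballP; exists (d / 2) => //=; rewrite divr_gt0.
  - by apply: nbhs_right_lt; rewrite divr_gt0.
  move=> [x' r] /= [xx' rd] y yx'.
  have h1 : `|f x - f x'| <= e / 2.
    by apply: H; apply: le_ball xx'; rewrite ler_pdivrMr//; lra.
  have h2 : `|f x - f y| <= e / 2.
    apply: H; rewrite /ball /= (_ : x - y = (x - x') - (y - x')); last by ring.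
    rewrite (le_lt_trans (ler_normB _ _))// [ltRHS]splitr ltrD//.
    exact: le_lt_trans rd.
  rewrite (_ : _ - _ = (f x - f x') - (f x - f y)); last by ring.
  by rewrite (le_trans (ler_normB _ _))// [leRHS]splitr lerD.
move=> r /= r0 H; exists (r / 2); first by rewrite divr_gt0.
move=> x y xab yx; apply: (H (r / 2)) => //=.
- by rewrite sub0r normrN gtr0_norm ?divr_gt0// ltr_pdivrMr//; lra.
- by rewrite divr_gt0.
Qed.

End heine.

(** * Herglotz integrals and comparison with an outer function *)

Section herglotz.
Context {R : realType}.
Notation mu := (@lebesgue_measure R).
Implicit Types (a b : R) (F G : R -> R[i]).

Lemma segcontM a b F G : segcont a b F -> segcont a b G ->
  segcont a b (fun x => F x * G x).
Proof.
move=> cF cG x xab e e0.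
set M := nc (F x) + nc (G x) + 1.
have M0 : 0 < M by rewrite ltr_wpDl// addr_ge0// nc_ge0.
have eM : 0 < e / 2 / M by rewrite !divr_gt0.
have [d1 d10 H1] := cF x xab _ eM; have [d2 d20 H2] := cG x xab _ eM.
have [d3 d30 H3] := cG x xab _ ltr01.
exists (Num.min d1 (Num.min d2 d3)); first by rewrite !lt_min d10 d20.
move=> y yab; rewrite !lt_min => /and3P[y1 y2 y3].
rewrite (_ : _ - _ = (F y - F x) * G y + F x * (G y - G x)); last by ring.
rewrite (le_trans (ncD _ _))// !ncM [leRHS](splitr e) lerD//.
  have Gy : nc (G y) <= M.
    have := nc_le_add (G y) (G x); have := H3 _ yab y3; have := nc_ge0 (F x).
    by rewrite /M; move: (nc _) (nc _) (nc _) (nc _) => *; lra.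
  rewrite (le_trans (ler_pM (nc_ge0 _) (nc_ge0 _) (H1 _ yab y1) Gy))//.
  by rewrite divfK ?gt_eqF.
have Fx : nc (F x) <= M.
  by have := nc_ge0 (G x); rewrite /M; move: (nc _) (nc _) => *; lra.
rewrite (le_trans (ler_pM (nc_ge0 _) (nc_ge0 _) Fx (H2 _ yab y2)))//.
by rewrite mulrC divfK ?gt_eqF.
Qed.

Lemma segcont_kernel a b (w : R[i]) : 0 < complex.Im w ->
  segcont a b (fun x => (w - x%:C)^-1).
Proof.
move=> w0; apply: (segcont_h (g := fun z => (w - z)^-1) (y := 0)) => x _.
apply: cdiffV; first exact: (cdiffB (cdiff_cst _ _) (cdiff_id _)).
apply/eqP => /(congr1 (@complex.Im R)); rewrite raddfB /= subr0.
by move/eqP; rewrite gt_eqF.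
Qed.

Lemma segcont_real a b (f : R -> R) : continuous f ->
  segcont a b (fun x => (f x)%:C).
Proof.
move=> cf x _ e e0; have /cvgrPdist_le/(_ _ e0)/nbhs_ballP[d d0 H] := cf x.
exists d; [exact: d0|move=> y _ yx].
have -> : (f y)%:C - (f x)%:C = (f y - f x)%:C.
  by apply/eqP; rewrite eq_complex /= subrr !eqxx.
rewrite nc_real distrC; apply: H; by rewrite /ball/= distrC.
Qed.

(* The holomorphic function in the upper half plane whose real part is the
   Poisson integral of [f] restricted to [[-L, L]]. *)
Definition herglotz (f : R -> R) L (w : R[i]) : R[i] :=
  (0 +i* pi^-1) * cint (- L) L (fun x => (f x)%:C * (w - x%:C)^-1).

Lemma Re_herglotz f L w : continuous f -> 0 < complex.Im w ->
  complex.Re (herglotz f L w) = pi^-1 *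
  (\int[mu]_(x in `[(- L)%R, L]) (f x * poisson (complex.Im w) (x - complex.Re w)))%R.
Proof.
move=> cf w0; rewrite /herglotz.
have cI : segcont (- L) L (fun x => (f x)%:C * (w - x%:C)^-1).
  by apply: segcontM; [exact: segcont_real|exact: segcont_kernel].
set I := cint _ _ _; have -> : complex.Re ((0 +i* pi^-1) * I) = pi^-1 * (-1 * complex.Im I).
  by case: I => ? ? /=; rewrite mul0r sub0r mulN1r mulrN.
congr (_ * _); rewrite /I Im_cint.
have <- := @RintegralZl _ _ _ mu _ _ (-1) (measurable_segment _ _) (segcont_integrable (@Im_lip R) cI).
apply: eq_Rintegral => x _; rewrite mulN1r.
case: w w0 {cI I} => u v /= w0; rewrite /poisson.
rewrite subr0 (_ : (x - u) ^+ 2 = (u - x) ^+ 2); last by ring.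
by rewrite !(mul0r, addr0, mulNr, mulrN) opprK.
Qed.

(** Differentiation under the integral sign. For an increment below half of [m = Im w], the kernel
    stays at distance [m / 2] from its pole, so the remainder is quadratic uniformly in [x]. *)
Lemma cdiff_herglotz f L M w : 0 <= L -> continuous f ->
  (forall x, `|f x| <= M) -> 0 < complex.Im w -> cdiff (herglotz f L) w.
Proof.
move=> L0 cf fM w0; set m := complex.Im w.
have LL : - L <= L by lra.
have m2 : 0 < m / 2 by rewrite divr_gt0.
pose D x := (f x)%:C * - ((w - x%:C)^-1 * (w - x%:C)^-1).
have M0 : 0 <= M by rewrite (le_trans _ (fM 0)).
apply: (@cdiff_quad _ _ _ ((0 +i* pi^-1) * cint (- L) L D)
   (pi^-1 * (2 * (M * (m ^- 2 * (2 / m))) * (L - - L))) (m / 2)) => // h hm.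
have wh0 : m / 2 <= complex.Im (w + h).
  rewrite raddfD /= -/m; have := le_trans (lerNnormlW (nc_geIm h)) (lexx _).
  by lra.
have wh : 0 < complex.Im (w + h) by rewrite (lt_le_trans m2).
have ck u : 0 < complex.Im u -> segcont (- L) L (fun x => (f x)%:C * (u - x%:C)^-1).
  by move=> u0; apply: segcontM; [exact: segcont_real|exact: segcont_kernel].
have cD : segcont (- L) L D.
  apply: segcontM; first exact: segcont_real.
  rewrite (_ : (fun x => - _) = (fun x => -1 * ((w - x%:C)^-1 * (w - x%:C)^-1))).
    by apply: segcontZ; apply: segcontM; exact: segcont_kernel.
  by apply/funext => x; rewrite mulN1r.
have cE : segcont (- L) L (fun x => (f x)%:C * (w + h - x%:C)^-1 - (f x)%:C * (w - x%:C)^-1).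
  rewrite (_ : (fun x => _) = (fun x => (f x)%:C * (w + h - x%:C)^-1 + -1 * ((f x)%:C * (w - x%:C)^-1))).
    by apply: segcontD; [exact: ck|apply: segcontZ; exact: ck].
  by apply/funext => x; rewrite mulN1r.
have chD : segcont (- L) L (fun x => h * D x) by exact: segcontZ.
have -> : herglotz f L (w + h) - herglotz f L w - (0 +i* pi^-1) * cint (- L) L D * h =
    (0 +i* pi^-1) * cint (- L) L (fun x => (f x)%:C * (w + h - x%:C)^-1 - (f x)%:C * (w - x%:C)^-1 - h * D x).
  rewrite cintB// (cintB (ck _ wh) (ck _ w0)) cintZ// /herglotz.
  by move: (cint _ _ _) (cint _ _ _) (cint _ _ _) => *; ring.
rewrite ncM nc_i ger0_norm ?invr_ge0 ?pi_ge0// -[leRHS]mulrA ler_wpM2l ?invr_ge0 ?pi_ge0//.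
rewrite [leRHS](_ : _ = 2 * (M * (m ^- 2 * (2 / m)) * nc h ^+ 2) * (L - - L)); last by ring.
have cT : segcont (- L) L (fun x => (f x)%:C * (w + h - x%:C)^-1 - (f x)%:C * (w - x%:C)^-1 - h * D x).
  rewrite (_ : (fun x => _) = (fun x => ((f x)%:C * (w + h - x%:C)^-1 - (f x)%:C * (w - x%:C)^-1) + -1 * (h * D x))).
    by apply: segcontD => //; exact: segcontZ.
  by apply/funext => x; rewrite mulN1r.
apply: nc_cint_le => // x _.
have nz u : 0 < complex.Im u -> u - x%:C != 0.
  move=> u0; apply/eqP => /(congr1 (@complex.Im R)); rewrite raddfB /= subr0.
  by move/eqP; rewrite gt_eqF.
have w1 := nz _ w0; have w2 := nz _ wh.
(* The exact remainder of [1 / (w + h - x)] after its linear part in [h]. *)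
rewrite (_ : _ - h * D x = (f x)%:C * ((w - x%:C)^-1 ^+ 2 * (w + h - x%:C)^-1 * h ^+ 2)); last first.
  by rewrite /D; field; rewrite w1 w2.
rewrite ncM nc_real ncM (ncX h) ncM ncX !ncV [leLHS]mulrA ler_wpM2r ?sqr_ge0//.
have imle u : complex.Im u <= nc (u - x%:C).
  by have := nc_geIm (u - x%:C); rewrite raddfB /= subr0; exact: le_trans (ler_norm _).
rewrite ler_pM// ?mulr_ge0 ?invr_ge0 ?exprn_ge0 ?invr_ge0 ?nc_ge0//.
rewrite ler_pM// ?invr_ge0 ?exprn_ge0 ?invr_ge0 ?nc_ge0//.
  by rewrite -exprVn lerXn2r ?nnegrE ?invr_ge0 ?nc_ge0 ?(ltW w0)// lef_pV2 ?posrE ?nc_gt0//; exact: imle.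
rewrite -[leRHS]invf_div lef_pV2 ?posrE ?nc_gt0//.
exact: le_trans (imle _).
Qed.

End herglotz.

Section outer.
Context {R : realType}.
Notation mu := (@lebesgue_measure R).
Implicit Types (phi : R[i] -> R[i]) (d : R).

Lemma continuous_real_line phi : (forall z, 0 <= complex.Im z -> cdiff phi z) ->
  continuous (fun x : R => nc (phi (x +i* 0))).
Proof.
move=> dphi x; apply/cvgrPdist_le => e e0.
have [r r0 H] := cdiff_modcont (dphi (x +i* 0) (lexx _)) e0.
apply/nbhs_ballP; exists r => // y xy; rewrite distrC.
apply: le_trans (nc_lip _ _) _.
have := H ((y +i* 0) - (x +i* 0)); rewrite ncBh.
rewrite distrC => /(_ xy); rewrite [X in phi X](_ : _ = y +i* 0)//; ring.
Qed.

(** The exponential lies above its tangent at [c / 2], and [(1 + X)^(1/2) <= 1 + X^(1/2)]. The lower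
    bound is affine in [ln (1 + X)]: integrated against the Poisson kernel, with [c] the resulting
    mean of [ln (1 + X)], it becomes Jensen's inequality. *)
Lemma Jensen_exp (X c : R) : 0 <= X -> 0 <= c ->
  expR (c / 2) - 1 - c * (expR (c / 2) / 2) + ln (1 + X) * (expR (c / 2) / 2) <= Num.sqrt X.
Proof.
move=> X0 c0; set y := ln (1 + X).
have X1 : 0 < 1 + X by rewrite ltr_wpDr.
have Ey : expR (y / 2) ^+ 2 = 1 + X.
  by rewrite -expRM_natl mulr_natl -mulr_natr divfK// lnK// posrE.
have h1 : expR (y / 2) <= 1 + Num.sqrt X.
  rewrite -(@ler_pXn2r _ 2)// ?nnegrE ?expR_ge0 ?addr_ge0 ?sqrtr_ge0// Ey.
  by rewrite sqrrD expr1n sqr_sqrtr// mul1r lerD2r lerDl mulrn_wge0 ?sqrtr_ge0.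
have h2 : expR (c / 2) * (1 + (y - c) / 2) <= expR (y / 2).
  have -> : y / 2 = c / 2 + (y - c) / 2 by lra.
  by rewrite expRD ler_wpM2l ?expR_ge0// expR_ge1Dx.
by move: h1 h2; move: (expR _) (expR _) (Num.sqrt _) => *; lra.
Qed.

(* Comparison with the outer function whose boundary modulus is about
   [1 + |phi| / d]: only the maximum modulus principle is needed, and the zeros
   of [phi] play no role. *)
Lemma outer_bound phi (B d L0 s t : R) :
  (forall z, 0 <= complex.Im z -> cdiff phi z) ->
  (forall z, 0 <= complex.Im z -> nc (phi z) <= B) -> 0 < d -> 0 < L0 ->
  (forall z, 0 <= complex.Im z -> L0 <= nc z -> nc (phi z) <= d) -> 0 < t ->
  exists u L, [/\ t <= u, u <= 2 * t, 0 < L &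
   Num.sqrt (nc (phi (s +i* t))) <= expR 1 * (Num.sqrt d + pi^-1 *
    (\int[mu]_(x in `[(- L)%R, L])
      (Num.sqrt (nc (phi (x +i* 0))) * poisson u (x - s)))%R)].
Proof.
move=> dphi phiB d0 L00 philarge t0.
pose X x : R := nc (phi (x +i* 0)) / d.
have X0 x : 0 <= X x by rewrite divr_ge0 ?nc_ge0 ?ltW.
have X1 x : 0 < 1 + X x by rewrite ltr_wpDr.
pose f x : R := ln (1 + X x).
have cX : continuous X.
  by move=> x; apply: cvgM; [exact: continuous_real_line|exact: cvg_cst].
have cf : continuous f.
  move=> x; apply: (@continuous_comp _ _ _ (fun x => 1 + X x) (@ln R)).
    by apply: cvgD; [exact: cvg_cst|exact: cX].
  exact: continuous_ln.
have f0 x : 0 <= f x by rewrite ln_ge0// lerDl.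
have B0 : 0 <= B by rewrite (le_trans (nc_ge0 _) (phiB 0 _)).
pose M := ln (1 + B / d).
have M0 : 0 <= M by rewrite ln_ge0// lerDl divr_ge0// ltW.
have fM x : `|f x| <= M.
  rewrite ger0_norm// ler_ln ?posrE//; last by rewrite ltr_wpDr// divr_ge0// ltW.
  by rewrite lerD2l ler_pM2r ?invr_gt0// phiB.
have e12 : 0 < 2^-1 :> R by [].
have [r0 r00 Hr0] := heine (- L0) L0 cf e12.
(* [r <= 1] keeps the window [[x - r, x + r]] inside [[-L, L]] when [|x| < L0], as [L = L0 + 1]. *)
pose r := Num.min r0 1.
have r_gt0 : 0 < r by rewrite lt_min r00 ltr01.
have pie : 0 < pi / (2 * (M + 1)) :> R by rewrite divr_gt0 ?pi_gt0// mulr_gt0// ltr_wpDl.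
have [eta [eta0 etat Heta]] := poisson_mass r_gt0 pie t0.
pose L := L0 + 1.
have LL0 : 0 < L by rewrite addr_gt0.
have LLL : - L <= L by lra.
exists (t + eta), L; split => //; [by rewrite lerDl ltW|by lra|].
(* Raised by [eta], the Herglotz integral is holomorphic on the closed half plane; the price is that
   its boundary values are only approximate. *)
pose G w := herglotz f L (w + 0 +i* eta).
have ImG w : 0 <= complex.Im w -> 0 < complex.Im (w + 0 +i* eta).
  by move=> w0; rewrite raddfD /= ltr_wpDl.
have ReG w : 0 <= complex.Im w -> complex.Re (G w) = pi^-1 *
    (\int[mu]_(x in `[(- L)%R, L]) (f x * poisson (complex.Im w + eta) (x - complex.Re w)))%R.
  move=> /ImG w0; rewrite /G Re_herglotz//.
  by rewrite (raddfD (@complex.Im R)) (raddfD (@complex.Re R)) /= addr0.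
have cfp u v : 0 < v -> continuous (fun x => f x * poisson v (x - u)).
  by move=> v0 x; apply: cvgM; [exact: cf|exact: poisson_continuous].
have ReG0 w : 0 <= complex.Im w -> 0 <= complex.Re (G w).
  move=> w0; rewrite ReG// mulr_ge0 ?invr_ge0 ?pi_ge0//.
  apply: Rintegral_ge0 => x _; rewrite mulr_ge0// poisson_ge0//.
  by have := ImG _ w0; rewrite raddfD.
have dG w : 0 <= complex.Im w -> cdiff G w.
  move=> w0; apply: (@cdiff_comp _ (fun w => w + 0 +i* eta) (herglotz f L)).
    exact: (cdiffD (cdiff_id _) (cdiff_cst _ _)).
  by apply: (cdiff_herglotz (M := M)) => //; [exact: ltW|exact: ImG].
pose H w := phi w * cexp (- G w).
have dH w : 0 <= complex.Im w -> cdiff H w.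
  move=> w0; apply: cdiffM; first exact: dphi.
  apply: (@cdiff_comp _ (fun w => - G w) cexp); last exact: cdiff_cexp.
  by apply: cdiffN; exact: dG.
have HE w : nc (H w) = nc (phi w) * expR (- complex.Re (G w)).
  by rewrite /H ncM nc_cexp raddfN.
(* The loss of 1 is one half for the oscillation of [f] in the window and one half for the mass of
   the kernel outside it. It becomes the factor [expR 1]. *)
have bdy x : f x - 1 <= complex.Re (G (x +i* 0)) \/ L0 <= `|x|.
  have [|xL] := leP L0 `|x|; first by right.
  left; have [fx|fx] := leP (f x) (2^-1); first by rewrite (le_trans _ (ReG0 _ _))//=; clear -fx; lra.
  rewrite ReG//= add0r.
  have r1 : r <= 1 by rewrite ge_min lexx orbT.
  have rr0 : r <= r0 by rewrite ge_min lexx.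
  have /andP[xL1 xL2] : - L0 < x < L0 by rewrite -ltr_norml.
  have sub1 : - L <= x - r by rewrite /L; clear -xL1 r1; lra.
  have sub2 : x + r <= L by rewrite /L; clear -xL2 r1; lra.
  have sub3 : x - r <= x + r by clear -r_gt0; lra.
  apply: (@le_trans _ _ (pi^-1 * (\int[mu]_(y in `[(x - r)%R, (x + r)%R]) ((f x - 2^-1) * poisson eta (y - x)))%R)).
    rewrite (@RintegralZl _ _ _ mu _ _ _ (measurable_segment _ _)); last first.
      by apply: continuous_integrable; exact: poisson_continuous.
    have := Heta x; set I := (\int[_]_(_ in _) _)%R => HI.
    set a := f x - 2^-1; have a0 : 0 < a by rewrite subr_gt0.
    have aM : a <= M + 1 by have := le_trans (ler_norm _) (fM x); rewrite /a; clear; lra.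
    have Mp : 0 < M + 1 by rewrite ltr_wpDl.
    have pp : 0 < pi :> R by exact: pi_gt0.
    have h1 : a * (pi - pi / (2 * (M + 1))) <= a * I by rewrite ler_pM2l.
    rewrite (le_trans _ (ler_wpM2l _ h1)) ?invr_ge0 ?pi_ge0//.
    have -> : pi^-1 * (a * (pi - pi / (2 * (M + 1)))) = a - a / (M + 1) / 2.
      have gen (p m A : R) : p != 0 -> m != 0 ->
          p^-1 * (A * (p - p / (2 * m))) = A - A / m / 2.
        by move=> p0 m0; field; rewrite p0 m0.
      by apply: gen; rewrite gt_eqF.
    have : a / (M + 1) <= 1 by rewrite ler_pdivrMr// mul1r.
    by rewrite /a; move: (_ / (M + 1)) => u; clear; lra.
  rewrite ler_wpM2l ?invr_ge0 ?pi_ge0//.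
  have cc k : continuous (fun y => k * poisson eta (y - x)).
    by move=> y; apply: cvgM; [exact: cvg_cst|exact: poisson_continuous].
  apply: (@le_trans _ _ (\int[mu]_(y in `[(x - r)%R, (x + r)%R]) (f y * poisson eta (y - x)))%R).
    apply: le_Rintegral_continuous => [||y].
    - exact: cc.
    - exact: cfp.
    rewrite in_itv/= => /andP[y1 y2]; rewrite ler_wpM2r ?poisson_ge0//.
    have xin : x \in `[- L0, L0] by rewrite in_itv/= !ltW.
    have : `|y - x| <= r0 by rewrite (le_trans _ rr0)// ler_norml; clear -y1 y2; lra.
    by move=> /(Hr0 _ _ xin); rewrite ler_norml => /andP[+ _]; clear; lra.
  apply: Rintegral_segment_sub => //; first exact: cfp.
  by move=> y; rewrite mulr_ge0// poisson_ge0.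
have dE x : nc (phi (x +i* 0)) <= d * expR (f x).
  by rewrite lnK ?posrE// mulrDr mulr1 /X mulrC divfK ?gt_eqF// lerDr ltW.
have e1 : 1 <= expR 1 :> R by rewrite (le_trans _ (expR_ge1Dx _))// lerDl.
(* The rectangle contains [s + i t], and its left, right and upper sides lie where [nc z >= L0], so
   that [phi] is at most [d] on them. *)
pose W := L0 + `|s| + t + 1.
have s0 := normr_ge0 s.
have sW : `|s| < W by rewrite /W; lra.
have W0 : 0 < W by rewrite (le_lt_trans s0).
have phid w : 0 <= complex.Im w -> L0 <= nc w -> nc (H w) <= d * expR 1.
  move=> w0 wL; have h : expR (- complex.Re (G w)) <= expR 1.
    by rewrite ler_expR (le_trans _ ler01)// oppr_le0 ReG0.
  by rewrite HE; exact: (ler_pM (nc_ge0 _) (expR_ge0 _) (philarge _ w0 wL) h).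
have Hst : nc (H (s +i* t)) <= d * expR 1.
  apply: (@max_modulus _ H (- W) W 0 W).
  - by rewrite in_itv/= -ltr_norml.
  - by rewrite in_itv/= t0 /W; lra.
  - by move=> z /rectangleE[_ _ z0 _]; exact: dH.
  move=> z [/rectangleE[z1 z2 z3 z4] /= o].
  have WL : L0 <= W by rewrite /W; lra.
  case/or4P: o => /eqP E.
  - apply: phid => //; rewrite (le_trans _ (nc_geRe _))// E normrN (le_trans WL)//.
    exact: ler_norm.
  - by apply: phid => //; rewrite (le_trans _ (nc_geRe _))// E (le_trans WL)// ler_norm.
  - case: z E z1 z2 {z3 z4} => x y /= -> _ _; case: (bdy x) => [h|h]; last first.
      by apply: phid => //; rewrite (le_trans h)// -nc_real.
    rewrite HE (le_trans (ler_wpM2r (expR_ge0 _) (dE x)))// -mulrA -expRD.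
    by rewrite ler_wpM2l ?(ltW d0)// ler_expR; clear -h; lra.
  - by apply: phid => //; rewrite (le_trans _ (nc_geIm _))// E (le_trans WL)// ler_norm.
set c := complex.Re (G (s +i* t)).
have c0 : 0 <= c by apply: ReG0; exact: ltW.
have cE : c = pi^-1 * (\int[mu]_(x in `[(- L)%R, L]) (f x * poisson (t + eta) (x - s)))%R.
  by rewrite /c ReG//= ltW.
have te0 : 0 < t + eta by rewrite addr_gt0.
have phic : nc (phi (s +i* t)) <= d * expR 1 * expR c.
  by rewrite -ler_pdivrMr ?expR_gt0// -expRN -HE.
have d00 := ltW d0.
have sq : Num.sqrt (nc (phi (s +i* t))) <= expR 1 * (Num.sqrt d * expR (c / 2)).
  rewrite -(@ler_pXn2r _ 2)// ?nnegrE ?mulr_ge0 ?expR_ge0 ?sqrtr_ge0//.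
  rewrite sqr_sqrtr ?nc_ge0// (le_trans phic)// !exprMn sqr_sqrtr//.
  rewrite (_ : expR (c / 2) ^+ 2 = expR c); last first.
    by rewrite -expRM_natl mulr_natl -mulr_natr divfK.
  rewrite mulrA ler_wpM2r ?expR_ge0// mulrC ler_wpM2r//.
  by rewrite expr2 ler_peMr ?expR_ge0.
apply: le_trans sq _; rewrite ler_wpM2l ?expR_ge0//.
set al := expR (c / 2) - 1 - c * (expR (c / 2) / 2); set be := expR (c / 2) / 2.
(* The sign of [al] matters: the kernel cut off at [L] has normalized mass at most 1 only, and for
   [al <= 0] this goes in the right direction. *)
have al0 : al <= 0.
  have : expR (c / 2) * (1 - c / 2) <= 1.
    have h := expR_ge1Dx (- (c / 2)).
    by rewrite (le_trans (ler_wpM2l (expR_ge0 _) h))// -expRD subrr expR0.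
  by rewrite /al; move: (expR _) => u; clear; lra.
pose P x := poisson (t + eta) (x - s).
have cP : continuous P by exact: poisson_continuous.
have P0 x : 0 <= P x by exact: poisson_ge0.
have csX : continuous (fun x => Num.sqrt (X x) * P x).
  move=> x; apply: cvgM; last exact: cP.
  by apply: (@continuous_comp _ _ _ X (@Num.sqrt R)); [exact: cX|exact: sqrt_continuous].
have main : expR (c / 2) - 1 <= pi^-1 * (\int[mu]_(x in `[(- L)%R, L]) (Num.sqrt (X x) * P x))%R.
  have h : (\int[mu]_(x in `[(- L)%R, L]) (al * P x + be * (f x * P x)) <=
      \int[mu]_(x in `[(- L)%R, L]) (Num.sqrt (X x) * P x))%R.
    apply: le_Rintegral_continuous => // [x|x _].
      apply: cvgD; apply: cvgM; try exact: cvg_cst; [exact: cP|exact: cfp].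
    rewrite mulrA -mulrDl ler_wpM2r// /al /be.
    by have := Jensen_exp (X0 x) c0; rewrite -/(f x); move: (expR _) (f x) (Num.sqrt _) => u v w; clear; lra.
  have pi0 : 0 <= pi^-1 :> R by rewrite invr_ge0 pi_ge0.
  apply: le_trans (ler_wpM2l pi0 h).
  have iP : mu.-integrable `[- L, L] (EFin \o P) by exact: continuous_integrable.
  have ifP : mu.-integrable `[- L, L] (EFin \o (fun x => f x * P x)).
    by apply: continuous_integrable; exact: cfp.
  have mI := measurable_segment (- L) L.
  have E : (\int[mu]_(x in `[(- L)%R, L]) (al * P x + be * (f x * P x)) =
     al * \int[mu]_(x in `[(- L)%R, L]) P x + be * \int[mu]_(x in `[(- L)%R, L]) (f x * P x))%R.
    rewrite -(RintegralZl al mI iP) -(RintegralZl be mI ifP).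
    rewrite -(@RintegralD _ _ _ mu _ _ _ mI)//; apply: continuous_integrable => x.
      by apply: cvgM; [exact: cvg_cst|exact: cP].
    by apply: cvgM; [exact: cvg_cst|exact: cfp].
  rewrite E mulrDr [pi^-1 * (be * _)]mulrCA -cE.
  have q1 : pi^-1 * (\int[mu]_(x in `[(- L)%R, L]) P x)%R <= 1.
    by rewrite ler_pdivrMl ?pi_gt0// mulr1 integral_poisson_le.
  rewrite mulrCA.
  have : al * 1 <= al * (pi^-1 * (\int[mu]_(x in `[(- L)%R, L]) P x)%R) by rewrite ler_wnM2l.
  by rewrite mulr1 /be; move: (al * _) => u; rewrite /al; move: (expR _) => v; clear; lra.
have -> : (\int[mu]_(x in `[(- L)%R, L]) (Num.sqrt (nc (phi (x +i* 0))) * poisson (t + eta) (x - s)) =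
    Num.sqrt d * \int[mu]_(x in `[(- L)%R, L]) (Num.sqrt (X x) * P x))%R.
  have iX : mu.-integrable `[- L, L] (EFin \o (fun x => Num.sqrt (X x) * P x)).
    by apply: continuous_integrable; exact: csX.
  rewrite -(RintegralZl (Num.sqrt d) (measurable_segment _ _) iX).
  have EX x : Num.sqrt (nc (phi (x +i* 0))) = Num.sqrt d * Num.sqrt (X x).
    by rewrite -sqrtrM// /X [d * _]mulrC divfK// gt_eqF.
  by apply: eq_Rintegral => x _; rewrite EX -mulrA.
rewrite mulrCA -[X in X + _]mulr1 -mulrDr ler_wpM2l ?sqrtr_ge0//.
by rewrite addrC -lerBlDr.
Qed.

End outer.

(** * Poisson integrals and the maximal function of a line *)

Section radii.
Context {R : realType}.
Notation mu := (@lebesgue_measure R).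
Notation Rm := (measurableTypeR R).
Local Open Scope ereal_scope.

Definition avg_radius (n : nat) : R :=
  if (@unpickle (nat * nat)%type n) is Some (a, b) then a.+1%:R / b.+1%:R else 1%R.

Lemma avg_radius_gt0 n : (0 < avg_radius n)%R.
Proof. by rewrite /avg_radius; case: unpickle => [[a b]|]//; rewrite divr_gt0. Qed.

Lemma avg_radius_dense (r : R) : (0 < r)%R -> exists n, (r <= avg_radius n <= 2 * r)%R.
Proof.
move=> r0; pose b := Num.truncn r^-1.
have hb : (r^-1 < b.+1%:R)%R by exact: truncnS_gt.
have b0 : (0 < b.+1%:R :> R)%R by rewrite ltr0n.
have rb : (1 < r * b.+1%:R)%R by rewrite mulrC -ltr_pdivrMr// div1r.
pose a := Num.truncn (r * b.+1%:R).
have ha1 : (r * b.+1%:R < a.+1%:R)%R by exact: truncnS_gt.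
have ha2 : (a%:R <= r * b.+1%:R)%R by rewrite truncn_le// ltW// (lt_trans _ rb).
exists (pickle (a, b)); rewrite /avg_radius pickleK; apply/andP; split.
  by rewrite ler_pdivlMr// ltW.
rewrite ler_pdivrMr// -natr1 -mulrA mulr_natl mulr2n lerD//.
exact: ltW.
Qed.

(* The radii are restricted to a countable dense set, for measurability. *)
Definition line_average (F : R -> \bar R) (r : R) : \bar R :=
  ((2 * r)^-1)%:E * \int[mu]_(u in `[(- r)%R, r]) F u.

Definition line_maximal (F : R -> \bar R) : \bar R :=
  ereal_sup (range (fun n => line_average F (avg_radius n))).

(** The radius is rounded up to an enumerated one of at most [2 r], hence an interval of length at
    most [4 r]. *)
Lemma le_line_maximal (F : Rm -> \bar R) r : (0 < r)%R -> measurable_fun setT F ->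
  (forall x, 0 <= F x) ->
  \int[mu]_(u in `[(- r)%R, r]) F u <= (4 * r)%:E * line_maximal F.
Proof.
move=> r0 mF F0; have [n /andP[rn nr]] := avg_radius_dense r0.
have n0 := avg_radius_gt0 n.
have h : line_average F (avg_radius n) <= line_maximal F.
  by apply: ereal_sup_ubound; exists n.
have h1 : \int[mu]_(u in `[(- r)%R, r]) F u <= \int[mu]_(u in `[(- avg_radius n)%R, avg_radius n]) F u.
  apply: ge0_subset_integral => //; first exact: measurable_funTS.
  by apply: subset_itv; rewrite bnd_simp ?lerN2.
apply: le_trans h1 _.
have -> : \int[mu]_(u in `[(- avg_radius n)%R, avg_radius n]) F u = (2 * avg_radius n)%:E * line_average F (avg_radius n).
  by rewrite /line_average muleA -EFinM divff ?mul1e// mulf_neq0// gt_eqF.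
have A0 : 0 <= line_average F (avg_radius n).
  by rewrite mule_ge0 ?integral_ge0// lee_fin invr_ge0 mulr_ge0// ltW.
rewrite lee_pmul// lee_fin ?mulr_ge0 ?(ltW n0)//.
by rewrite (_ : (4 * r = 2 * (2 * r))%R) ?ler_pM2l//; ring.
Qed.

Lemma line_maximal_ge0 F : (forall x, 0 <= F x) -> 0 <= line_maximal F.
Proof.
move=> F0; apply: (@le_trans _ _ (line_average F (avg_radius 0))).
  by rewrite mule_ge0 ?integral_ge0// lee_fin invr_ge0 mulr_ge0// ltW// avg_radius_gt0.
by apply: ereal_sup_ubound; exists 0%N.
Qed.

(* Split the line into dyadic annuli around [0]. *)
Lemma poisson_line_maximal (F : Rm -> \bar R) t L : (0 < t)%R -> measurable_fun setT F ->
  (forall x, 0 <= F x) ->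
  \int[mu]_(x in `[(- L)%R, L]) (F x * (poisson t x)%:E) <= 20%:E * line_maximal F.
Proof.
move=> t0 mF F0; set M := line_maximal F.
have M0 : 0 <= M by exact: line_maximal_ge0.
pose P x := F x * (poisson t x)%:E.
have mp : measurable_fun setT (poisson t : Rm -> R).
  apply: continuous_measurable_fun => x.
  by have := @poisson_continuous R t 0%R t0 x; under eq_fun do rewrite subr0.
have mP : measurable_fun setT P by apply: emeasurable_funM => //; exact/measurable_EFinP.
have P0 x : 0 <= P x by rewrite mule_ge0// lee_fin poisson_ge0.
(* The central interval costs 4 and the passage from stage [K] to the next one [8 2^-K]; the partial
   sums are [20 - 16 2^-K]. *)
have step (K : nat) : \int[mu]_(x in `[(- (2 ^+ K * t))%R, (2 ^+ K * t)%R]) P x <= (20 - 16 * 2^-1 ^+ K)%:E * M.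
  elim: K => [|K ih].
    rewrite !expr0 !mul1r mulr1.
    apply: (@le_trans _ _ (t^-1%:E * \int[mu]_(x in `[(- t)%R, t]) F x)).
      rewrite -ge0_integralZl_EFin//; [|exact: measurable_funTS|by rewrite invr_ge0 ltW].
      apply: ge0_le_integral => //; [exact: measurable_funTS|apply: measurable_funTS; exact: emeasurable_funM|].
      move=> x _; rewrite /P muleC lee_wpmul2r// lee_fin /poisson.
      rewrite ler_pdivrMr ?poisson_den// mulrDr (expr2 t) [(t^-1 * (t * t))%R]mulrA.
      by rewrite mulVf ?gt_eqF// mul1r lerDr mulr_ge0 ?sqr_ge0// invr_ge0 ltW.
    have := le_line_maximal t0 mF F0; rewrite -/M => h.
    have ti0 : (0 <= (t^-1)%:E :> \bar R) by rewrite lee_fin invr_ge0 (ltW t0).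
    apply: le_trans (lee_wpmul2l ti0 h) _.
    rewrite muleA -EFinM mulrCA mulVf ?gt_eqF// mulr1.
    by rewrite lee_wpmul2r// lee_fin; lra.
  set r := (2 ^+ K * t)%R in ih; have r0 : (0 < r)%R by rewrite mulr_gt0// exprn_gt0.
  have rE : (2 ^+ K.+1 * t = 2 * r)%R by rewrite exprS -mulrA.
  rewrite rE.
  (* Outside [[-r, r]] with [r = 2^K t] the kernel is at most [t / r^2 = 2^-K / r]. *)
  have split : \int[mu]_(x in `[(- (2 * r))%R, (2 * r)%R]) P x <=
      \int[mu]_(x in `[(- r)%R, r]) P x + \int[mu]_(x in `[(- (2 * r))%R, (2 * r)%R]) ((2^-1 ^+ K / r)%:E * F x).
    rewrite integral_mkcond [X in _ <= X + _]integral_mkcond [X in _ <= _ + X]integral_mkcond.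
    have mres a b (H : Rm -> \bar R) : measurable_fun setT H -> measurable_fun setT (H \_ `[a, b]%classic).
      by move=> mH; apply: ((measurable_restrictT _ (measurable_segment _ _)).1 (measurable_funTS mH)).
    have mc : measurable_fun setT (fun x : Rm => (2^-1 ^+ K / r)%:E * F x) by exact: emeasurable_funM.
    have c0 : (0 <= 2^-1 ^+ K / r)%R by rewrite divr_ge0 ?exprn_ge0 ?invr_ge0 ?(ltW r0).
    have Q0 x : 0 <= (2^-1 ^+ K / r)%:E * F x by rewrite mule_ge0// lee_fin.
    rewrite -ge0_integralD//; last 4 first.
    - by move=> x _; rewrite erestrict_ge0.
    - exact: mres.
    - by move=> x _; rewrite erestrict_ge0.
    - exact: mres.
    apply: ge0_le_integral => //.
    - by move=> x _; rewrite erestrict_ge0.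
    - exact: mres.
    - by apply: emeasurable_funD; exact: mres.
    move=> x _; rewrite /patch !mem_setE; case: ifPn => [x2|_]; last first.
      by case: ifPn => // _; rewrite adde0.
    case: ifPn => [_|xr]; first by rewrite leeDl.
    rewrite add0e /P muleC lee_wpmul2r// lee_fin /poisson.
    have xr2 : (r ^+ 2 <= x ^+ 2)%R.
      move: xr; rewrite in_itv/= -ler_norml -ltNge => /ltW xr.
      by rewrite -(real_normK (num_real x)) lerXn2r ?nnegrE ?(ltW r0).
    rewrite ler_pdivrMr ?poisson_den//.
    apply: (@le_trans _ _ (2^-1 ^+ K / r * r ^+ 2)%R); last first.
      by rewrite ler_wpM2l// (le_trans xr2)// lerDl sqr_ge0.
    rewrite expr2 mulrA divfK ?gt_eqF// /r mulrA -exprMn mulVf ?pnatr_eq0// expr1n mul1r//.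
  apply: le_trans split _.
  have h2 : \int[mu]_(x in `[(- (2 * r))%R, (2 * r)%R]) ((2^-1 ^+ K / r)%:E * F x) <= (8 * 2^-1 ^+ K)%:E * M.
    have c0 : (0 <= 2^-1 ^+ K / r)%R by rewrite divr_ge0 ?exprn_ge0 ?invr_ge0 ?(ltW r0).
    rewrite ge0_integralZl_EFin//; last exact: measurable_funTS.
    have r20 : (0 < 2 * r)%R by rewrite mulr_gt0.
    have := le_line_maximal r20 mF F0; rewrite -/M => h.
    rewrite (le_trans (lee_wpmul2l _ h)) ?lee_fin//.
    rewrite muleA -EFinM lee_wpmul2r// lee_fin le_eqVlt; apply/orP; left; apply/eqP.
    by field; rewrite gt_eqF.
  rewrite (le_trans (leeD ih h2))// -ge0_muleDl ?lee_fin.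
  - rewrite lee_wpmul2r// lee_fin exprS.
    have : (0 <= 2^-1 ^+ K :> R)%R by rewrite exprn_ge0// invr_ge0.
    by move: (2^-1 ^+ K)%R => u; lra.
  - have : (2^-1 ^+ K <= 1 :> R)%R by rewrite exprn_ile1 ?invr_ge0// invf_le1// ler1n.
    by move: (2^-1 ^+ K)%R => u; lra.
  - by rewrite mulr_ge0// exprn_ge0// invr_ge0.
have [K hK] : exists K : nat, (L <= 2 ^+ K * t)%R.
  exists (Num.truncn (L / t)).+1.
  rewrite -ler_pdivrMr// (le_trans (ltW (truncnS_gt _)))//.
  by rewrite -natrX ler_nat ltnW// ltn_expl.
apply: (@le_trans _ _ (\int[mu]_(x in `[(- (2 ^+ K * t))%R, (2 ^+ K * t)%R]) P x)).
  apply: ge0_subset_integral => //; [exact: measurable_funTS|by move=> x _; exact: P0|].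
  by apply: subset_itv; rewrite bnd_simp ?lerN2.
rewrite (le_trans (step K))// lee_wpmul2r// lee_fin gerBl mulr_ge0//.
Qed.

End radii.

Section half_plane.
Context {R : realType}.
Notation mu := (@lebesgue_measure R).
Notation Rm := (measurableTypeR R).
Implicit Types (phi : R[i] -> R[i]) (z w : R[i]).

(** [1 - i d w]: in the closed upper half plane its modulus is at least 1 and at least [d |w|].
    Dividing by it makes a bounded function small at infinity, as [outer_bound] requires. *)
Definition damp (d : R) w : R[i] := 1 + d%:C * ((- 'i) * w).

Lemma dampE d (x y : R) : damp d (x +i* y) = (1 + d * y) +i* (- (d * x)).
Proof. by apply/eqP; rewrite eq_complex /=; apply/andP; split; apply/eqP; ring. Qed.

Lemma cdiff_damp d w : cdiff (damp d) w.
Proof.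
by apply: cdiffD; [exact: cdiff_cst|apply: cdiffM; [exact: cdiff_cst|apply: cdiffM; [exact: cdiff_cst|exact: cdiff_id]]].
Qed.

Lemma nc_damp_ge1 d w : 0 <= d -> 0 <= complex.Im w -> 1 <= nc (damp d w).
Proof.
case: w => x y d0; rewrite [complex.Im _]/= => y0; rewrite dampE (le_trans _ (nc_geRe _))//=.
by rewrite (le_trans _ (ler_norm _))// lerDl mulr_ge0.
Qed.

Lemma nc_damp_ge d w : 0 <= d -> 0 <= complex.Im w -> d * nc w <= nc (damp d w).
Proof.
case: w => x y d0; rewrite [complex.Im _]/= => y0; rewrite dampE.
rewrite -(@ler_pXn2r _ 2)// ?nnegrE ?mulr_ge0 ?nc_ge0// exprMn !nc_sqr.
have dy : 0 <= d * y by rewrite mulr_ge0.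
have -> : complex.Re ((1 + d * y) +i* (- (d * x))) = 1 + d * y by [].
have -> : complex.Im ((1 + d * y) +i* (- (d * x))) = - (d * x) by [].
by rewrite [complex.Re _]/= [complex.Im _]/= mulrDr -!exprMn sqrrN; move: (d * x) dy => u; nra.
Qed.

Lemma nc_damp_le d w : 0 <= d -> nc (damp d w) <= 1 + d * nc w.
Proof.
move=> d0; rewrite (le_trans (ncD _ _))// !ncM ncN.
have -> : nc (d%:C) = d by rewrite -[RHS]ger0_norm// nc_real.
have -> : nc ('i : R[i]) = 1 by rewrite -[RHS]normr1 -nc_i.
have -> : nc (1 : R[i]) = 1 by rewrite -[RHS]normr1 nc_real.
by rewrite mul1r.
Qed.

#[local] Opaque damp.

(** [expR 1] and [pi^-1] come from [outer_bound], [2 + 2 A^2] from recentring the kernel, 20 from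
    [poisson_line_maximal]. *)
Definition half_plane_cst (A : R) : R := expR 1 * (pi^-1 * ((2 + 2 * A ^+ 2) * 20)).

Lemma half_plane_cst_gt0 A : 0 < half_plane_cst A.
Proof.
by rewrite !mulr_gt0 ?expR_gt0 ?invr_gt0 ?pi_gt0// ltr_wpDr// mulr_ge0// sqr_ge0.
Qed.

(** Recentring: [(x - s0)^2 <= 2 (x - s)^2 + 2 A^2 u^2], because [|s - s0| <= A t <= A u]. *)
Lemma poisson_compare (A s s0 t u x : R) : 0 < t -> t <= u -> `|s - s0| <= A * t ->
  poisson u (x - s) <= (2 + 2 * A ^+ 2) * poisson u (x - s0).
Proof.
move=> t0 tu As; have u0 := lt_le_trans t0 tu.
have A0 : 0 <= A by rewrite -(pmulr_lge0 _ t0) (le_trans _ As).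
rewrite /poisson mulrA ler_pdivrMr ?poisson_den// mulrAC ler_pdivlMr ?poisson_den//.
rewrite [leRHS]mulrAC mulrC ler_wpM2r ?(ltW u0)//.
have h : (s - s0) ^+ 2 <= A ^+ 2 * u ^+ 2.
  rewrite -exprMn -(real_normK (num_real (s - s0))) lerXn2r ?nnegrE ?mulr_ge0 ?(ltW u0)//.
  by rewrite (le_trans As)// ler_wpM2l.
have -> : x - s0 = (x - s) + (s - s0) by ring.
move: (x - s) (s - s0) h => a b h.
have := sqr_ge0 (a - b); have := sqr_ge0 (A * a); have := sqr_ge0 u; nra.
Qed.

(** The outer comparison is applied to the damped function with smallness [e^2] at infinity, whose
    square root is the error [e]. Since [B] only decides how far out the damping must act, it is
    absent from the result. *)
Lemma half_plane_bound phi (B A s0 s t : R) :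
  (forall z, 0 <= complex.Im z -> cdiff phi z) ->
  (forall z, 0 <= complex.Im z -> nc (phi z) <= B) -> 0 < t ->
  `|s - s0| <= A * t ->
  ((Num.sqrt (nc (phi (s +i* t))))%:E <= (half_plane_cst A)%:E *
    line_maximal (fun u => (Num.sqrt (nc (phi ((s0 + u) +i* 0))))%:E))%E.
Proof.
move=> dphi phiB t0 As.
set F := fun u : R => (Num.sqrt (nc (phi ((s0 + u) +i* 0))))%:E.
have A0 : 0 <= A by rewrite -(pmulr_lge0 _ t0) (le_trans _ As).
have F0 u : (0 <= F u)%E by rewrite lee_fin sqrtr_ge0.
have M0 := line_maximal_ge0 F0; set M := line_maximal F in M0 *.
have cphi : continuous (fun x : R => Num.sqrt (nc (phi (x +i* 0)))).
  move=> x; apply: (@continuous_comp _ _ _ (fun x : R => nc (phi (x +i* 0))) (@Num.sqrt R)).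
    exact: continuous_real_line.
  exact: sqrt_continuous.
have mF0 : measurable_fun setT (fun x : Rm => (Num.sqrt (nc (phi (x +i* 0))))%:E).
  by apply/measurable_EFinP; exact: continuous_measurable_fun.
have mF : measurable_fun setT (F : Rm -> \bar R).
  rewrite (_ : F = (fun x : Rm => (Num.sqrt (nc (phi (x +i* 0))))%:E) \o (fun u => u + s0)).
    by apply: measurableT_comp => //; exact: measurable_shift.
  by apply/funext => u; rewrite /F /= addrC.
have [Moo|] := eqVneq M +oo%E.
  by rewrite Moo gt0_muley ?leey// lte_fin half_plane_cst_gt0.
case E : M M0 => [m| |]// m0 _; rewrite lee_fin in m0.
set a := Num.sqrt _.
(* The factor [1 + e] undoes the damping at the point, and [expR 1 * e] is the error of the
   comparison; both disappear as [e] tends to 0. *)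
suff key e : 0 < e -> e <= 1 -> a <= (1 + e) * (expR 1 * e + half_plane_cst A * m).
  rewrite -EFinM lee_fin; set b := half_plane_cst A * m.
  have b0 : 0 <= b by rewrite mulr_ge0// ltW// half_plane_cst_gt0.
  have q0 : 0 < 2 * expR 1 + b :> R by rewrite ltr_pwDl// mulr_gt0// expR_gt0.
  apply/ler_addgt0Pr => eps eps0; set e := Num.min 1 (eps / (2 * expR 1 + b)).
  have e0 : 0 < e by rewrite lt_min ltr01 divr_gt0.
  have e1 : e <= 1 by rewrite ge_min lexx.
  have e2 : e * (2 * expR 1 + b) <= eps by rewrite -ler_pdivlMr// ge_min lexx orbT.
  apply: le_trans (key _ e0 e1) _; rewrite -/b.
  have ee : e * e <= e by rewrite ler_piMl// ltW.
  have := ler_wpM2r (expR_ge0 (1 : R)) ee.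
  by move: (expR 1) e2 => v; nra.
move=> e0 e1; set z := s +i* t.
(* Chosen so that the damping factor has modulus at most [1 + e] at [z]. *)
pose d := e / (nc z + 1); have nz1 : 0 < nc z + 1 by rewrite ltr_wpDl ?nc_ge0.
have d0 : 0 < d by rewrite divr_gt0.
pose phi1 w := phi w * (damp d w)^-1.
have dmp w : 0 <= complex.Im w -> 0 < nc (damp d w).
  by move=> w0; rewrite (lt_le_trans ltr01)// nc_damp_ge1// ltW.
have dphi1 w : 0 <= complex.Im w -> cdiff phi1 w.
  move=> w0; apply: cdiffM; first exact: dphi.
  by apply: (cdiffV (cdiff_damp d w)); rewrite -nc_gt0; exact: dmp.
have phi1E w : nc (phi1 w) = nc (phi w) / nc (damp d w) by rewrite ncM ncV.
have B0 : 0 <= B by rewrite (le_trans (nc_ge0 _) (phiB 0 _)).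
have phi1le w : 0 <= complex.Im w -> nc (phi1 w) <= nc (phi w).
  move=> w0; rewrite phi1E ler_pdivrMr ?dmp// ler_peMr ?nc_ge0// nc_damp_ge1//.
  exact: ltW.
have phi1B w : 0 <= complex.Im w -> nc (phi1 w) <= B.
  by move=> w0; rewrite (le_trans (phi1le _ w0))// phiB.
have ee0 : 0 < e ^+ 2 by rewrite exprn_gt0.
pose L0 := B / (d * e ^+ 2) + 1.
have L00 : 0 < L0 by rewrite ltr_wpDl// divr_ge0// mulr_ge0 ?ltW.
have phi1d w : 0 <= complex.Im w -> L0 <= nc w -> nc (phi1 w) <= e ^+ 2.
  move=> w0 wL; rewrite phi1E ler_pdivrMr ?dmp// (le_trans (phiB _ w0))//.
  rewrite (le_trans _ (ler_wpM2l (ltW ee0) (nc_damp_ge (ltW d0) w0)))//.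
  have -> : e ^+ 2 * (d * nc w) = nc w * (d * e ^+ 2) by move: (nc w) => u; ring.
  have q0 : 0 < d * e ^+ 2 by rewrite mulr_gt0.
  move: wL; rewrite /L0; move: (nc w) => u wL.
  have : B / (d * e ^+ 2) <= u by apply: le_trans wL; rewrite lerDl.
  by rewrite ler_pdivrMr.
have [u [L [tu _ L_gt0 bnd]]] := outer_bound s dphi1 phi1B ee0 L00 phi1d t0.
have u0 := lt_le_trans t0 tu.
set I := (\int[mu]_(x in _) _)%R in bnd.
have IM : I <= (2 + 2 * A ^+ 2) * 20 * m.
  have K0 : 0 <= 2 + 2 * A ^+ 2 by rewrite addr_ge0// mulr_ge0// sqr_ge0.
  have cI : continuous (fun x => Num.sqrt (nc (phi1 (x +i* 0))) * poisson u (x - s)).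
    move=> x; apply: cvgM; last exact: poisson_continuous.
    apply: (@continuous_comp _ _ _ (fun x : R => nc (phi1 (x +i* 0))) (@Num.sqrt R)).
      exact: continuous_real_line.
    exact: sqrt_continuous.
  pose Q x := (F x * (poisson u x)%:E)%E.
  have mp : measurable_fun setT (fun x : Rm => (poisson u x)%:E).
    apply/measurable_EFinP; apply: continuous_measurable_fun => x.
    by have := @poisson_continuous R u 0%R u0 x; under eq_fun do rewrite subr0.
  have mQ : measurable_fun setT (Q : Rm -> \bar R) by exact: emeasurable_funM.
  have Q0 x : (0 <= Q x)%E by rewrite mule_ge0// lee_fin poisson_ge0.
  have mQs : measurable_fun setT (fun x : Rm => Q (x + - s0)).
    by apply: measurableT_comp => //; exact: measurable_shift.
  rewrite -lee_fin (EFin_Rintegral_continuous _ _ cI).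
  apply: (@le_trans _ _ (\int[mu]_(x in `[(- L)%R, L]) ((2 + 2 * A ^+ 2)%:E * Q (x - s0)%R))%E).
    apply: ge0_le_integral => //=.
    - by move=> x _; rewrite lee_fin mulr_ge0 ?sqrtr_ge0// poisson_ge0.
    - by apply: measurable_funTS; apply/measurable_EFinP; exact: continuous_measurable_fun.
    - by apply: measurable_funTS; exact: emeasurable_funM.
    move=> x _; rewrite /Q /F (_ : s0 + (x - s0) = x); last by ring.
    rewrite -!EFinM lee_fin [leRHS]mulrCA.
    have h : Num.sqrt (nc (phi1 (x +i* 0))) <= Num.sqrt (nc (phi (x +i* 0))).
      by rewrite ler_sqrt ?nc_ge0// phi1le.
    exact: (ler_pM (sqrtr_ge0 _) (poisson_ge0 _ u0) h (poisson_compare _ t0 tu As)).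
  rewrite ge0_integralZl_EFin//; last exact: measurable_funTS.
  rewrite (integral_shift_segment _ _ _ mQ Q0) -mulrA EFinM lee_wpmul2l//.
  (* Recentring at [s0] shifts the segment, which is then enlarged to one symmetric about 0. *)
  pose L' := L + `|s0|.
  apply: (@le_trans _ _ (\int[mu]_(x in `[(- L')%R, L']) Q x)%E).
    apply: ge0_subset_integral => //; first exact: measurable_funTS.
    have := ler_norm s0; have := ler_norm (- s0); rewrite normrN => h1 h2.
    by apply: subset_itv; rewrite bnd_simp /L'; clear -h1 h2; lra.
  by rewrite EFinM -E; exact: poisson_line_maximal.
have zE : Num.sqrt (nc (phi z)) = Num.sqrt (nc (damp d z)) * Num.sqrt (nc (phi1 z)).
  by rewrite -sqrtrM ?nc_ge0// phi1E mulrC divfK// gt_eqF// dmp//= ltW.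
have dz : Num.sqrt (nc (damp d z)) <= 1 + e.
  have h : nc (damp d z) <= 1 + e.
    rewrite (le_trans (nc_damp_le _ (ltW d0)))// lerD2l /d mulrAC ler_pdivrMr//.
    by rewrite ler_pM2l// lerDl.
  have e10 : 0 <= 1 + e by clear -e0; lra.
  rewrite -(@ler_pXn2r _ 2)// ?nnegrE ?sqrtr_ge0// sqr_sqrtr ?nc_ge0//.
  by rewrite (le_trans h)// expr2 ler_peMr//; clear -e0; lra.
rewrite /a zE; apply: ler_pM; rewrite ?sqrtr_ge0//.
apply: le_trans bnd _; rewrite sqrtr_sqr ger0_norm ?(ltW e0)// mulrDr lerD2l.
rewrite /half_plane_cst -mulrA ler_wpM2l ?expR_ge0// -mulrA.
by rewrite ler_wpM2l ?invr_ge0 ?pi_ge0.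
Qed.

End half_plane.

(** * Maximal operators along measure preserving flows *)

Section hardy_littlewood_L2.
Context {R : realType}.
Notation mu := (@lebesgue_measure R).
Notation Rm := (measurableTypeR R).
Local Open Scope ereal_scope.

Lemma measurable_ereal_sup d (T : measurableType d) (f : nat -> T -> \bar R) :
  (forall n, measurable_fun setT (f n)) ->
  measurable_fun setT (fun x => ereal_sup (range (f ^~ x))).
Proof.
move=> mf; have := measurable_fun_esups mf 0%N.
by apply: eq_measurable_fun => x _; rewrite /esups /sdrop; congr ereal_sup; apply/seteqP; split => _ [n _ <-]; exists n.
Qed.

Lemma measurable_ltr_set d (T : measurableType d) (f g : T -> R) :
  measurable_fun setT f -> measurable_fun setT g -> measurable [set x | (f x < g x)%R].
Proof.
move=> /measurable_EFinP mf /measurable_EFinP mg.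
have := measurable_lte measurableT mf mg; rewrite setTI.
by rewrite (_ : [set x | _] = [set x | (f x < g x)%R])//; apply/seteqP; split => x /=; rewrite lte_fin.
Qed.

Lemma eq_indic (T U : Type) (A : set T) (B : set U) x y : (A x <-> B y) ->
  \1_A x = \1_B y :> R.
Proof.
move=> AB; rewrite !indicE (_ : (x \in A) = (y \in B))//.
by apply/idP/idP; rewrite !inE => /AB.
Qed.

Lemma integral_setT_indic (A : set Rm) : measurable A -> \int[mu]_x (\1_A x)%:E = mu A.
Proof. by move=> mA; rewrite integral_indic// setIT. Qed.

Lemma integral_segment_cst (a b N : R) : (a <= b)%R ->
  \int[mu]_(u in `[a, b]) N%:E = N%:E * (b - a)%:E.
Proof. by move=> ab; rewrite integral_cst//; congr (_ * _); exact: lebesgue_segment. Qed.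

Lemma HL_maximal_le (f : R -> R) (N : R) x : measurable_fun setT f ->
  (forall y, `|f y|%R <= N)%R -> HL_maximal f x <= N%:E.
Proof.
move=> mf fN; apply: ge_ereal_sup => _ [r + <-]; rewrite /= in_itv/= andbT => r0.
have r20 : (r *+ 2 != 0)%R by rewrite mulrn_eq0/= gt_eqF.
rewrite /iavg lebesgue_measure_ball ?(ltW r0)// inver (negbTE r20).
apply: (@le_trans _ _ (((r *+ 2)^-1)%:E * \int[mu]_(y in ball x r) (N%:E))).
  rewrite lee_wpmul2l// ?lee_fin ?invr_ge0 ?mulrn_wge0 ?(ltW r0)//.
  apply: ge0_le_integral => //; first exact: measurable_ball.
  - apply: measurable_funTS; apply: measurableT_comp => //; exact/measurable_EFinP.
  - by move=> y _; rewrite lee_fin.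
have -> : \int[mu]_(y in ball x r) N%:E = N%:E * (r *+ 2)%:E.
  by rewrite integral_cst; [congr (_ * _); exact: lebesgue_measure_ball (ltW r0)|exact: measurable_ball].
by rewrite -!EFinM lee_fin mulrCA mulVf// mulr1.
Qed.

Lemma HL_maximal_addr (f g : R -> R) (N : R) x : measurable_fun setT f ->
  measurable_fun setT g -> (forall y, `|g y|%R <= N)%R ->
  HL_maximal (f \+ g)%R x <= HL_maximal f x + N%:E.
Proof.
move=> mf mg gN; apply: ge_ereal_sup => _ [r r0 <-].
apply: (@le_trans _ _ (iavg f (ball x r) + iavg g (ball x r))).
  apply: iavgD; [exact: measurable_ball| |exact: measurable_funTS|exact: measurable_funTS].
  by move: r0; rewrite /= in_itv/= andbT => r0; rewrite lebesgue_measure_ball ?ltry ?ltW.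
apply: leeD; first by apply: ereal_sup_ubound; exists r.
by apply: (le_trans _ (HL_maximal_le x mg gN)); apply: ereal_sup_ubound; exists r.
Qed.

(** The part of [h] with [2 h <= c] contributes at most [c / 2] to the maximal function, so the
    remaining part must exceed [c / 2]. The weak type constant 3 at that level gives [6 / c]. *)
Lemma HL_maximal_weak (h : Rm -> R) (c : R) : measurable_fun setT h -> (forall x, 0 <= h x)%R ->
  mu.-integrable setT (EFin \o h) -> (0 < c)%R ->
  mu [set x | c%:E < HL_maximal h x] <=
  (6 / c)%:E * \int[mu]_x (h x * \1_[set x | (c < 2 * h x)%R] x)%:E.
Proof.
move=> mh h0 ih c0; set A := [set x | (c < 2 * h x)%R].
have mA : measurable (A : set Rm).
  by apply: measurable_ltr_set => //; exact: measurable_funM.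
pose h1 x := (h x * \1_A x)%R; pose h2 x := (h x * \1_(~` A) x)%R.
have mh1 : measurable_fun setT h1 by apply: measurable_funM => //; exact: measurable_indic.
have mh2 : measurable_fun setT h2.
  by apply: measurable_funM => //; apply: measurable_indic; exact: measurableC.
have hE : h = (h1 \+ h2)%R.
  apply/funext => x; rewrite /h1 /h2 /= !indicE in_setC.
  by case: (x \in A); rewrite /= ?mulr1 ?mulr0 ?addr0 ?add0r.
have h2c y : (`|h2 y| <= c / 2)%R.
  rewrite /h2 indicE in_setC; case: (boolP (y \in A)) => [_|]; first by rewrite mulr0 normr0 divr_ge0// ltW.
  rewrite mulr1 ger0_norm//; rewrite notin_setE /A /= => /negP; rewrite -leNgt => h2c.
  by rewrite ler_pdivlMr// mulrC.
have ih1 : mu.-integrable setT (EFin \o h1).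
  apply: (le_integrable measurableT _ _ ih); first exact/measurable_EFinP.
  move=> x _; rewrite /= lee_fin /h1 normrM ler_piMr// indicE.
  by case: (_ \in _); rewrite ?normr1 ?normr0.
have c20 : (0 < c / 2)%R by rewrite divr_gt0.
apply: (@le_trans _ _ (mu [set x | (c / 2)%:E < HL_maximal h1 x])).
  have l1 : locally_integrable setT h1 by exact: open_integrable_locally openT ih1.
  have l0 : locally_integrable setT h by exact: open_integrable_locally openT ih.
  apply: le_measure; rewrite ?inE.
  - rewrite -[X in measurable X]setTI; apply: emeasurable_fun_o_infty => //.
    exact: measurable_HL_maximal.
  - rewrite -[X in measurable X]setTI; apply: emeasurable_fun_o_infty => //.
    exact: measurable_HL_maximal.
  move=> x /= cx; rewrite ltNge; apply/negP => h1x; move: cx; apply/negP; rewrite -leNgt hE.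
  rewrite (le_trans (HL_maximal_addr x mh1 mh2 h2c))//.
  by rewrite (le_trans (leeD h1x (lexx _)))// -EFinD lee_fin; lra.
apply: (le_trans (maximal_inequality _ c20)); first exact: open_integrable_locally openT ih1.
have -> : (3 / (c / 2) = 6 / c)%R by field; rewrite gt_eqF.
rewrite le_eqVlt; apply/orP; left; apply/eqP; congr (_ * _).
apply: eq_integral => x _; rewrite gee0_abs// lee_fin mulr_ge0//.
Qed.

(** A layer-cake bound where only the levels between [y / 2] and [y] are kept, at the cost of the
    constant 4 instead of 2. *)
Lemma sqr_le_layer (y : R) : (0 <= y)%R ->
  (y * y)%:E <= 4%:E * \int[mu]_c (c * \1_`]0, y[%classic c)%:E.
Proof.
rewrite le_eqVlt => /predU1P[<-|y0].
  rewrite mul0r mule_ge0// integral_ge0// => c _; rewrite lee_fin indicE.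
  by rewrite mem_setE in_itv/=; case: (boolP (0 < c < 0)%R) => [/andP[/ltW c0 _]|_]; rewrite ?mulr1 ?mulr0.
have my a b : measurable (`]a, b[%classic : set Rm) by exact: measurable_itv.
have : (y / 2)%:E * mu `](y / 2)%R, y[ <= \int[mu]_c (c * \1_`]0%R, y[%classic c)%:E.
  rewrite -integral_setT_indic; last exact: my.
  rewrite -ge0_integralZl_EFin//; last 2 first.
  - by apply/measurable_EFinP; apply: measurable_indic; exact: my.
  - by rewrite divr_ge0 ?ltW.
  apply: ge0_le_integral => //.
  - by move=> c _; rewrite -EFinM lee_fin mulr_ge0// divr_ge0// ltW.
  - by apply: emeasurable_funM => //; apply/measurable_EFinP; apply: measurable_indic; exact: my.
  - apply/measurable_EFinP; apply: measurable_funM => //; apply: measurable_indic; exact: my.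
  move=> c _; rewrite -EFinM lee_fin !indicE !mem_setE !in_itv/=.
  have [c1|c1] /= := ltP (y / 2)%R c.
    have -> : (0 < c)%R by apply: le_lt_trans c1; rewrite divr_ge0// ltW.
    by case: (c < y)%R; rewrite /= ?mulr1 ?mulr0// ltW.
  rewrite mulr0; by case: (boolP (0 < c < y)%R) => [/andP[/ltW c0 _]|_]; rewrite ?mulr1 ?mulr0.
rewrite lebesgue_measure_itv/= lte_fin ifT; last lra.
rewrite -EFinB -EFinM => h; apply: le_trans (lee_wpmul2l _ h); rewrite ?lee_fin//; lra.
Qed.

(** Marcinkiewicz interpolation: layers of the square, the truncated weak type bound on each level,
    and Fubini. The constant is [4 * 6 * 2], the last factor being the length of the levels below
    [2 h] relative to [h]. The bound [N] makes the maximal function finite and does not enter the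
    constant. *)
Lemma HL_maximal_L2 (h : Rm -> R) (N : R) : measurable_fun setT h -> (forall x, 0 <= h x <= N)%R ->
  mu.-integrable setT (EFin \o h) ->
  \int[mu]_x (HL_maximal h x * HL_maximal h x) <= 48%:E * \int[mu]_x (h x * h x)%:E.
Proof.
move=> mh h01 ih.
have h0 x : (0 <= h x)%R by case/andP: (h01 x).
have l0 : locally_integrable setT h by exact: open_integrable_locally openT ih.
have mM : measurable_fun setT (HL_maximal h : Rm -> \bar R) by exact: measurable_HL_maximal.
pose g x := fine (HL_maximal h x).
have hN y : (`|h y| <= N)%R by rewrite ger0_norm//; case/andP: (h01 y).
have gE x : HL_maximal h x = (g x)%:E.
  rewrite fineK// ge0_fin_numE; last exact: HL_maximalT_ge0.
  by rewrite (le_lt_trans (HL_maximal_le x mh hN))// ltry.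
have g0 x : (0 <= g x)%R by rewrite -lee_fin -gE; exact: HL_maximalT_ge0.
have mg : measurable_fun setT (g : Rm -> R).
  by apply/measurable_EFinP; apply: eq_measurable_fun mM => x _; rewrite gE.
(* The region under the graph of [k]: its sections give the level sets on one side of Fubini and the
   layers on the other. *)
pose S (k : Rm -> R) : set (Rm * Rm) := [set p | (0 < p.2)%R /\ (p.2 < k p.1)%R].
have mS k : measurable_fun setT k -> measurable (S k).
  move=> mk; have m1 : measurable [set p : Rm * Rm | (0 < p.2)%R] by exact: measurable_ltr_set.
  have m2 : measurable [set p : Rm * Rm | (p.2 < k p.1)%R].
    by apply: (measurable_ltr_set (g := k \o fst)) => //; exact: measurableT_comp.
  by rewrite (_ : S k = [set p | (0 < p.2)%R] `&` [set p : Rm * Rm | (p.2 < k p.1)%R])//; exact: measurableI.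
have S1 k x c : \1_(S k) (x, c) = \1_`]0%R, (k x)[%classic c :> R.
  by apply: eq_indic; rewrite /S /= in_itv/=; split=> [[-> ->]//|/andP].
pose P (p : Rm * Rm) : \bar R := (p.2 * \1_(S g) p)%:E.
have mP : measurable_fun setT P.
  by apply/measurable_EFinP; apply: measurable_funM => //; apply: measurable_indic; exact: mS.
have P0 p : 0 <= P p.
  rewrite lee_fin indicE; case: (boolP (p \in S g)) => [|_]; last by rewrite mulr0.
  by rewrite inE mulr1 => -[/ltW].
have m2h : measurable_fun setT (fun x => (2 * h x)%R) by exact: measurable_funM.
pose Q (p : Rm * Rm) : \bar R := (h p.1 * \1_(S (fun x => 2 * h x)%R) p)%:E.
have mQ : measurable_fun setT Q.
  apply/measurable_EFinP; apply: measurable_funM; last by apply: measurable_indic; exact: mS.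
  exact: measurableT_comp mh measurable_fst.
have Q0 p : 0 <= Q p by rewrite lee_fin mulr_ge0.
under eq_integral do rewrite gE -EFinM.
apply: (@le_trans _ _ (\int[mu]_x (4%:E * \int[mu]_c P (x, c)))).
  apply: ge0_le_integral => //.
  - by move=> x _; rewrite lee_fin mulr_ge0.
  - by apply/measurable_EFinP; exact: measurable_funM.
  - by apply: emeasurable_funM => //; exact: measurable_fun_fubini_tonelli_F.
  move=> x _; rewrite (le_trans (sqr_le_layer (g0 x)))// lee_wpmul2l//.
  by rewrite le_eqVlt; apply/orP; left; apply/eqP; apply: eq_integral => c _; rewrite /P S1.
rewrite ge0_integralZl_EFin//; [|by move=> x _; exact: integral_ge0|exact: measurable_fun_fubini_tonelli_F].
rewrite fubini_tonelli//.
have step : \int[mu]_c \int[mu]_x P (x, c) <= \int[mu]_c (6%:E * \int[mu]_x Q (x, c)).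
  apply: ge0_le_integral => //.
  - by move=> c _; exact: integral_ge0.
  - exact: measurable_fun_fubini_tonelli_G.
  - by apply: emeasurable_funM => //; exact: measurable_fun_fubini_tonelli_G.
  move=> c _; have [c0|c0] := leP c 0%R.
    rewrite integral0_eq ?mule_ge0 ?integral_ge0// => x _.
    by rewrite /P S1 indicE mem_setE in_itv/= ltNge c0 mulr0.
  have wk := HL_maximal_weak mh h0 ih c0.
  have -> : \int[mu]_x P (x, c) = c%:E * mu [set x | c%:E < HL_maximal h x].
    have mB : measurable ([set x | c%:E < HL_maximal h x] : set Rm).
      by rewrite -[X in measurable X]setTI; exact: emeasurable_fun_o_infty.
    rewrite -integral_setT_indic//.
    rewrite -ge0_integralZl_EFin//; last 2 first.
    - by apply/measurable_EFinP; exact: measurable_indic.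
    - exact: ltW.
    apply: eq_integral => x _; rewrite /P S1 -EFinM; congr (_ * _)%:E.
    by apply: eq_indic; rewrite /= in_itv/= c0/= gE lte_fin.
  apply: le_trans (lee_wpmul2l _ wk) _; first by rewrite lee_fin ltW.
  rewrite muleA -EFinM mulrC divfK ?gt_eqF// le_eqVlt; apply/orP; left; apply/eqP; congr (_ * _).
  apply: eq_integral => x _; rewrite /Q S1; congr (_ * _)%:E.
  by apply: eq_indic; rewrite /= in_itv/= c0.
apply: le_trans (lee_wpmul2l _ step) _; first by rewrite lee_fin.
rewrite ge0_integralZl_EFin//; [|by move=> x _; exact: integral_ge0|exact: measurable_fun_fubini_tonelli_G].
rewrite muleA -fubini_tonelli//.
have -> : \int[mu]_x \int[mu]_c Q (x, c) = \int[mu]_x (2%:E * (h x * h x)%:E).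
  apply: eq_integral => x _; rewrite /Q.
  have mI : measurable (`]0%R, (2 * h x)%R[%classic : set Rm) by exact: measurable_itv.
  transitivity ((h x)%:E * \int[mu]_c (\1_`]0%R, (2 * h x)%R[%classic c)%:E).
    rewrite -ge0_integralZl_EFin//; last by apply/measurable_EFinP; exact: measurable_indic.
    by apply: eq_integral => c _; rewrite S1.
  rewrite integral_setT_indic// lebesgue_measure_itv/= lte_fin.
  case: ifPn => [_|]; first by rewrite sube0 -!EFinM; congr _%:E; ring.
  rewrite -leNgt => hx; have -> : h x = 0%R by have := h0 x; lra.
  by rewrite mul0r !mule0.
rewrite ge0_integralZl_EFin//; last by apply/measurable_EFinP; exact: measurable_funM.
  by rewrite muleA -!EFinM (_ : (4 * 6 * 2 = 48 :> R)%R)//; lra.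
by move=> x _; rewrite lee_fin mulr_ge0.
Qed.

End hardy_littlewood_L2.

(** * Transference to measure preserving flows *)

Section flow.
Context {R : realType} d (X : measurableType d).
Variable nu : {sigma_finite_measure set X -> \bar R}.
Notation mu := (@lebesgue_measure R).
Notation Rm := (measurableTypeR R).
Local Open Scope ereal_scope.
Implicit Types (phi : R -> X -> X) (F G : X -> \bar R).

(** Invariance is stated through integrals of nonnegative functions, the form that Fubini transmits
    to products and shears. *)
Record measure_flow phi : Prop := MeasureFlow {
  flow_measurable : measurable_fun setT (fun p : X * Rm => phi p.2 p.1);
  flowD : forall u v x, phi (u + v)%R x = phi u (phi v x);
  flow_invariant : forall u G, measurable_fun setT G -> (forall x, 0 <= G x) ->
    \int[nu]_x G (phi u x) = \int[nu]_x G x }.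

Definition flow_maximal phi F x := line_maximal (fun u => F (phi u x)).

Lemma measurable_flow_orbit phi F x : measure_flow phi -> measurable_fun setT F ->
  measurable_fun setT (fun u : Rm => F (phi u x)).
Proof.
move=> [mphi _ _] mF; apply: measurableT_comp => //.
exact: (measurableT_comp mphi (pair1_measurable x)).
Qed.

Lemma measurable_indic_snd (A : set Rm) : measurable A ->
  measurable_fun setT (fun p : X * Rm => \1_A p.2 : R).
Proof.
move=> mA; have h : measurable_fun setT (\1_A : Rm -> R) by exact: measurable_indic.
exact: (measurableT_comp h measurable_snd).
Qed.

Lemma measurable_flow_average phi F r : measure_flow phi -> measurable_fun setT F ->
  (forall x, 0 <= F x) ->
  measurable_fun setT (fun x => line_average (fun u => F (phi u x)) r).
Proof.
move=> hphi mF F0; apply: emeasurable_funM => //.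
pose H (p : X * Rm) := F (phi p.2 p.1) * (\1_`[(- r)%R, r]%classic p.2)%:E.
have mH : measurable_fun setT H.
  apply: emeasurable_funM; first exact: measurableT_comp (flow_measurable hphi).
  by apply/measurable_EFinP; apply: measurable_indic_snd; exact: measurable_segment.
have H0 p : 0 <= H p by rewrite mule_ge0.
have := @measurable_fun_fubini_tonelli_F _ _ X Rm R mu H mH H0.
apply: eq_measurable_fun => x _.
rewrite /fubini_F [RHS]integral_mkcond; apply: eq_integral => u _.
by rewrite /H /patch indicE; case: ifPn; rewrite ?mule1 ?mule0.
Qed.

Lemma measurable_flow_maximal phi F : measure_flow phi -> measurable_fun setT F ->
  (forall x, 0 <= F x) -> measurable_fun setT (flow_maximal phi F).
Proof.
by move=> hphi mF F0; apply: measurable_ereal_sup => n; exact: measurable_flow_average.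
Qed.

Lemma line_average_le (F : Rm -> \bar R) (N r : R) : (0 < r)%R -> measurable_fun setT F ->
  (forall x, 0 <= F x <= N%:E) -> line_average F r <= N%:E.
Proof.
move=> r0 mF FN; rewrite /line_average.
have r20 : (0 < 2 * r)%R by rewrite mulr_gt0.
apply: (@le_trans _ _ (((2 * r)^-1)%:E * \int[mu]_(u in `[(- r)%R, r]) (N%:E))).
  rewrite lee_wpmul2l ?lee_fin ?invr_ge0 ?(ltW r20)//.
  apply: ge0_le_integral => //.
  - by move=> u _; case/andP: (FN u).
  - exact: measurable_funTS.
  - by move=> u _; case/andP: (FN u).
rewrite integral_segment_cst; last by lra.
rewrite (_ : (r - - r = 2 * r)%R); last by ring.
by rewrite -!EFinM lee_fin mulrCA mulVf ?mulr1// gt_eqF.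
Qed.

Lemma flow_maximal_bounds phi F (N : R) : measure_flow phi -> measurable_fun setT F ->
  (forall x, 0 <= F x <= N%:E) -> forall x, 0 <= flow_maximal phi F x <= N%:E.
Proof.
move=> hphi mF FN x; apply/andP; split.
  by apply: line_maximal_ge0 => u; case/andP: (FN (phi u x)).
apply: ge_ereal_sup => _ [n _ <-]; apply: line_average_le => //; first exact: avg_radius_gt0.
exact: (measurable_flow_orbit x hphi mF).
Qed.

(** An arbitrary sequence of radii allows truncation: transference needs radii bounded by the length
    of the time window. *)
Definition radii_maximal (rad : nat -> R) phi F x :=
  ereal_sup (range (fun n => line_average (fun u => F (phi u x)) (rad n))).

(* Calderon's transference: averaging over a time window [[-L, L]] turns the
   maximal operator along the flow into the one-dimensional one. *)
Lemma transference phi (f : X -> R) (N L : R) (rad : nat -> R) : measure_flow phi ->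
  measurable_fun setT f -> (forall x, 0 <= f x <= N)%R -> (0 < L)%R ->
  (forall n, 0 < rad n <= L)%R ->
  \int[nu]_x (radii_maximal rad phi (EFin \o f) x * radii_maximal rad phi (EFin \o f) x) <=
  96%:E * \int[nu]_x (f x * f x)%:E.
Proof.
move=> hphi mf fN L0 radL; set M := radii_maximal rad phi _.
have f0 x : (0 <= f x)%R by case/andP: (fN x).
have mF : measurable_fun setT (EFin \o f) by exact/measurable_EFinP.
have F0 x : 0 <= (EFin \o f) x by rewrite lee_fin.
have mM : measurable_fun setT M.
  by apply: measurable_ereal_sup => n; exact: (measurable_flow_average _ hphi mF F0).
have M0 x : 0 <= M x.
  apply: (@le_trans _ _ (line_average (fun u => (f (phi u x))%:E) (rad 0%N))).
    rewrite mule_ge0 ?integral_ge0// => [|u _]; last exact: F0.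
    by rewrite lee_fin invr_ge0 mulr_ge0// ltW//; case/andP: (radL 0%N).
  by apply: ereal_sup_ubound; exists 0%N.
have mphi := flow_measurable hphi.
pose I : set Rm := `[(- L)%R, L]%classic; pose J : set Rm := `[(- (2 * L))%R, (2 * L)%R]%classic.
have mI : measurable I by exact: measurable_segment.
have mJ : measurable J by exact: measurable_segment.
pose W (p : X * Rm) := M (phi p.2 p.1) * M (phi p.2 p.1) * (\1_I p.2)%:E.
(* The orbit of [x], cut off at twice the window: averages of radius at most [L] centred in
   [[-L, L]] do not see the cutoff. *)
pose h x v := (f (phi v x) * \1_J v)%R.
pose V (p : X * Rm) := (h p.1 p.2 * h p.1 p.2)%:E.
have mMphi : measurable_fun setT (fun p : X * Rm => M (phi p.2 p.1)) by exact: measurableT_comp mphi.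
have mW : measurable_fun setT W.
  by apply: emeasurable_funM; [exact: emeasurable_funM|apply/measurable_EFinP; exact: measurable_indic_snd].
have mh2 : measurable_fun setT (fun p : X * Rm => h p.1 p.2).
  by apply: measurable_funM; [exact: measurableT_comp mphi|exact: measurable_indic_snd].
have mV : measurable_fun setT V by apply/measurable_EFinP; exact: measurable_funM.
have W0 p : 0 <= W p by rewrite mule_ge0 ?mule_ge0// lee_fin.
have h0 x v : (0 <= h x v)%R by rewrite mulr_ge0.
have V0 p : 0 <= V p by rewrite lee_fin mulr_ge0.
have mh x : measurable_fun setT (h x : Rm -> R).
  exact: (measurableT_comp mh2 (pair1_measurable x)).
have hN x v : (0 <= h x v <= N)%R.
  rewrite h0 (le_trans (ler_piMr _ _))//; case/andP: (fN (phi v x)) => //.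
have N0 : (0 <= N)%R by rewrite (le_trans (f0 point))//; case/andP: (fN point).
have ih x : mu.-integrable setT (EFin \o h x : Rm -> \bar R).
  apply/integrableP; split; first exact/measurable_EFinP.
  apply: (@le_lt_trans _ _ (\int[mu]_v (N%:E * (\1_J v)%:E))).
    apply: ge0_le_integral => //.
    - by do 2 apply: measurableT_comp => //; exact/measurable_EFinP.
    - by apply: emeasurable_funM => //; apply/measurable_EFinP; exact: measurable_indic.
    move=> v _; rewrite gee0_abs ?lee_fin// /h ler_wpM2r//.
    by case/andP: (fN (phi v x)).
  rewrite ge0_integralZl_EFin//; last by apply/measurable_EFinP; exact: measurable_indic.
  by rewrite integral_setT_indic// lebesgue_segment -?EFinM ?ltry//; lra.
(* By [flowD], the averages at [phi u x] are averages of [h x] centred at [u]. *)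
have MHL x u : I u -> M (phi u x) <= HL_maximal (h x) u.
  rewrite /I /= in_itv/= => /andP[u1 u2].
  apply: ge_ereal_sup => _ [n _ <-]; have /andP[r0 rL] := radL n; set r := rad n in r0 rL *.
  apply: (@le_trans _ _ (iavg (h x) (ball u r))); last first.
    by apply: ereal_sup_ubound; exists r => //=; rewrite in_itv/= r0.
  have r20 : (r *+ 2 != 0)%R by rewrite mulrn_eq0/= gt_eqF.
  rewrite /iavg lebesgue_measure_ball ?(ltW r0)// inver (negbTE r20) /line_average.
  have -> : (r *+ 2 = 2 * r)%R by rewrite mulr_natl.
  rewrite lee_wpmul2l ?lee_fin ?invr_ge0 ?mulr_ge0 ?(ltW r0)//.
  have aE y : `|(h x y)%:E| = (h x y)%:E by rewrite gee0_abs// lee_fin.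
  under [X in _ <= X]eq_integral do rewrite aE.
  rewrite ball_itv -(@integral_itv_bndoo _ _ _ _ true false); last first.
    apply: measurable_funTS; apply/measurable_EFinP; exact: mh.
  have sh := @integral_shift_segment R (fun v => (h x v)%:E) u (- r)%R r
    ((measurable_EFinP _ _).2 (mh x)) (fun v => h0 x v).
  rewrite (addrC u r) (addrC u (- r)%R) -sh.
  rewrite le_eqVlt; apply/orP; left; apply/eqP; apply: eq_integral => w.
  rewrite inE/= in_itv/= => /andP[w1 w2]; rewrite /h (flowD hphi) indicE mem_set ?mulr1//.
  by rewrite /J /= in_itv/=; apply/andP; split; lra.
have key x : \int[mu]_u W (x, u) <= 48%:E * \int[mu]_v V (x, v).
  apply: le_trans (HL_maximal_L2 (mh x) (hN x) (ih x)).
  have lih : locally_integrable setT (h x) by exact: open_integrable_locally openT (ih x).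
  have HL0 v : 0 <= HL_maximal (h x) v by exact: HL_maximalT_ge0.
  apply: ge0_le_integral => //.
  - exact: (measurableT_comp mW (pair1_measurable x)).
  - by apply: emeasurable_funM; exact: measurable_HL_maximal.
  move=> u _; rewrite /W /= indicE; case: (boolP (u \in I)) => [|_]; last first.
    by rewrite mule0 mule_ge0.
  by rewrite inE mule1 => uI; apply: lee_pmul => //; exact: MHL.
have lhs : \int[nu]_x \int[mu]_u W (x, u) = (2 * L)%:E * \int[nu]_x (M x * M x).
  rewrite fubini_tonelli//.
  have -> : \int[mu]_u \int[nu]_x W (x, u) =
      \int[mu]_u ((\int[nu]_x (M x * M x)) * (\1_I u)%:E).
    have mMM : measurable_fun setT (fun x => M x * M x) by exact: emeasurable_funM.
    have MM0 x : 0 <= M x * M x by exact: mule_ge0.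
    apply: eq_integral => u _; rewrite -(flow_invariant hphi u mMM MM0).
    have mu' : measurable_fun setT (fun x => M (phi u x)).
      exact: (measurableT_comp mMphi (pair2_measurable u)).
    by rewrite -(ge0_integralZr nu measurableT (emeasurable_funM mu' mu')).
  rewrite ge0_integralZl//; last 2 first.
  - by apply/measurable_EFinP; exact: measurable_indic.
  - by rewrite integral_ge0// => x _; exact: mule_ge0.
  rewrite integral_setT_indic// lebesgue_segment; last by lra.
  by rewrite muleC; congr (_%:E * _); ring.
have rhs : \int[nu]_x \int[mu]_v V (x, v) = (4 * L)%:E * \int[nu]_x (f x * f x)%:E.
  rewrite fubini_tonelli//.
  have mff : measurable_fun setT (fun x => (f x * f x)%:E).
    by apply/measurable_EFinP; exact: measurable_funM.
  have ff0 x : 0 <= (f x * f x)%:E by rewrite lee_fin mulr_ge0.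
  have -> : \int[mu]_v \int[nu]_x V (x, v) =
      \int[mu]_v ((\int[nu]_x (f x * f x)%:E) * (\1_J v)%:E).
    apply: eq_integral => v _; rewrite -(flow_invariant hphi v mff ff0).
    rewrite -ge0_integralZr//; last first.
      exact: (measurableT_comp mff (measurableT_comp mphi (pair2_measurable v))).
    apply: eq_integral => x _; rewrite /V /h /= -EFinM; congr _%:E.
    by rewrite indicE; case: (_ \in _); rewrite ?mulr1 ?mulr0.
  rewrite ge0_integralZl//; last 2 first.
  - by apply/measurable_EFinP; exact: measurable_indic.
  - exact: integral_ge0.
  rewrite integral_setT_indic// lebesgue_segment; last by lra.
  by rewrite muleC; congr (_%:E * _); ring.
have : \int[nu]_x \int[mu]_u W (x, u) <= 48%:E * \int[nu]_x \int[mu]_v V (x, v).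
  have mVF : measurable_fun setT (fun x => \int[mu]_v V (x, v)) by exact: measurable_fun_fubini_tonelli_F.
  rewrite -ge0_integralZl_EFin//; last by move=> x _; exact: integral_ge0.
  apply: ge0_le_integral => //.
  - by move=> x _; exact: integral_ge0.
  - exact: measurable_fun_fubini_tonelli_F.
  - exact: emeasurable_funM.
(* By invariance the two sides carry the window lengths [2 L] and [4 L]; their ratio doubles 48 to
   96, uniformly in [L]. *)
rewrite lhs rhs => main.
have L20 : (0 < 2 * L)%R by rewrite mulr_gt0.
have Li : 0 <= ((2 * L)^-1)%:E by rewrite lee_fin invr_ge0 ltW.
have := lee_wpmul2l Li main.
rewrite !muleA -!EFinM mulVf ?gt_eqF// mul1e => /le_trans; apply.
rewrite le_eqVlt; apply/orP; left; apply/eqP; congr (_%:E * _).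
by field; rewrite gt_eqF.
Qed.

(** Only the radii of index at most [k] are used at first; their sum bounds them all and serves as
    the window. The constant of [transference] does not depend on the window, so monotone
    convergence in [k] concludes. *)
Lemma flow_maximal_L2 phi F (N : R) : measure_flow phi -> measurable_fun setT F ->
  (forall x, 0 <= F x <= N%:E) ->
  \int[nu]_x (flow_maximal phi F x * flow_maximal phi F x) <= 96%:E * \int[nu]_x (F x * F x).
Proof.
move=> hphi mF FN; pose f x := fine (F x).
have fE x : F x = (f x)%:E.
  case/andP: (FN x) => F0 FN'; rewrite fineK// ge0_fin_numE//.
  by rewrite (le_lt_trans FN')// ltry.
have -> : F = EFin \o f by apply/funext => x; rewrite fE.
have mf : measurable_fun setT f.
  by apply/measurable_EFinP; apply: eq_measurable_fun mF => x _; rewrite fE.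
have fN x : (0 <= f x <= N)%R by rewrite -!lee_fin -fE.
have mF' : measurable_fun setT (EFin \o f) by exact/measurable_EFinP.
have F0 x : 0 <= (EFin \o f) x by rewrite lee_fin; case/andP: (fN x).
pose rad (k n : nat) : R := avg_radius (minn n k).
pose M k := radii_maximal (rad k) phi (EFin \o f).
have mM k : measurable_fun setT (M k).
  by apply: measurable_ereal_sup => n; exact: (measurable_flow_average _ hphi mF' F0).
have av0 r x : (0 < r)%R -> 0 <= line_average (fun u => (EFin \o f) (phi u x)) r.
  by move=> r0; rewrite mule_ge0 ?integral_ge0// lee_fin invr_ge0 mulr_ge0// ltW.
have M0 k x : 0 <= M k x.
  apply: le_trans (av0 (rad k 0%N) x (avg_radius_gt0 _)) _.
  by apply: ereal_sup_ubound; exists 0%N.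
have Mnd x : {homo M^~ x : k l / (k <= l)%N >-> k <= l}.
  move=> k l kl; apply: ereal_sup_le => _ [n _ <-].
  exists (minn n k) => //; rewrite /rad (_ : minn (minn n k) l = minn n k)//.
  by apply/minn_idPl; rewrite (leq_trans (geq_minr _ _)).
have Mle k x : M k x <= flow_maximal phi (EFin \o f) x.
  by apply: ereal_sup_le => _ [n _ <-]; exists (minn n k).
have Mcvg x : M ^~ x @ \oo --> flow_maximal phi (EFin \o f) x.
  have := ereal_nondecreasing_cvgn (Mnd x).
  rewrite (_ : ereal_sup _ = flow_maximal phi (EFin \o f) x)//.
  apply/eqP; rewrite eq_le; apply/andP; split.
    by apply: ge_ereal_sup => _ [k _ <-]; exact: Mle.
  apply: ge_ereal_sup => _ [n _ <-]; apply: (@le_trans _ _ (M n x)).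
    by apply: ereal_sup_ubound; exists n => //; rewrite /rad minnn.
  by apply: ereal_sup_ubound; exists n.
have FB x : 0 <= (EFin \o f) x <= N%:E by rewrite /= !lee_fin.
have Mfin x : flow_maximal phi (EFin \o f) x \is a fin_num.
  case/andP: (flow_maximal_bounds hphi mF' FB x) => a b.
  by rewrite ge0_fin_numE// (le_lt_trans b)// ltry.
have sq x : (fun k => M k x * M k x) @ \oo -->
    flow_maximal phi (EFin \o f) x * flow_maximal phi (EFin \o f) x.
  by apply: cvgeM => //; exact: mule_def_fin.
have nd2 x : {homo (fun k => M k x * M k x) : k l / (k <= l)%N >-> k <= l}.
  by move=> k l kl; apply: lee_pmul => //; exact: Mnd.
have -> : \int[nu]_x (flow_maximal phi (EFin \o f) x * flow_maximal phi (EFin \o f) x) =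
    \int[nu]_x (limn (fun k => M k x * M k x)).
  by apply: eq_integral => x _; apply/esym/cvg_lim.
rewrite monotone_convergence//; last 2 first.
- by move=> k; exact: emeasurable_funM.
- by move=> k x _; exact: mule_ge0.
apply: lime_le.
  apply: ereal_nondecreasing_is_cvgn => k l kl; apply: ge0_le_integral => //.
  - by move=> x _; exact: mule_ge0.
  - exact: emeasurable_funM.
  - exact: emeasurable_funM.
  - by move=> x _; exact: nd2.
apply: nearW => k; pose L : R := (\sum_(i < k.+1) avg_radius i)%R.
have rL n : (0 < rad k n <= L)%R.
  rewrite avg_radius_gt0/= /rad /L; have nk : (minn n k < k.+1)%N by rewrite ltnS geq_minr.
  rewrite (bigD1 (Ordinal nk))//= lerDl sumr_ge0// => i _.
  by rewrite ltW// avg_radius_gt0.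
apply: (transference hphi mf fN _ rL).
by case/andP: (rL 0%N) => a; exact: lt_le_trans.
Qed.

(** The head of the list is the outermost operator. Each operator preserves measurability and the
    bound [N], so the L^2 estimate can be applied again. *)
Definition iter_maximal (l : seq (R -> X -> X)) F := foldr flow_maximal F l.

Lemma iter_maximal_bounds l F (N : R) : (forall phi, List.In phi l -> measure_flow phi) ->
  measurable_fun setT F -> (forall x, 0 <= F x <= N%:E) ->
  measurable_fun setT (iter_maximal l F) /\
  forall x, 0 <= iter_maximal l F x <= N%:E.
Proof.
move=> + mF FN; elim: l => [//|phi l ih] hl.
have [p pl|mG GN] := ih; first by apply: hl; right.
have hphi : measure_flow phi by apply: hl; left.
split; last exact: flow_maximal_bounds.
by apply: measurable_flow_maximal => // x; case/andP: (GN x).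
Qed.

Lemma iter_maximal_L2 l F (N : R) : (forall phi, List.In phi l -> measure_flow phi) ->
  measurable_fun setT F -> (forall x, 0 <= F x <= N%:E) ->
  \int[nu]_x (iter_maximal l F x * iter_maximal l F x) <=
  (96 ^+ size l)%:E * \int[nu]_x (F x * F x).
Proof.
move=> + mF FN; elim: l => [|phi l ih] hl; first by rewrite expr0 mul1e.
have hl' p : List.In p l -> measure_flow p by move=> pl; apply: hl; right.
have [mG GN] := iter_maximal_bounds hl' mF FN.
have hphi : measure_flow phi by apply: hl; left.
apply: le_trans (flow_maximal_L2 hphi mG GN) _.
by rewrite exprS EFinM -muleA lee_wpmul2l ?lee_fin//; exact: ih.
Qed.

End flow.

(** * Translations of the Heisenberg group *)

Section preserves.
Context {R : realType}.
Notation Rm := (measurableTypeR R).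
Local Open Scope ereal_scope.

Definition preserves d (X : measurableType d) (nu : set X -> \bar R) (phi : X -> X) :=
  forall G : X -> \bar R, measurable_fun setT G -> (forall x, 0 <= G x) ->
  \int[nu]_x G (phi x) = \int[nu]_x G x.

Context d1 d2 (X1 : measurableType d1) (X2 : measurableType d2).
Variables (m1 : {sigma_finite_measure set X1 -> \bar R})
  (m2 : {sigma_finite_measure set X2 -> \bar R}).

Lemma integral_sfprod1 (f : X1 * X2 -> \bar R) : measurable_fun setT f ->
  (forall x, 0 <= f x) -> \int[sfprod m1 m2]_p f p = \int[m1]_x \int[m2]_y f (x, y).
Proof. by move=> mf f0; exact: (fubini_tonelli1 f mf f0). Qed.

Lemma integral_sfprod2 (f : X1 * X2 -> \bar R) : measurable_fun setT f ->
  (forall x, 0 <= f x) -> \int[sfprod m1 m2]_p f p = \int[m2]_y \int[m1]_x f (x, y).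
Proof. by move=> mf f0; exact: (fubini_tonelli2 f mf f0). Qed.

(** Fubini, with the fibre variable integrated first. Multiplication in the Heisenberg group and the
    passage to heights in the Siegel domain are shears of this kind. *)
Lemma preserves_skew (A : X2 -> X1 -> X1) (B : X2 -> X2) :
  measurable_fun setT (fun p : X1 * X2 => (A p.2 p.1, B p.2)) ->
  (forall y, preserves m1 (A y)) -> preserves m2 B ->
  preserves (sfprod m1 m2) (fun p => (A p.2 p.1, B p.2)).
Proof.
move=> mAB hA hB G mG G0.
rewrite integral_sfprod2//; last exact: measurableT_comp mG mAB.
rewrite (integral_sfprod2 mG G0).
rewrite -(hB (fun y => \int[m1]_x G (x, y))); last 2 first.
- exact: measurable_fun_fubini_tonelli_G.
- by move=> y; exact: integral_ge0.
apply: eq_integral => y _ /=; rewrite (hA y (fun x => G (x, B y)))//.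
exact: measurableT_comp mG (pair2_measurable _).
Qed.

Lemma preserves_prod (f : X1 -> X1) (g : X2 -> X2) : measurable_fun setT f ->
  measurable_fun setT g -> preserves m1 f -> preserves m2 g ->
  preserves (sfprod m1 m2) (fun p => (f p.1, g p.2)).
Proof.
move=> mf mg hf hg; apply: (preserves_skew (A := fun _ => f)) => //.
by apply: measurable_fun_pair; [exact: measurableT_comp mf measurable_fst|exact: measurableT_comp mg measurable_snd].
Qed.

Lemma preserves_shift (a : R) : preserves (@lebesgue_measure R) (fun x : Rm => (x + a)%R).
Proof. by move=> G mG G0; exact: integral_shift. Qed.

End preserves.

Section Cn_translation.
Context {R : realType}.
Notation Rm := (measurableTypeR R).

Lemma integral_CnS n (G : 'rV[Cplx R]_n.+1 -> \bar R) : measurable_fun setT G ->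
  (forall x, 0 <= G x)%E ->
  (\int[lebesgue_Cn n.+1]_z G z =
   \int[sfprod (sfprod lebesgue_measure lebesgue_measure) (lebesgue_Cn n)]_p G (Cn_cons p))%E.
Proof.
move=> mG G0.
have := @ge0_integral_pushforward _ _ _ _ R _ (@measurable_Cn_cons R n)
  (sfprod (sfprod lebesgue_measure lebesgue_measure) (lebesgue_Cn n)) setT G measurableT mG
  (fun x _ => G0 x).
by rewrite preimage_setT.
Qed.

Lemma Re_Cn_coord n d (T : measurableType d) (f : T -> 'rV[Cplx R]_n) j : measurable_fun setT f ->
  measurable_fun setT (fun x => complex.Re (f x ord0 j)).
Proof.
by move=> mf; exact: (measurableT_comp measurable_fst (measurableT_comp (measurable_Cn_coord j) mf)).
Qed.

Lemma Im_Cn_coord n d (T : measurableType d) (f : T -> 'rV[Cplx R]_n) j : measurable_fun setT f ->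
  measurable_fun setT (fun x => complex.Im (f x ord0 j)).
Proof.
by move=> mf; exact: (measurableT_comp measurable_snd (measurableT_comp (measurable_Cn_coord j) mf)).
Qed.

Lemma measurable_Cn_fun n d (T : measurableType d) (f : T -> 'rV[Cplx R]_n) :
  (forall j, measurable_fun setT (fun x => complex.Re (f x ord0 j) : Rm)) ->
  (forall j, measurable_fun setT (fun x => complex.Im (f x ord0 j) : Rm)) ->
  measurable_fun setT f.
Proof. by move=> h1 h2; apply: measurable_fun_CnP => i; apply: measurable_fun_pair. Qed.

Lemma measurable_Cn_translation n (c : 'rV[Cplx R]_n) :
  measurable_fun setT (fun z : 'rV[Cplx R]_n => z + c).
Proof.
apply: measurable_Cn_fun => j.
  rewrite (_ : (fun x => _) = (fun x : 'rV[Cplx R]_n => complex.Re (x ord0 j) + complex.Re (c ord0 j))).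
    by apply: measurable_funD => //; exact: (@Re_Cn_coord n _ _ id).
  by apply/funext => x; rewrite mxE raddfD.
rewrite (_ : (fun x => _) = (fun x : 'rV[Cplx R]_n => complex.Im (x ord0 j) + complex.Im (c ord0 j))).
  by apply: measurable_funD => //; exact: (@Im_Cn_coord n _ _ id).
by apply/funext => x; rewrite mxE raddfD.
Qed.

Lemma Cn_translation n (c : 'rV[Cplx R]_n) : preserves (lebesgue_Cn n) (fun z => z + c).
Proof.
elim: n c => [|n ih] c G mG G0.
  by apply: eq_integral => z _; congr G; rewrite [LHS]thinmx0 [RHS]thinmx0.
have mGc : measurable_fun setT (fun z : 'rV[Cplx R]_n.+1 => G (z + c)).
  exact: measurableT_comp mG (measurable_Cn_translation c).
rewrite integral_CnS// [RHS]integral_CnS//.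
pose a := complex.Re (c ord0 ord0); pose b := complex.Im (c ord0 ord0).
pose c' := \row_j c ord0 (lift ord0 j).
have P : preserves (sfprod (sfprod lebesgue_measure lebesgue_measure) (lebesgue_Cn n))
    (fun p : (Rm * Rm) * 'rV[Cplx R]_n => ((p.1.1 + a, p.1.2 + b), p.2 + c')).
  apply: (@preserves_prod R _ _ (Rm * Rm)%type 'rV[Cplx R]_n _ _
    (fun p => (p.1 + a, p.2 + b)) (fun z => z + c')); last exact: ih.
  - apply: measurable_fun_pair; [exact: measurableT_comp (measurable_shift a) measurable_fst|].
    exact: measurableT_comp (measurable_shift b) measurable_snd.
  - exact: measurable_Cn_translation.
  - apply: (@preserves_prod R _ _ Rm Rm _ _ (fun x => x + a) (fun x => x + b));
      [exact: measurable_shift|exact: measurable_shift|exact: preserves_shift|exact: preserves_shift].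
rewrite -(P (fun p => G (Cn_cons p)))//; last first.
  exact: measurableT_comp mG (@measurable_Cn_cons R n).
apply: eq_integral => -[[x y] v] _; congr G; apply/rowP => j; rewrite !mxE /=.
case: (unliftP ord0 j) => [i|] ->; first by rewrite /= !mxE.
by rewrite /= /a /b; case: (c _ _).
Qed.

End Cn_translation.

Section heis_group.
Context {R : realType} {n : nat}.
Notation Rm := (measurableTypeR R).
Notation Hm := (measurableTypeR R * 'rV[Cplx R]_n)%type.
Implicit Types (z w : 'rV[Cplx R]_n) (g h k : heis R n).

Definition omega z w : R := \sum_j (complex.Im (z ord0 j) * complex.Re (w ord0 j)
  - complex.Re (z ord0 j) * complex.Im (w ord0 j)).

Lemma omegaE z w : complex.Im (Defs.hermitian z w) = omega z w.
Proof.
rewrite raddf_sum; apply: eq_bigr => j _; case: (z _ _) => a b; case: (w _ _) => c d /=.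
by ring.
Qed.

Lemma omegaDl z z' w : omega (z + z') w = omega z w + omega z' w.
Proof.
rewrite -big_split; apply: eq_bigr => j _ /=; rewrite mxE.
by case: (z _ _) => a b; case: (z' _ _) => a' b'; case: (w _ _) => c d /=; ring.
Qed.

Lemma omegaN z w : omega w z = - omega z w.
Proof.
rewrite -sumrN; apply: eq_bigr => j _.
by case: (z _ _) => a b; case: (w _ _) => c d /=; ring.
Qed.

Lemma omegaDr z w w' : omega z (w + w') = omega z w + omega z w'.
Proof. by rewrite omegaN omegaDl opprD -!omegaN. Qed.

Lemma omegaNl z w : omega (- z) w = - omega z w.
Proof.
rewrite -sumrN; apply: eq_bigr => j _; rewrite mxE.
by case: (z _ _) => a b; case: (w _ _) => c d /=; ring.
Qed.

Lemma omegaNr z w : omega z (- w) = - omega z w.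
Proof. by rewrite omegaN omegaNl -omegaN. Qed.

Lemma omega_self z : omega z z = 0.
Proof. have /eqP := omegaN z z; rewrite -addr_eq0 -mulr2n mulrn_eq0/= => /eqP.
exact. Qed.

Lemma omegaZl (u : R) z w : omega (u%:C *: z) w = u * omega z w.
Proof.
rewrite mulr_sumr; apply: eq_bigr => j _; rewrite mxE.
by case: (z _ _) => a b; case: (w _ _) => c d /=; ring.
Qed.

Lemma omegaZr (u : R) z w : omega z (u%:C *: w) = u * omega z w.
Proof. by rewrite omegaN omegaZl -mulrN -omegaN. Qed.

Lemma heis_mulE g h : heis_mul g h = (g.1 + h.1 + 2 * omega g.2 h.2, g.2 + h.2).
Proof. by rewrite /heis_mul omegaE. Qed.

Lemma heis_mulA g h k : heis_mul g (heis_mul h k) = heis_mul (heis_mul g h) k.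
Proof.
rewrite !heis_mulE /= omegaDl omegaDr; congr pair; last exact: addrA.
by rewrite !mulrDr !addrA; ring.
Qed.

Lemma heis_mulg0 g : heis_mul g (0, 0) = g.
Proof.
rewrite heis_mulE /= (_ : omega g.2 0 = 0) ?mulr0 ?addr0; first by case: g.
by rewrite -(scale0r (0 : 'rV[Cplx R]_n)) -[0 : Cplx R]/((0 : R)%:C) omegaZr mul0r.
Qed.

(** Since [omega] vanishes on the diagonal, [u |-> (u k.1, u k.2)] is a one-parameter subgroup; the
    flow is right multiplication by it. *)
Definition rflow k (u : R) g : heis R n := heis_mul g (u * k.1, u%:C *: k.2).

Lemma rflowD k u v g : rflow k (u + v) g = rflow k u (rflow k v g).
Proof.
rewrite /rflow -heis_mulA; congr heis_mul.
rewrite heis_mulE /= omegaZl omegaZr omega_self !mulr0 addr0 mulrDl [X in (X, _)]addrC.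
by rewrite rmorphD/= scalerDl [X in (_, X)]addrC.
Qed.

Lemma measurable_omega d (T : measurableType d) (f g : T -> 'rV[Cplx R]_n) :
  measurable_fun setT f -> measurable_fun setT g ->
  measurable_fun setT (fun x => omega (f x) (g x)).
Proof.
move=> mf mg; apply: measurable_sum => j; apply: measurable_funB; apply: measurable_funM;
  by [exact: Re_Cn_coord|exact: Im_Cn_coord].
Qed.

Lemma measurable_heis_mul d (T : measurableType d) (f g : T -> Hm) :
  measurable_fun setT f -> measurable_fun setT g ->
  measurable_fun setT (fun x => heis_mul (f x) (g x) : Hm).
Proof.
move=> mf mg.
have f1 := measurableT_comp measurable_fst mf; have f2 := measurableT_comp measurable_snd mf.
have g1 := measurableT_comp measurable_fst mg; have g2 := measurableT_comp measurable_snd mg.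
under eq_fun do rewrite heis_mulE.
apply: measurable_fun_pair.
  apply: measurable_funD; first exact: measurable_funD.
  by apply: measurable_funM => //; exact: measurable_omega.
apply: measurable_Cn_fun => j.
  rewrite (_ : (fun x => _) = (fun x => complex.Re ((f x).2 ord0 j) + complex.Re ((g x).2 ord0 j))).
    by apply: measurable_funD; [exact: (Re_Cn_coord _ f2)|exact: (Re_Cn_coord _ g2)].
  by apply/funext => x; rewrite mxE raddfD.
rewrite (_ : (fun x => _) = (fun x => complex.Im ((f x).2 ord0 j) + complex.Im ((g x).2 ord0 j))).
  by apply: measurable_funD; [exact: (Im_Cn_coord _ f2)|exact: (Im_Cn_coord _ g2)].
by apply/funext => x; rewrite mxE raddfD.
Qed.

Lemma measurable_heis_line k : measurable_fun setT (fun u : Rm => (u * k.1, u%:C *: k.2) : Hm).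
Proof.
apply: measurable_fun_pair; first by apply: measurable_funM.
apply: measurable_Cn_fun => j.
  rewrite (_ : (fun x => _) = (fun x : Rm => x * complex.Re (k.2 ord0 j))).
    by apply: measurable_funM.
  by apply/funext => x; rewrite mxE; case: (k.2 _ _) => a b /=; ring.
rewrite (_ : (fun x => _) = (fun x : Rm => x * complex.Im (k.2 ord0 j))).
  by apply: measurable_funM.
by apply/funext => x; rewrite mxE; case: (k.2 _ _) => a b /=; ring.
Qed.

(** Left and right multiplications both translate [z] and shift the centre by an amount depending on
    [z]. *)
Lemma preserves_heis_skew (a : R) (b : 'rV[Cplx R]_n) (c : 'rV[Cplx R]_n -> R) :
  measurable_fun setT (c : 'rV[Cplx R]_n -> Rm) ->
  preserves (lebesgue_heis R n) (fun g : Hm => (g.1 + (a + c g.2), g.2 + b) : Hm).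
Proof.
move=> mc; rewrite /lebesgue_heis.
apply: (@preserves_skew R _ _ Rm 'rV[Cplx R]_n _ _ (fun z s => s + (a + c z)) (fun z => z + b)).
- apply: measurable_fun_pair.
    apply: measurable_funD => //; apply: measurable_funD => //.
    exact: measurableT_comp mc measurable_snd.
  exact: measurableT_comp (measurable_Cn_translation b) measurable_snd.
- by move=> z; exact: preserves_shift.
exact: Cn_translation.
Qed.

Lemma preserves_heis_mulr k : preserves (lebesgue_heis R n) (fun g : Hm => heis_mul g k : Hm).
Proof.
have := @preserves_heis_skew k.1 k.2 (fun z => 2 * omega z k.2).
rewrite (_ : (fun g : Hm => heis_mul g k) =
   (fun g : Hm => (g.1 + (k.1 + 2 * omega g.2 k.2), g.2 + k.2) : Hm)).
  apply; apply: measurable_funM => //; exact: measurable_omega.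
by apply/funext => g; rewrite heis_mulE addrA.
Qed.

Lemma preserves_heis_mull k : preserves (lebesgue_heis R n) (fun g : Hm => heis_mul k g : Hm).
Proof.
have := @preserves_heis_skew k.1 k.2 (fun z => 2 * omega k.2 z).
rewrite (_ : (fun g : Hm => heis_mul k g) =
   (fun g : Hm => (g.1 + (k.1 + 2 * omega k.2 g.2), g.2 + k.2) : Hm)).
  apply; apply: measurable_funM => //; exact: measurable_omega.
by apply/funext => g; rewrite heis_mulE addrA (addrC k.1) (addrC k.2).
Qed.

Lemma measure_flow_heis k : measure_flow (lebesgue_heis R n) (rflow k : R -> Hm -> Hm).
Proof.
split.
- apply: measurable_heis_mul => //.
  exact: measurableT_comp (measurable_heis_line k) measurable_snd.
- exact: rflowD.
by move=> u; exact: preserves_heis_mulr.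
Qed.

End heis_group.

Section product_flow.
Context {R : realType} d1 d2 (X1 : measurableType d1) (X2 : measurableType d2).
Notation Rm := (measurableTypeR R).
Variables (m1 : {sigma_finite_measure set X1 -> \bar R})
  (m2 : {sigma_finite_measure set X2 -> \bar R}).

Lemma measure_flow_fst (phi : R -> X1 -> X1) : measure_flow m1 phi ->
  measure_flow (sfprod m1 m2) (fun u (x : X1 * X2) => (phi u x.1, x.2)).
Proof.
move=> [mphi phiD phiI]; split.
- apply: measurable_fun_pair; last exact: measurableT_comp measurable_snd measurable_fst.
  apply: (measurableT_comp mphi (g := fun p : (X1 * X2) * Rm => (p.1.1, p.2))).
  by apply: measurable_fun_pair => //; exact: measurableT_comp measurable_fst measurable_fst.
- by move=> u v x; rewrite phiD.
move=> u; apply: (@preserves_prod _ _ _ _ _ m1 m2 (phi u) id) => //.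
  exact: (measurableT_comp mphi (pair2_measurable u)).
by move=> ?; exact: phiI.
Qed.

Lemma measure_flow_snd (phi : R -> X2 -> X2) : measure_flow m2 phi ->
  measure_flow (sfprod m1 m2) (fun u (x : X1 * X2) => (x.1, phi u x.2)).
Proof.
move=> [mphi phiD phiI]; split.
- apply: measurable_fun_pair; first exact: measurableT_comp measurable_fst measurable_fst.
  apply: (measurableT_comp mphi (g := fun p : (X1 * X2) * Rm => (p.1.2, p.2))).
  by apply: measurable_fun_pair => //; exact: measurableT_comp measurable_snd measurable_fst.
- by move=> u v x; rewrite phiD.
move=> u; apply: (@preserves_prod _ _ _ _ _ m1 m2 id (phi u)) => //.
  exact: (measurableT_comp mphi (pair2_measurable u)).
by move=> ?; exact: phiI.
Qed.

End product_flow.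

(** * Pointwise domination by iterated maximal functions *)

Section lines.
Context {R : realType}.

(** Holomorphy along complex lines: it is all that the one-variable inequalities use, and it is
    stable under the affine maps below. *)
Definition line_holo (V : lmodType (Cplx R)) (S : set V) (F : V -> Cplx R) :=
  forall (p d : V) (z : R[i]), S (p + (z : Cplx R) *: d) ->
    cdiff (fun w => F (p + (w : Cplx R) *: d)) z.

Notation mu := (@lebesgue_measure R).
Notation Rm := (measurableTypeR R).

Lemma square_integral_le (s : R -> R) (K : Rm * Rm -> \bar R) g (p q r : R) : 0 <= r ->
  (forall z, square p q r z -> cdiff g z) ->
  measurable_fun setT s -> (forall x, 0 <= s x) -> measurable_fun setT K ->
  (forall w, 0 <= K w)%E ->
  (forall x y, square p q r (x +i* y) -> ((s (nc (g (x +i* y))))%:E <= K (x, y))%E) ->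
  (square_integral (fun x y => (s (nc (g (x +i* y))))%:E) p q r <=
   square_integral (fun x y => K (x, y)) p q r)%E.
Proof.
move=> r0 dg ms s0 mK K0 gK; rewrite -[leRHS]mul1e.
apply: (@le_square_integral R _ _ (fun w => (s (nc (g (clamp (p - r) (p + r) w.1 +i* clamp (q - r) (q + r) w.2))))%:E) K) => //.
- apply/measurable_EFinP; apply: (measurableT_comp ms); exact: clamp_square.
- by move=> w; rewrite lee_fin.
- by move=> x y /rectangleE[x1 x2 y1 y2]; rewrite !clamp_id// in_itv/= ?x1 ?y1.
- by move=> x y xy; rewrite mul1e; exact: gK.
Qed.

Lemma square_mean_le (K : Rm * Rm -> \bar R) g (p q r : R) : 0 < r ->
  (forall z, square p q r z -> cdiff g z) -> measurable_fun setT K ->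
  (forall w, 0 <= K w)%E ->
  (forall x y, square p q r (x +i* y) -> ((nc (g (x +i* y)))%:E <= K (x, y))%E) ->
  ((r ^+ 2 * nc (g (p +i* q)))%:E <= 8%:E * square_integral (fun x y => K (x, y)) p q r)%E.
Proof.
move=> r0 dg mK K0 gK; apply: le_trans (square_mean_ineq r0 dg) _.
rewrite lee_wpmul2l ?lee_fin//.
have gE (x : R[i]) : nc x = `|nc x| :> R by have /ger0_norm -> := nc_ge0 x.
have E : (fun x y => (nc (g (x +i* y)))%:E) = (fun x y => (`|nc (g (x +i* y))|)%:E).
  by apply/funext => x; apply/funext => y; rewrite -gE.
rewrite E; apply: (square_integral_le (s := Num.norm)) => //.
- exact: ltW.
- by move=> x y xy; rewrite -gE; exact: gK.
Qed.

Lemma square_mean_sqrt_le (K : Rm * Rm -> \bar R) g (p q r : R) : 0 < r ->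
  (forall z, square p q r z -> cdiff g z) -> measurable_fun setT K ->
  (forall w, 0 <= K w)%E ->
  (forall x y, square p q r (x +i* y) -> ((Num.sqrt (nc (g (x +i* y))))%:E <= K (x, y))%E) ->
  ((r ^+ 2 * Num.sqrt (nc (g (p +i* q))))%:E <=
    256%:E * square_integral (fun x y => K (x, y)) p q r)%E.
Proof.
move=> r0 dg mK K0 gK; apply: le_trans (square_mean_sqrt r0 dg) _.
have ms : measurable_fun setT (@Num.sqrt R).
  by apply: continuous_measurable_fun; exact: sqrt_continuous.
have c0 : (0 <= 256%:E :> \bar R)%E by rewrite lee_fin ler0n.
exact: (lee_wpmul2l c0 (square_integral_le (ltW r0) dg ms (@sqrtr_ge0 R) mK K0 gK)).
Qed.

Lemma line_maximal_le (G F : Rm -> \bar R) (c : R) : (0 <= c)%R ->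
  measurable_fun setT G -> measurable_fun setT F -> (forall u, 0 <= G u)%E ->
  (forall u, 0 <= F u)%E -> (forall u, G u <= c%:E * F u)%E ->
  (line_maximal G <= c%:E * line_maximal F)%E.
Proof.
move=> c0 mG mF G0 F0 GF; apply: ge_ereal_sup => _ [n _ <-].
set r := avg_radius n; have r0 : 0 < r by exact: avg_radius_gt0.
apply: (@le_trans _ _ (c%:E * line_average F r)%E); last first.
  by rewrite lee_wpmul2l ?lee_fin//; apply: ereal_sup_ubound; exists n.
rewrite /line_average muleCA lee_wpmul2l ?lee_fin ?invr_ge0 ?mulr_ge0 ?(ltW r0)//.
rewrite -ge0_integralZl_EFin//; last exact: measurable_funTS.
apply: ge0_le_integral => //; first exact: measurable_funTS.
by apply: measurable_funTS; exact: emeasurable_funM.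
Qed.

Lemma measurable_real_line phi : (forall z, 0 <= complex.Im z -> cdiff phi z) ->
  measurable_fun setT (fun u : Rm => (Num.sqrt (nc (phi (u +i* 0))))%:E).
Proof.
move=> dphi; apply/measurable_EFinP; apply: continuous_measurable_fun => x.
apply: (@continuous_comp _ _ _ (fun x : R => nc (phi (x +i* 0))) (@Num.sqrt R)).
  exact: continuous_real_line.
exact: sqrt_continuous.
Qed.

Lemma measurable_partial_integral d (T : measurableType d) (f : T * Rm -> \bar R) (A : set Rm) :
  measurable_fun setT f -> (forall p, 0 <= f p)%E -> measurable A ->
  measurable_fun setT (fun x => \int[mu]_(y in A) f (x, y))%E.
Proof.
move=> mf f0 mA.
have mH : measurable_fun setT (fun p : T * Rm => f p * (\1_A p.2)%:E)%E.
  apply: emeasurable_funM => //; apply/measurable_EFinP; exact: measurable_indic_snd.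
have H0 p : (0 <= f p * (\1_A p.2)%:E)%E by rewrite mule_ge0.
have := @measurable_fun_fubini_tonelli_F _ _ T Rm R mu _ mH H0.
apply: eq_measurable_fun => x _.
rewrite /fubini_F [RHS]integral_mkcond; apply: eq_integral => u _.
by rewrite /patch indicE; case: ifPn; rewrite ?mule1 ?mule0.
Qed.

Lemma flow_segment_le d (X : measurableType d) (nu : {sigma_finite_measure set X -> \bar R})
    (phi : R -> X -> X) (G : X -> \bar R) (b r rho : R) y :
  measure_flow nu phi -> measurable_fun setT G -> (forall x, 0 <= G x)%E ->
  0 < rho -> `|b| + r <= rho ->
  (\int[mu]_(z in `[(- r)%R, r]) G (phi (b + z)%R y) <= (4 * rho)%:E * flow_maximal phi G y)%E.
Proof.
move=> hphi mG G0 rho0 br.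
have mo := measurable_flow_orbit y hphi mG.
under eq_integral do rewrite addrC.
rewrite (integral_shift_segment b (- r) r mo)//.
apply: le_trans (le_line_maximal rho0 mo _) => //.
apply: ge0_subset_integral => //; first exact: measurable_funTS.
have := ler_norm b; have := ler_norm (- b); rewrite normrN => h1 h2.
by apply: subset_itv; rewrite bnd_simp; lra.
Qed.

End lines.

(** * Left translations as affine automorphisms of the Siegel domain *)

Section siegel_translation.
Context {R : realType} {n : nat}.
Notation V := (Cplx R * 'rV[Cplx R]_n)%type.
Implicit Types (z w : 'rV[Cplx R]_n) (g h k : heis R n) (p d : V).

Definition sqnorm z : R := \sum_j nc (z ord0 j) ^+ 2.

Lemma Cn_normE z : Cn_norm z ^+ 2 = sqnorm z.
Proof. by rewrite /Cn_norm sqr_sqrtr// sumr_ge0// => j _; rewrite sqr_ge0. Qed.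

(** Left multiplication by [h] at unchanged height, read in the Siegel domain, where it is a complex
    affine map; [siegel_translate_dir] is its linear part. *)
Definition siegel_translate h p : V :=
  (p.1 + ((h.1 +i* sqnorm h.2) + 2 * 'i * \sum_j (h.2 ord0 j)^* * p.2 ord0 j), h.2 + p.2).

Definition siegel_translate_dir h d : V :=
  (d.1 + 2 * 'i * \sum_j (h.2 ord0 j)^* * d.2 ord0 j, d.2).

Lemma siegel_pi_mul t h g :
  siegel_pi t (heis_mul h g) = siegel_translate h (siegel_pi t g).
Proof.
rewrite /siegel_pi /siegel_translate heis_mulE !Cn_normE; congr pair.
(* One complex linear term holds both corrections: its real part is that of the group law, its
   imaginary part the cross term of [|h + g|^2]. *)
have S : 2 * 'i * (\sum_j (h.2 ord0 j)^* * g.2 ord0 j) =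
    (2 * omega h.2 g.2) +i* (2 * \sum_j (complex.Re (h.2 ord0 j) * complex.Re (g.2 ord0 j) +
      complex.Im (h.2 ord0 j) * complex.Im (g.2 ord0 j))) :> R[i].
  rewrite /omega !mulr_sumr.
  elim/big_rec3: _ => [|j a b c _ ->]; first by apply/eqP; rewrite eq_complex /= eqxx.
  case: (h.2 _ _) => h1 h2; case: (g.2 _ _) => g1 g2.
  by apply/eqP; rewrite eq_complex /=; apply/andP; split; apply/eqP; ring.
rewrite S; have -> : sqnorm (h.2 + g.2) = sqnorm h.2 + sqnorm g.2 +
   2 * \sum_j (complex.Re (h.2 ord0 j) * complex.Re (g.2 ord0 j) +
      complex.Im (h.2 ord0 j) * complex.Im (g.2 ord0 j)).
  rewrite /sqnorm mulr_sumr -!big_split; apply: eq_bigr => j _ /=.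
  rewrite mxE !nc_sqr; case: (h.2 _ _) => h1 h2; case: (g.2 _ _) => g1 g2 /=; ring.
by apply/eqP; rewrite eq_complex /=; apply/andP; split; apply/eqP; ring.
Qed.

Lemma siegel_translate_line h p d (z : R[i]) :
  siegel_translate h (p + (z : Cplx R) *: d) =
  siegel_translate h p + (z : Cplx R) *: siegel_translate_dir h d.
Proof.
rewrite /siegel_translate /siegel_translate_dir; congr pair; last by rewrite /= addrA.
rewrite /= (_ : \sum_j (h.2 ord0 j)^* * (p.2 + (z : Cplx R) *: d.2) ord0 j =
  (\sum_j (h.2 ord0 j)^* * p.2 ord0 j) + z * (\sum_j (h.2 ord0 j)^* * d.2 ord0 j)); last first.
  rewrite mulr_sumr -big_split; apply: eq_bigr => j _ /=; rewrite !mxE.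
  by rewrite mulrDr; congr (_ + _); rewrite mulrCA.
have zE (u : Cplx R) : (z : Cplx R) *: u = z * u by [].
rewrite !zE; move: (\sum_j _) (\sum_j _) (_ +i* _) => a b c.
by move: (2 * 'i : R[i]) => e; rewrite !mulrDr !addrA; ring.
Qed.

Lemma siegelP p : siegel R n p -> exists2 t, 0 < t & exists g, p = siegel_pi t g.
Proof.
case: p => -[a b] z; rewrite /siegel /= => h; exists (b - Cn_norm z ^+ 2); first by rewrite subr_gt0.
by exists (a, z); rewrite /siegel_pi /= subrK.
Qed.

Lemma siegel_siegel_pi t g : siegel R n (siegel_pi t g) <-> 0 < t.
Proof. by rewrite /siegel /siegel_pi /= ltrDr. Qed.

Lemma siegel_translateP h p : siegel R n p -> siegel R n (siegel_translate h p).
Proof.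
by move=> /siegelP[t t0 [g ->]]; rewrite -siegel_pi_mul siegel_siegel_pi.
Qed.

Lemma line_holo_translate h (F : V -> Cplx R) : line_holo (siegel R n) F ->
  line_holo (siegel R n) (F \o siegel_translate h).
Proof.
move=> hF p d z Sp; rewrite (_ : (fun w : R[i] => _) =
   (fun w : R[i] => F (siegel_translate h p + (w : Cplx R) *: siegel_translate_dir h d))).
  by apply: hF; rewrite -siegel_translate_line; exact: siegel_translateP.
by apply/funext => w; rewrite /= siegel_translate_line.
Qed.

End siegel_translation.

Section heis_directions.
Context {R : realType} {n : nat}.

Definition heis_X (j : 'I_n) : heis R n := (0, delta_mx ord0 j).
Definition heis_Y (j : 'I_n) : heis R n := (0, 'i%C *: delta_mx ord0 j).
Definition heis_T : heis R n := (1, 0).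

Lemma scale_deltaE (z : Cplx R) (j i : 'I_n) :
  (z *: delta_mx ord0 j : 'rV[Cplx R]_n) ord0 i = if i == j then z else 0.
Proof. by rewrite !mxE /=; case: eqP => _; rewrite ?mulr1 ?mulr0. Qed.

Lemma sub_deltaE (kap : 'rV[Cplx R]_n) (j i : 'I_n) :
  (kap - kap ord0 j *: delta_mx ord0 j) ord0 i = if i == j then 0 else kap ord0 i.
Proof. by rewrite !mxE /=; case: eqP => [->|_]; rewrite ?mulr1 ?subrr ?mulr0 ?subr0. Qed.

Lemma omega_delta (w : 'rV[Cplx R]_n) (z : Cplx R) j : omega w (z *: delta_mx ord0 j) =
  complex.Im (w ord0 j) * complex.Re z - complex.Re (w ord0 j) * complex.Im z.
Proof.
rewrite /omega (bigD1 j)//= big1 ?addr0 => [|i ij]; last first.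
  by rewrite scale_deltaE (negbTE ij) !mulr0 subrr.
by rewrite scale_deltaE eqxx.
Qed.

Lemma sqnorm_delta (z : Cplx R) (j : 'I_n) : sqnorm (z *: delta_mx ord0 j) = nc z ^+ 2.
Proof.
rewrite /sqnorm (bigD1 j)//= big1 ?addr0 => [|i ij]; last first.
  by rewrite scale_deltaE (negbTE ij) nc0 expr0n.
by rewrite scale_deltaE eqxx.
Qed.

(** The j-th coordinate is moved to the left and becomes a flow along [heis_X j] followed by one
    along [heis_Y j], with [u + i v = kap_j + z]. What remains has no j-th coordinate, and all
    commutators are collected in the centre. *)
Lemma horizontal_split (g : heis R n) j (s : R) (kap : 'rV[Cplx R]_n) (z : R[i]) :
  let u := complex.Re (kap ord0 j) + complex.Re z in
  let v := complex.Im (kap ord0 j) + complex.Im z in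
  heis_mul (heis_mul g (s, kap)) (0, (z : Cplx R) *: delta_mx ord0 j) =
  heis_mul (rflow (heis_Y j) v (rflow (heis_X j) u g))
    (s + 2 * (complex.Im (kap ord0 j) * complex.Re z - complex.Re (kap ord0 j) * complex.Im z) +
      2 * (u * v), kap - kap ord0 j *: delta_mx ord0 j).
Proof.
move=> u v; rewrite /rflow -!heis_mulA; congr heis_mul.
rewrite heis_mulA /heis_X /heis_Y !heis_mulE /= !mulr0 !add0r !scalerA -scalerDl.
have uvE : u%:C + v%:C * 'i%C = kap ord0 j + z.
  rewrite /u /v; move: (kap _ _) {u v} => [a b]; move: z => [c e].
  by apply/eqP; rewrite eq_complex /=; apply/andP; split; apply/eqP; ring.
rewrite uvE (omegaN (kap - _)) !omega_delta; congr pair; last first.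
  by rewrite [RHS]addrC scalerDl addrA subrK.
rewrite sub_deltaE scale_deltaE eqxx [complex.Re 0]/= [complex.Im 0]/=.
by rewrite /=; ring.
Qed.

End heis_directions.

Lemma norm_combination (R : realType) (s a b c X Y Z : R) : `|s| <= X -> `|a| <= Y ->
  `|b| <= Y -> `|c| <= Z -> `|s + 2 * (a - b) + 2 * c| <= X + 4 * Y + 2 * Z.
Proof.
rewrite !ler_norml => /andP[? ?] /andP[? ?] /andP[? ?] /andP[? ?].
by apply/andP; split; lra.
Qed.

Section pointwise.
Context {R : realType} {n : nat} d (X : measurableType d).
Variables (nu : {sigma_finite_measure set X -> \bar R}).
Variables (P : X -> heis R n) (fl : heis R n -> R -> X -> X).
Hypothesis Pfl : forall k u x, P (fl k u x) = rflow k u (P x).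
Hypothesis hfl : forall k, measure_flow nu (fl k).
Notation mu := (@lebesgue_measure R).
Notation Rm := (measurableTypeR R).
Notation V := (Cplx R * 'rV[Cplx R]_n)%type.

(** The central flow stands last, so its maximal operator acts first; each coordinate then adds two
    operators outside. *)
Definition heis_flows (l : seq 'I_n) : seq (R -> X -> X) :=
  foldr (fun j s => [:: fl (heis_X j), fl (heis_Y j) & s]) [:: fl heis_T] l.

Lemma measure_heis_flows l phi : List.In phi (heis_flows l) -> measure_flow nu phi.
Proof.
elim: l => [|j l ih] /=; first by case=> // <-; exact: hfl.
by case=> [<-|[<-|//]]; exact: hfl.
Qed.

(** [D] is a flow-invariant set on which the other Heisenberg factor is frozen, since [Phi] depends
    on a point of that factor. The bound above [eps] is existential, so that no constant can depend
    on it. *)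
Record controlled (Phi : V -> Cplx R) (eps : R) (F : X -> \bar R) (c : R) (D : set X) :
    Prop := Controlled {
  controlled_holo : line_holo (siegel R n) Phi;
  controlled_eps : 0 < eps;
  controlled_bound : exists B, forall t g, eps <= t -> nc (Phi (siegel_pi t g)) <= B;
  controlled_meas : measurable_fun setT F;
  controlled_fin : exists N : R, forall x, (0 <= F x <= N%:E)%E;
  controlled_cst : 0 <= c;
  controlled_flow : forall k u x, D x -> D (fl k u x);
  controlled_le : forall x, D x ->
    ((Num.sqrt (nc (Phi (siegel_pi eps (P x)))))%:E <= c%:E * F x)%E }.

(** The point [(i eps, 0) + w (1, 0)] has height [Im w + eps] over [(Re w, 0)]: the half plane is a
    complex line, moved to [P x] by a left translation. *)
Lemma pointwise_vertical Phi eps F c D A t x s : controlled Phi eps F c D -> 0 < t -> D x ->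
  `|s| <= A * t ->
  ((Num.sqrt (nc (Phi (siegel_pi (t + eps) (heis_mul (P x) (s, 0))))))%:E <=
   (half_plane_cst A * c)%:E * iter_maximal (heis_flows [::]) F x)%E.
Proof.
move=> [hol eps0 [B PhiB] mF [N FN] c0 Dfl le] t0 Dx sA.
pose phi (w : R[i]) := Phi (siegel_translate (P x) ((((0 +i* eps) : Cplx R), 0) + (w : Cplx R) *: (1, 0))).
have pE (w : R[i]) : ((((0 +i* eps) : Cplx R), 0) + (w : Cplx R) *: (1, 0)) =
    siegel_pi (complex.Im w + eps) (complex.Re w, 0) :> V.
  rewrite /siegel_pi Cn_normE /sqnorm big1 ?addr0; last by move=> j _; rewrite mxE nc0 expr0n.
  congr pair; last by rewrite /= scaler0 addr0.
  rewrite /= (_ : (w : Cplx R) *: 1 = w); last exact: mulr1.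
  by case: w => a b; apply/eqP; rewrite eq_complex /= add0r addrC !eqxx.
have phiE w : phi w = Phi (siegel_pi (complex.Im w + eps) (heis_mul (P x) (complex.Re w, 0))).
  by rewrite /phi pE siegel_pi_mul.
have dphi w : 0 <= complex.Im w -> cdiff phi w.
  move=> w0; apply: (line_holo_translate (P x) hol (p := (((0 +i* eps) : Cplx R), 0)) (d := (1, 0))).
  by rewrite pE siegel_siegel_pi ltr_wpDl.
have phiB w : 0 <= complex.Im w -> nc (phi w) <= B.
  by move=> w0; rewrite phiE PhiB// lerDr.
have s0A : `|s - 0| <= A * t by rewrite subr0.
have := half_plane_bound dphi phiB t0 s0A; rewrite phiE [complex.Re _]/= [complex.Im _]/=.
move=> /le_trans; apply.
rewrite (EFinM (half_plane_cst A) c) -[leRHS]muleA; apply: lee_wpmul2l.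
  by rewrite lee_fin ltW// half_plane_cst_gt0.
have F0 y : (0 <= F y)%E by case/andP: (FN y).
apply: line_maximal_le => //.
- rewrite (_ : (fun u => _) = (fun u : Rm => (Num.sqrt (nc (phi (u +i* 0))))%:E)).
    exact: measurable_real_line.
  by apply/funext => u; rewrite add0r.
- exact: (measurable_flow_orbit x (hfl heis_T) mF).
move=> u; rewrite add0r phiE [complex.Re _]/= [complex.Im _]/= add0r.
apply: le_trans (le _ (Dfl heis_T u x Dx)).
by rewrite Pfl /rflow /heis_T /= mulr1 scaler0.
Qed.

(** Induction on the coordinates that [kap] may involve, for all apertures [A] and [B] at once,
    because eliminating a coordinate enlarges them. The constant precedes [Phi], [eps], [F], [c] and
    [D], which permits an application to each function of a family. *)
Lemma pointwise l (A B : R) : 0 <= A -> 0 <= B -> exists2 C, 0 < C &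
  forall Phi eps F c D, controlled Phi eps F c D -> forall t x (s : R) (kap : 'rV[Cplx R]_n),
  0 < t -> D x -> `|s| <= A * t -> (forall i, i \notin l -> kap ord0 i = 0) ->
  (forall i, nc (kap ord0 i) <= B * Num.sqrt t) ->
  ((Num.sqrt (nc (Phi (siegel_pi (t + eps) (heis_mul (P x) (s, kap))))))%:E <=
   (C * c)%:E * iter_maximal (heis_flows l) F x)%E.
Proof.
elim: l A B => [|j l ih] A B A0 B0.
  exists (half_plane_cst A); first exact: half_plane_cst_gt0.
  move=> Phi eps F c D ctl t x s kap t0 Dx sA kap0 _.
  have -> : kap = 0 by apply/rowP => i; rewrite kap0// mxE.
  exact: pointwise_vertical ctl t0 Dx sA.
(* The bracket bounds the central coordinate of [horizontal_split] relative to [t]; the factor 2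
   pays for the remaining height, at least [t / 2]. *)
pose A' := 2 * (A + 4 * B + 2 * (B + 1) ^+ 2).
have A'0 : 0 <= A' by have := sqr_ge0 (B + 1); rewrite /A'; lra.
have B'0 : 0 <= 2 * B by rewrite mulr_ge0.
have [C' C'0 H] := ih A' (2 * B) A'0 B'0.
have B1 : 0 < B + 1 by rewrite ltr_wpDl.
(* 256 is the constant of the square root mean inequality; [64 (B + 1)^2] is [(4 rho)^2 / r^2], with
   [rho = (B + 1) q] and [r = q / 2]. *)
exists (256 * (64 * ((B + 1) ^+ 2 * C'))).
  apply: mulr_gt0; first by rewrite ltr0n.
  apply: mulr_gt0; first by rewrite ltr0n.
  exact: mulr_gt0 (exprn_gt0 2 B1) C'0.
move=> Phi eps F c D ctl t x s kap t0 Dx sA kap0 kapB.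
have [hol eps0 _ mF [N FN] c0 Dfl _] := ctl.
set h := heis_mul (P x) (s, kap); set e : 'rV[Cplx R]_n := delta_mx ord0 j.
pose p0 : V := (0 +i* (t + eps), 0); pose d0 : V := (0, e).
pose psi (z : R[i]) := Phi (siegel_translate h (p0 + (z : Cplx R) *: d0)).
have pE (z : R[i]) : p0 + (z : Cplx R) *: d0 =
    siegel_pi (t - nc z ^+ 2 + eps) (0, (z : Cplx R) *: e).
  rewrite /siegel_pi Cn_normE sqnorm_delta; congr pair; last by rewrite /= add0r.
  by rewrite /= scaler0 addr0; congr (_ +i* _); ring.
have psiE z : psi z = Phi (siegel_pi (t - nc z ^+ 2 + eps) (heis_mul h (0, (z : Cplx R) *: e))).
  by rewrite /psi pE siegel_pi_mul.
pose q := Num.sqrt t; have q0 : 0 < q by rewrite sqrtr_gt0.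
have qt : q ^+ 2 = t by rewrite sqr_sqrtr// ltW.
(* On the square of half-width [q / 2] one has [|z|^2 <= 2 (q / 2)^2 = t / 2]. *)
pose r := q / 2; have r0 : 0 < r by rewrite divr_gt0.
have sqz z : square 0 0 r z -> [/\ `|complex.Re z| <= r, `|complex.Im z| <= r & nc z ^+ 2 <= t / 2].
  case: z => a b /rectangleE; rewrite [complex.Re _]/= [complex.Im _]/= !add0r => -[a1 a2 b1 b2].
  have ha : `|a| <= r by rewrite ler_norml a1.
  have hb : `|b| <= r by rewrite ler_norml b1.
  split=> //; rewrite nc_sqr [complex.Re _]/= [complex.Im _]/=.
  have := lerXn2r 2 (normr_ge0 a) (ltW r0) ha; have := lerXn2r 2 (normr_ge0 b) (ltW r0) hb.
  rewrite !real_normK ?num_real// -qt /r; move: (a ^+ 2) (b ^+ 2) => u v; lra.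
have dpsi z : square 0 0 r z -> cdiff psi z.
  move=> /sqz[_ _ zt]; apply: (line_holo_translate h hol (p := p0) (d := d0)).
  by rewrite pE siegel_siegel_pi; move: (nc z ^+ 2) zt => m zt; lra.
set k : R[i] := kap ord0 j.
pose G := iter_maximal (heis_flows l) F.
have [mG GN] := iter_maximal_bounds (@measure_heis_flows l) mF FN.
have G0 y : (0 <= G y)%E by case/andP: (GN y).
(* The induction hypothesis at the point of [X] reached by the two flows; its two variables are the
   flow times up to the shift by [k]. *)
pose K (w : Rm * Rm) := ((C' * c)%:E *
  G (fl (heis_Y j) (complex.Im k + w.2) (fl (heis_X j) (complex.Re k + w.1) x)))%E.
have C'c : 0 <= C' * c by rewrite mulr_ge0// ltW.
have K0 w : (0 <= K w)%E by rewrite mule_ge0// lee_fin.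
have mshift (b : R) : measurable_fun setT (fun u : Rm => b + u : Rm).
  by apply: measurable_funD.
have mX : measurable_fun setT (fun w : Rm * Rm => fl (heis_X j) (complex.Re k + w.1) x).
  apply: (measurableT_comp (flow_measurable (hfl (heis_X j))) (g := fun w : Rm * Rm => (x, complex.Re k + w.1))).
  by apply: measurable_fun_pair => //; exact: measurableT_comp (mshift _) measurable_fst.
have mK : measurable_fun setT K.
  apply: emeasurable_funM => //; apply: (measurableT_comp mG).
  apply: (measurableT_comp (flow_measurable (hfl (heis_Y j))) (g := fun w : Rm * Rm =>
    (fl (heis_X j) (complex.Re k + w.1) x, complex.Im k + w.2))).
  by apply: measurable_fun_pair => //; exact: measurableT_comp (mshift _) measurable_snd.
have kB : nc k <= B * q by exact: kapB.
have bound a b : square 0 0 r (a +i* b) -> ((Num.sqrt (nc (psi (a +i* b))))%:E <= K (a, b))%E.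
  move=> /sqz; rewrite [complex.Re _]/= [complex.Im _]/= => -[ha hb zt].
  set z := a +i* b in zt *; rewrite psiE /h horizontal_split -/k [complex.Re z]/= [complex.Im z]/=.
  set t' := t - nc z ^+ 2; set u := complex.Re k + a; set v := complex.Im k + b.
  have [t'0 tt] : 0 < t' /\ t <= 2 * t' by rewrite /t'; move: (nc z ^+ 2) zt => m zt; split; lra.
  rewrite -(Pfl (heis_X j)) -(Pfl (heis_Y j)).
  have hr : r <= q by rewrite /r; lra.
  have k1 : `|complex.Re k| <= B * q by rewrite (le_trans (nc_geRe _)).
  have k2 : `|complex.Im k| <= B * q by rewrite (le_trans (nc_geIm _)).
  have ha' := le_trans ha hr; have hb' := le_trans hb hr.
  have u1 : `|u| <= (B + 1) * q.
    by rewrite (le_trans (ler_normD _ _))// mulrDl mul1r lerD.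
  have v1 : `|v| <= (B + 1) * q.
    by rewrite (le_trans (ler_normD _ _))// mulrDl mul1r lerD.
  apply: (H _ _ _ _ _ ctl) => //.
  - exact: (Dfl _ _ _ (Dfl _ _ _ Dx)).
  - have e1 : `|complex.Im k * a| <= B * t.
      by rewrite normrM -qt expr2 mulrA ler_pM.
    have e2 : `|complex.Re k * b| <= B * t.
      by rewrite normrM -qt expr2 mulrA ler_pM.
    have e3 : `|u * v| <= (B + 1) ^+ 2 * t.
      by rewrite normrM -qt -exprMn expr2 ler_pM.
    apply: (@le_trans _ _ (A * t + 4 * (B * t) + 2 * ((B + 1) ^+ 2 * t))).
      exact: norm_combination.
    rewrite (_ : _ + _ = (A + 4 * B + 2 * (B + 1) ^+ 2) * t); last by ring.
    rewrite /A' mulrAC [leRHS]mulrC ler_wpM2l//.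
    by have := A'0; rewrite pmulr_rge0.
  - move=> i il; rewrite sub_deltaE; case: eqP => [//|/eqP ij].
    by rewrite kap0// inE negb_or ij.
  move=> i; rewrite sub_deltaE; case: eqP => [_|_].
    by rewrite nc0 mulr_ge0 ?sqrtr_ge0.
  rewrite (le_trans (kapB i))// -/q mulrAC [leRHS]mulrC ler_wpM2l//.
  rewrite -(@ler_pXn2r _ 2)// ?nnegrE ?mulr_ge0 ?sqrtr_ge0 ?(ltW q0)//.
  rewrite qt exprMn sqr_sqrtr ?(ltW t'0)// expr2 -mulrA (le_trans tt)//.
  by rewrite ler_pM2l// ler_peMl ?(ltW t'0)// ler1n.
have := square_mean_sqrt_le r0 dpsi mK K0 bound.
rewrite (_ : psi (0 +i* 0) = Phi (siegel_pi (t + eps) h)); last first.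
  rewrite psiE -[0 +i* 0]/(0 : R[i]) nc0 expr0n subr0 /=; congr (Phi (siegel_pi _ _)).
  by rewrite scale0r heis_mulg0.
move=> main.
(* Both coordinates of [k] are at most [B q], so the time windows of radius [r] around them fit into
   [[-rho, rho]]. *)
pose rho := (B + 1) * q; have rho0 : 0 < rho by rewrite mulr_gt0.
have hX := hfl (heis_X j); have hY := hfl (heis_Y j).
pose M := flow_maximal (fl (heis_Y j)) G.
have mM : measurable_fun setT M by exact: measurable_flow_maximal.
have M0 y : (0 <= M y)%E by exact: line_maximal_ge0.
have kr (b : R) : `|b| <= nc k -> `|b| + r <= rho.
  by move=> /le_trans/(_ kB) hb; rewrite /rho /r; lra.
have KM : (square_integral (fun a b => K (a, b)) 0 0 r <=
    (C' * c * (4 * rho) ^+ 2)%:E * flow_maximal (fl (heis_X j)) M x)%E.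
  rewrite /square_integral !sub0r !add0r.
  have mMX : measurable_fun setT (fun a : Rm => M (fl (heis_X j) (complex.Re k + a)%R x)).
    apply: (measurableT_comp mM); apply: (measurableT_comp (flow_measurable hX)
      (g := fun a : Rm => (x, complex.Re k + a))).
    by apply: measurable_fun_pair; [exact: measurable_cst|exact: mshift].
  apply: (@le_trans _ _ (\int[mu]_(a in `[(- r)%R, r])
     ((C' * c * (4 * rho))%:E * M (fl (heis_X j) (complex.Re k + a)%R x)))%E).
    apply: ge0_le_integral => //.
    - by move=> a _; exact: integral_ge0.
    - by apply: measurable_funTS; apply: measurable_partial_integral => //; exact: measurable_segment.
    - by apply: measurable_funTS; exact: emeasurable_funM.
    move=> a _; rewrite /K /=.
    have mGY : measurable_fun setT (fun b : Rm => G (fl (heis_Y j) (complex.Im k + b)%R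
        (fl (heis_X j) (complex.Re k + a) x))).
      apply: (measurableT_comp mG); apply: (measurableT_comp (flow_measurable hY)
        (g := fun b : Rm => (fl (heis_X j) (complex.Re k + a) x, complex.Im k + b))).
      by apply: measurable_fun_pair; [exact: measurable_cst|exact: mshift].
    rewrite ge0_integralZl_EFin//; last exact: measurable_funTS.
    rewrite (EFinM (C' * c)) -muleA; apply: lee_wpmul2l; first by rewrite lee_fin.
    by apply: flow_segment_le => //; apply: kr; exact: nc_geIm.
  rewrite ge0_integralZl_EFin//; last 2 first.
  - exact: measurable_funTS.
  - by rewrite mulr_ge0// mulr_ge0// ltW.
  rewrite (_ : C' * c * (4 * rho) ^+ 2 = C' * c * (4 * rho) * (4 * rho)); last by ring.
  rewrite (EFinM (C' * c * (4 * rho))) -[leRHS]muleA; apply: lee_wpmul2l.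
    by rewrite lee_fin mulr_ge0// mulr_ge0// ltW.
  by apply: flow_segment_le => //; apply: kr; exact: nc_geRe.
set S := Num.sqrt _ in main *.
have r20 : 0 < r ^+ 2 by rewrite exprn_gt0.
have ri : (0 <= ((r ^+ 2)^-1)%:E :> \bar R)%E by rewrite lee_fin invr_ge0 ltW.
have -> : S%:E = (((r ^+ 2)^-1)%:E * (r ^+ 2 * S)%:E)%E.
  by rewrite -EFinM mulrA mulVf ?mul1r// gt_eqF.
apply: le_trans (lee_wpmul2l ri main) _.
have c256 : (0 <= 256%:E :> \bar R)%E by rewrite lee_fin ler0n.
apply: le_trans (lee_wpmul2l ri (lee_wpmul2l c256 KM)) _.
rewrite !muleA -!EFinM le_eqVlt; apply/orP; left; apply/eqP; congr (_%:E * _)%E.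
rewrite /rho /r.
have gen (a b u v : R) : u != 0 -> ((u / 2) ^+ 2)^-1 * 256 * (a * v * (4 * (b * u)) ^+ 2) =
  256 * (64 * (b ^+ 2 * a)) * v by move=> u0; field.
by apply: gen; rewrite gt_eqF.
Qed.

End pointwise.

(** * Measurability and boundedness of functions in the Hardy space *)

Section complex_rounding.
Context {R : realType}.
Notation Rm := (measurableTypeR R).

Definition cgrid (k : nat) (z : R[i]) : int * int := (grid k (complex.Re z), grid k (complex.Im z)).
Definition cgrid_pt (k : nat) (i : int * int) : R[i] := grid_pt k i.1 +i* grid_pt k i.2.

Lemma cgrid_ptP k z : nc (z - cgrid_pt k (cgrid k z)) <= 2 * k.+1%:R^-1.
Proof.
case: z => a b; rewrite (le_trans (nc_le_ReIm _))// mulr_natl mulr2n lerD//;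
  exact: (grid_ptP _ _).
Qed.

Lemma cgrid_pt_near (e : R) : 0 < e ->
  \forall k \near \oo, forall z, nc (z - cgrid_pt k (cgrid k z)) < e.
Proof.
move=> e0; have e20 : 0 < e / 2 by rewrite divr_gt0.
have /cvgrPdist_lt/(_ _ e20) := @cvg_grid_err R; apply: filterS => k.
rewrite sub0r normrN ger0_norm ?invr_ge0// => ke z.
by rewrite (le_lt_trans (cgrid_ptP _ _))// mulrC -ltr_pdivlMr.
Qed.

Lemma cvg_cgrid (z : R[i]) : (fun k => cgrid_pt k (cgrid k z) : Cplx R) @ \oo --> (z : Cplx R).
Proof.
apply/cvgrPdist_lt => e /posC_real[-> e0].
have := cgrid_pt_near e0; apply: filterS => k /(_ z) h.
by rewrite -[`|_|]/(`|z - cgrid_pt k (cgrid k z)| : R[i]) ncE ltcR.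
Qed.

Lemma cvg_row_cgrid n (z : 'rV[Cplx R]_n) :
  (fun k => \row_j (cgrid_pt k (cgrid k (z ord0 j)) : Cplx R)) @ \oo --> z.
Proof.
apply/cvg_mx_entourageP => A; rewrite -entourage_ballE => -[e /= /posC_real[-> e0] eA].
have := cgrid_pt_near e0; apply: filterS => k h i j; rewrite inE; apply: eA.
rewrite /= -ball_normE /ball_ /= mxE (ord1 i).
by rewrite -[`|_|]/(`|z ord0 j - cgrid_pt k (cgrid k (z ord0 j))| : R[i]) ncE ltcR.
Qed.

Lemma measurable_cgrid d (T : measurableType d) (f : T -> R[i]) k i :
  measurable_fun setT (fun x => complex.Re (f x) : Rm) ->
  measurable_fun setT (fun x => complex.Im (f x) : Rm) ->
  measurable ((cgrid k \o f) @^-1` [set i]).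
Proof.
move=> mr mi; case: i => i j.
rewrite (_ : _ @^-1` _ = ((fun x => complex.Re (f x)) @^-1` (grid k @^-1` [set i])) `&`
   ((fun x => complex.Im (f x)) @^-1` (grid k @^-1` [set j]))).
  apply: measurableI; rewrite -[X in measurable X]setTI; [apply: mr => //|apply: mi => //]; exact: measurable_grid.
by apply/seteqP; split=> [x [/= -> ->]|x [/= a b]]; rewrite /cgrid//= a b.
Qed.

Lemma measurable_row_cgrid d (T : measurableType d) n (f : T -> 'rV[Cplx R]_n) k
    (i : {ffun 'I_n -> int * int}) : measurable_fun setT f ->
  measurable ((fun x => [ffun j => cgrid k (f x ord0 j)]) @^-1` [set i]).
Proof.
move=> mf; rewrite (_ : _ @^-1` _ =
   \bigcap_(j in [set: 'I_n]) ((cgrid k \o (fun x => f x ord0 j)) @^-1` [set i j])).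
  apply: fin_bigcap_measurable => // j _.
  by apply: measurable_cgrid; [exact: Re_Cn_coord|exact: Im_Cn_coord].
apply/seteqP; split=> [x /= <- j _|x h]; first by rewrite /= ffunE.
by apply/ffunP => j; rewrite ffunE; exact: h.
Qed.

(** All real coordinates are rounded to the grid. Rounded points may leave the domain, but
    continuity is required only at their limits. *)
Lemma measurable_continuous_comp d (T : measurableType d) n1 n2
    (G : (Cplx R * 'rV[Cplx R]_n1) * (Cplx R * 'rV[Cplx R]_n2) -> Cplx R)
    (w1 w2 : T -> R[i]) (z1 : T -> 'rV[Cplx R]_n1) (z2 : T -> 'rV[Cplx R]_n2) :
  measurable_fun setT (fun x => complex.Re (w1 x) : Rm) ->
  measurable_fun setT (fun x => complex.Im (w1 x) : Rm) ->
  measurable_fun setT (fun x => complex.Re (w2 x) : Rm) ->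
  measurable_fun setT (fun x => complex.Im (w2 x) : Rm) ->
  measurable_fun setT z1 -> measurable_fun setT z2 ->
  (forall x, {for ((w1 x, z1 x), (w2 x, z2 x)), continuous G}) ->
  measurable_fun setT (fun x => nc (G ((w1 x, z1 x), (w2 x, z2 x)))).
Proof.
move=> a1 b1 a2 b2 m1 m2 cG.
pose I := (((int * int) * {ffun 'I_n1 -> int * int}) * ((int * int) * {ffun 'I_n2 -> int * int}))%type.
pose k (m : nat) (x : T) : I :=
  ((cgrid m (w1 x), [ffun j => cgrid m (z1 x ord0 j)]), (cgrid m (w2 x), [ffun j => cgrid m (z2 x ord0 j)])).
pose pt (m : nat) (i : I) : (Cplx R * 'rV[Cplx R]_n1) * (Cplx R * 'rV[Cplx R]_n2) :=
  ((cgrid_pt m i.1.1, \row_j cgrid_pt m (i.1.2 j)), (cgrid_pt m i.2.1, \row_j cgrid_pt m (i.2.2 j))).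
apply: (@measurable_fun_rounding _ T R I k (fun m i => nc (G (pt m i)))).
  move=> m [[i1 i2] [i3 i4]].
  rewrite (_ : _ @^-1` _ = (((cgrid m \o w1) @^-1` [set i1]) `&`
     ((fun x => [ffun j => cgrid m (z1 x ord0 j)]) @^-1` [set i2])) `&`
     (((cgrid m \o w2) @^-1` [set i3]) `&`
     ((fun x => [ffun j => cgrid m (z2 x ord0 j)]) @^-1` [set i4]))).
    by apply: measurableI; apply: measurableI; by [exact: measurable_cgrid|exact: measurable_row_cgrid].
  by apply/seteqP; split=> [x [/= <- <- <- <-]|x [[/= <- <-] [/= <- <-]]].
move=> x.
have ptx : (fun m => pt m (k m x)) @ \oo --> (((w1 x : Cplx R), z1 x), ((w2 x : Cplx R), z2 x)).
  have row nn (z : T -> 'rV[Cplx R]_nn) :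
     (fun m => \row_j (cgrid_pt m ([ffun j => cgrid m (z x ord0 j)] j) : Cplx R)) @ \oo --> z x.
    by under eq_fun do under eq_mx do rewrite ffunE; exact: cvg_row_cgrid.
  have half nn (w : T -> R[i]) (z : T -> 'rV[Cplx R]_nn) : (fun m => ((cgrid_pt m (cgrid m (w x)) : Cplx R),
      \row_j (cgrid_pt m ([ffun j => cgrid m (z x ord0 j)] j) : Cplx R))) @ \oo --> ((w x : Cplx R), z x).
    apply: (@cvg_pair nat (Cplx R) 'rV[Cplx R]_nn \oo (nbhs (w x : Cplx R)) (nbhs (z x))); [exact: cvg_cgrid|exact: row].
  apply: (@cvg_pair nat (Cplx R * 'rV[Cplx R]_n1)%type (Cplx R * 'rV[Cplx R]_n2)%type \oo
    (nbhs ((w1 x : Cplx R), z1 x)) (nbhs ((w2 x : Cplx R), z2 x))); exact: half.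
have /cvgrPdist_lt Gx := cvg_comp _ _ ptx (cG x).
apply/cvgrPdist_le => e e0.
have e0C : 0 < (e%:C : Cplx R) by rewrite ltcR.
have := Gx _ e0C; apply: filterS => m h.
rewrite (le_trans (nc_lip _ _))// -lecR -ncE ltW//.
Qed.

End complex_rounding.

Section hardy_measurable.
Context {R : realType} {n1 n2 : nat}.
Notation Rm := (measurableTypeR R).
Notation Hm n := (measurableTypeR R * 'rV[Cplx R]_n)%type.

Lemma measurable_sqnorm d (T : measurableType d) n (z : T -> 'rV[Cplx R]_n) :
  measurable_fun setT z -> measurable_fun setT (fun x => sqnorm (z x)).
Proof.
move=> mz; apply: measurable_sum => j; under eq_fun do rewrite nc_sqr.
by apply: measurable_funD; apply: measurable_funX; [exact: Re_Cn_coord|exact: Im_Cn_coord].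
Qed.

Lemma measurable_holomorphic (f : (R * R) * (heis R n1 * heis R n2) -> Cplx R)
    d (T : measurableType d) (t1 t2 : T -> Rm) (g1 : T -> Hm n1) (g2 : T -> Hm n2) :
  holomorphic_on_U f -> measurable_fun setT t1 -> measurable_fun setT t2 ->
  measurable_fun setT g1 -> measurable_fun setT g2 ->
  (forall x, 0 < t1 x) -> (forall x, 0 < t2 x) ->
  measurable_fun setT (fun x => nc (f ((t1 x, t2 x), (g1 x, g2 x)))).
Proof.
move=> hf mt1 mt2 mg1 mg2 t10 t20.
have fE x : f ((t1 x, t2 x), (g1 x, g2 x)) =
    (f \o U_pi_inv) (siegel_pi (t1 x) (g1 x), siegel_pi (t2 x) (g2 x)).
  by rewrite /= -[X in U_pi_inv X]/(U_pi ((t1 x, t2 x), (g1 x, g2 x))) U_piK.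
under eq_fun do rewrite fE.
have s1 := measurableT_comp measurable_fst mg1; have z1 := measurableT_comp measurable_snd mg1.
have s2 := measurableT_comp measurable_fst mg2; have z2 := measurableT_comp measurable_snd mg2.
apply: (measurable_continuous_comp (G := f \o U_pi_inv)
   (w1 := fun x => (g1 x).1 +i* (t1 x + Cn_norm (g1 x).2 ^+ 2))
   (w2 := fun x => (g2 x).1 +i* (t2 x + Cn_norm (g2 x).2 ^+ 2))
   (z1 := fun x => (g1 x).2) (z2 := fun x => (g2 x).2)) => //.
- by apply: measurable_funD => //; under eq_fun do rewrite Cn_normE; exact: measurable_sqnorm.
- by apply: measurable_funD => //; under eq_fun do rewrite Cn_normE; exact: measurable_sqnorm.
move=> x; apply: differentiable_continuous; apply: hf; split; rewrite /=.
  by rewrite -[(_, _)]/(siegel_pi (t1 x) (g1 x)) siegel_siegel_pi.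
by rewrite -[(_, _)]/(siegel_pi (t2 x) (g2 x)) siegel_siegel_pi.
Qed.

End hardy_measurable.

(** * Interior mean value inequalities and boundedness above a positive height *)

Section Cn_mean.
Context {R : realType}.
Notation mu := (@lebesgue_measure R).
Notation Rm := (measurableTypeR R).

Definition polysquare n (r : R) : set 'rV[Cplx R]_n :=
  [set z | forall j, `|complex.Re (z ord0 j)| <= r /\ `|complex.Im (z ord0 j)| <= r].

Arguments polysquare : clear implicits.

Lemma square_integral_le_plane (K : Rm * Rm -> \bar R) (p q r : R) : measurable_fun setT K ->
  (forall w, 0 <= K w)%E ->
  (square_integral (fun x y => K (x, y)) p q r <= \int[sfprod mu mu]_w K w)%E.
Proof.
move=> mK K0; rewrite square_integralE//.
have mS : measurable ((`[(p - r)%R, (p + r)%R] `*` `[(q - r)%R, (q + r)%R])%classic : set (Rm * Rm)).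
  by apply: measurableX; exact: measurable_segment.
exact: ge0_subset_integral.
Qed.

Lemma Cn_cons_line n (a b c e : R) (p d : 'rV[Cplx R]_n) (z : Cplx R) :
  Cn_cons (((a, b) : Rm * Rm), p) + z *: Cn_cons (((c, e) : Rm * Rm), d) =
  \row_j oapp ((p + z *: d) ord0) ((a +i* b) + z * (c +i* e)) (unlift ord0 j).
Proof.
apply/rowP => j; rewrite !mxE /=.
by case: (unliftP ord0 j) => [i|] _ /=; rewrite ?mxE.
Qed.

(** The inequality on squares, one complex coordinate at a time, along the recursion that defines
    the measure. The majorant [K] is measurable on the whole space, whereas [F] is controlled on the
    product of squares only. *)
Lemma Cn_mean n (r : R) (F : 'rV[Cplx R]_n -> Cplx R) (K : 'rV[Cplx R]_n -> \bar R) : 0 < r ->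
  line_holo (polysquare n r) F -> measurable_fun setT K -> (forall z, 0 <= K z)%E ->
  (forall z, polysquare n r z -> (nc (F z))%:E <= K z)%E ->
  (((r ^+ 2) ^+ n * nc (F 0))%:E <= (8 ^+ n)%:E * \int[lebesgue_Cn n]_z K z)%E.
Proof.
move=> r0; elim: n F K => [|n ih] F K hF mK K0 FK.
  rewrite !expr0 mul1r mul1e /= integral_dirac// diracT mul1e; apply: FK => -[].
  by [].
have r20 : 0 < (r ^+ 2) ^+ n by rewrite !exprn_gt0.
pose c : R := 8 ^+ n / (r ^+ 2) ^+ n.
have c0 : 0 <= c by rewrite divr_ge0 ?exprn_ge0 ?ltW.
pose K' (w : Rm * Rm) := (c%:E * \int[lebesgue_Cn n]_v K (Cn_cons (w, v)))%E.
have mKc : measurable_fun setT (fun p => K (Cn_cons p)).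
  exact: measurableT_comp mK (@measurable_Cn_cons R n).
have mI : measurable_fun setT (fun w : Rm * Rm => \int[lebesgue_Cn n]_v K (Cn_cons (w, v)))%E.
  exact: (@measurable_fun_fubini_tonelli_F _ _ _ _ _ (lebesgue_Cn n) (fun p => K (Cn_cons p))).
have mK' : measurable_fun setT K' by exact: emeasurable_funM.
have K'0 w : (0 <= K' w)%E by rewrite mule_ge0 ?integral_ge0// lee_fin.
pose e : 'rV[Cplx R]_n.+1 := Cn_cons (((1, 0) : Rm * Rm), 0).
pose g (z : R[i]) := F (0 + (z : Cplx R) *: e).
have gE x y : 0 + ((x +i* y) : Cplx R) *: e = Cn_cons (((x, y) : Rm * Rm), 0).
  rewrite add0r; apply/rowP => j; rewrite !mxE /=.
  case: (unliftP ord0 j) => [i|] _ /=; first by rewrite mxE mulr0.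
  by rewrite -[1 +i* 0]/(1 : R[i]) mulr1.
have inP x y v : square 0 0 r (x +i* y) -> polysquare n r v -> polysquare n.+1 r (Cn_cons (((x, y) : Rm * Rm), v)).
  move=> /rectangleE; rewrite [complex.Re _]/= [complex.Im _]/= !add0r => -[a1 a2 b1 b2] hv j.
  rewrite !mxE; case: (unliftP ord0 j) => [i|] _ /=; first exact: hv.
  by rewrite !ler_norml a1 a2 b1 b2.
have P0 : polysquare n r 0 by move=> j; rewrite mxE /= normr0 ltW.
have bound x y : square 0 0 r (x +i* y) -> ((nc (g (x +i* y)))%:E <= K' (x, y))%E.
  move=> xy; rewrite /g gE.
  have := ih (fun v => F (Cn_cons (((x, y) : Rm * Rm), v))) (fun v => K (Cn_cons ((x, y), v))).
  have h1 : line_holo (polysquare n r) (fun v => F (Cn_cons (((x, y) : Rm * Rm), v))).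
    move=> p d z Pz.
    have E (w : Cplx R) : Cn_cons (((x, y) : Rm * Rm), p + w *: d) =
        Cn_cons (((x, y) : Rm * Rm), p) + w *: Cn_cons (((0, 0) : Rm * Rm), d).
      rewrite Cn_cons_line; apply/rowP => j; rewrite !mxE /=.
      by rewrite -[0 +i* 0]/(0 : R[i]) mulr0 addr0.
    rewrite (_ : (fun w : R[i] => _) = (fun w : R[i] => F (Cn_cons (((x, y) : Rm * Rm), p) + (w : Cplx R) *: Cn_cons (((0, 0) : Rm * Rm), d)))).
      by apply: hF; rewrite -E; exact: inP.
    by apply/funext => w; rewrite E.
  have h2 : measurable_fun setT (fun v => K (Cn_cons (((x, y) : Rm * Rm), v))).
    exact: (measurableT_comp mKc (pair1_measurable _)).
  move=> /(_ h1 h2 (fun v => K0 _) (fun v hv => FK _ (inP _ _ _ xy hv))) H.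
  have ri : (0 <= (((r ^+ 2) ^+ n)^-1)%:E :> \bar R)%E by rewrite lee_fin invr_ge0 ltW.
  have := lee_wpmul2l ri H; rewrite -EFinM mulrA mulVf ?gt_eqF// mul1r => /le_trans; apply.
  by rewrite muleA -EFinM /K' /c mulrC.
have dg z : square 0 0 r z -> cdiff g z.
  case: z => x y xy; apply: hF; rewrite gE; exact: inP.
have := square_mean_le r0 dg mK' K'0 bound.
rewrite (_ : g (0 +i* 0) = F 0); last first.
  by rewrite /g -[0 +i* 0]/(0 : R[i]) scale0r addr0.
move=> H.
have c8 : (0 <= 8%:E :> \bar R)%E by rewrite lee_fin ler0n.
have H2 := le_trans H (lee_wpmul2l c8 (square_integral_le_plane 0 0 r mK' K'0)).
rewrite ge0_integralZl_EFin// in H2; last by move=> w _; exact: integral_ge0.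
rewrite integral_CnS// integral_sfprod1//.
have rn : (0 <= ((r ^+ 2) ^+ n)%:E :> \bar R)%E by rewrite lee_fin ltW.
have := lee_wpmul2l rn H2; rewrite -EFinM mulrA -exprSr => /le_trans; apply.
rewrite !muleA -!EFinM le_eqVlt; apply/orP; left; apply/eqP; congr (_%:E * _)%E.
have gen (u v : R) : u != 0 -> u * 8 * (v / u) = 8 * v by move=> u0; field.
by rewrite /c [8 ^+ n.+1]exprS; apply: gen; rewrite gt_eqF.
Qed.

End Cn_mean.
Arguments polysquare {R} n r.

Section siegel_mean.
Context {R : realType} (n : nat).
Notation mu := (@lebesgue_measure R).
Notation Rm := (measurableTypeR R).
Notation V := (Cplx R * 'rV[Cplx R]_n)%type.
Notation Hm := (measurableTypeR R * 'rV[Cplx R]_n)%type.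

(** After a left translation the point lies over the origin. The mean inequality is applied in [w]
    and in [z], on sets whose size depends on [eps] and [n] only; a shear and left invariance turn
    the result into an integral over heights and the group. *)
Lemma siegel_mean (eps : R) : 0 < eps -> exists2 C : R, 0 < C &
  forall (Phi : V -> Cplx R) (K : Rm * Hm -> \bar R) (t : R) (h : heis R n),
  line_holo (siegel R n) Phi -> eps <= t -> measurable_fun setT K ->
  (forall p, 0 <= K p)%E ->
  (forall eta g, (eps / 2 <= eta)%R -> (nc (Phi (siegel_pi eta g)))%:E <= K (eta, g))%E ->
  ((nc (Phi (siegel_pi t h)))%:E <=
   C%:E * \int[mu]_(eta in `[(t - eps / 2)%R, (t + eps / 2)%R]) \int[lebesgue_heis R n]_g K (eta, g))%E.
Proof.
move=> eps0.
(* Chosen so that [|z|^2 <= eps / 4] on the product of squares of half-width [dl]. *)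
pose dl := Num.min 1 (eps / (8 * n.+1%:R)).
have n0 : 0 < 8 * n.+1%:R :> R by rewrite mulr_gt0.
have dl0 : 0 < dl by rewrite lt_min ltr01 divr_gt0.
have dl1 : dl <= 1 by rewrite ge_min lexx.
have dl2 : 2 * dl ^+ 2 * n%:R <= eps / 4.
  have h1 : dl ^+ 2 <= dl by rewrite expr2 ler_piMl// ltW.
  have h2 : dl * (8 * n.+1%:R) <= eps by rewrite -ler_pdivlMr// ge_min lexx orbT.
  have h3 : dl ^+ 2 * n%:R <= dl * n.+1%:R by rewrite ler_pM ?sqr_ge0// ler_nat.
  by move: h2 h3; move: (n.+1%:R) (n%:R) (dl ^+ 2) => u v w; lra.
pose rho := eps / 4; have rho0 : 0 < rho by rewrite divr_gt0.
pose c : R := 8 ^+ n / (dl ^+ 2) ^+ n.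
have dn0 : 0 < (dl ^+ 2) ^+ n by rewrite !exprn_gt0.
have c0 : 0 < c by rewrite divr_gt0 ?exprn_gt0.
exists (8 * c / rho ^+ 2); first by apply: divr_gt0; [exact: mulr_gt0|exact: exprn_gt0].
move=> Phi K t h hol et mK K0 PhiK.
pose J : set Rm := `[t - eps / 2, t + eps / 2]%classic.
have mJ : measurable J by exact: measurable_segment.
pose L (p : Rm * Hm) := (K (p.1, heis_mul h p.2) * (\1_J p.1)%:E)%E.
have mh : measurable_fun setT (fun p : Rm * Hm => (p.1, heis_mul h p.2 : Hm)).
  by apply: measurable_fun_pair => //; exact: measurable_heis_mul.
have mL : measurable_fun setT L.
  apply: emeasurable_funM; first exact: measurableT_comp mK mh.
  apply/measurable_EFinP; have h1 : measurable_fun setT (\1_J : Rm -> R) by exact: measurable_indic.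
  exact: measurableT_comp h1 measurable_fst.
have L0 p : (0 <= L p)%E by rewrite mule_ge0.
(* From [Im w] to the height [Im w - |z|^2]: a shear, hence measure preserving. *)
pose T (p : Rm * Hm) : Rm * Hm := (p.1 - sqnorm p.2.2, p.2).
have mq : measurable_fun setT (fun g : Hm => sqnorm g.2) by apply: measurable_sqnorm.
have mT : measurable_fun setT T.
  apply: measurable_fun_pair => //; apply: measurable_funB => //.
  exact: measurableT_comp mq measurable_snd.
pose LT p := L (T p).
have mLT : measurable_fun setT LT by exact: measurableT_comp mL mT.
have LT0 p : (0 <= LT p)%E by exact: L0.
have translate : (\int[sfprod mu (lebesgue_heis R n)]_p LT p = \int[sfprod mu (lebesgue_heis R n)]_p L p)%E.
  apply: (@preserves_skew R _ _ Rm Hm _ _ (fun g y => y - sqnorm g.2) id) => //.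
  by move=> g; exact: preserves_shift.
have sq_z z : polysquare n dl z -> sqnorm z <= eps / 4.
  move=> hz; apply: le_trans dl2; rewrite /sqnorm.
  apply: (@le_trans _ _ (\sum_(j < n) (2 * dl ^+ 2))); last by rewrite sumr_const card_ord mulr_natr.
  apply: ler_sum => j _; case: (hz j) => h1 h2; rewrite nc_sqr.
  have := lerXn2r 2 (normr_ge0 _) (ltW dl0) h1; have := lerXn2r 2 (normr_ge0 _) (ltW dl0) h2.
  rewrite !real_normK ?num_real//; move: (_ ^+ 2) (_ ^+ 2) (dl ^+ 2) => u v w; clear; lra.
pose Lz (x y : Rm) (z : 'rV[Cplx R]_n) := LT (y, (x, z)).
have siegelE (w : Cplx R) z : (w, z) = siegel_pi (complex.Im w - sqnorm z) (complex.Re w, z) :> V.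
  by rewrite /siegel_pi Cn_normE /= subrK; case: w.
have sqy x y : square 0 t rho (x +i* y) -> t - eps / 4 <= y <= t + eps / 4.
  by move=> /rectangleE[_ _ /= y1 y2]; rewrite y1.
have sqn0 (z : 'rV[Cplx R]_n) : 0 <= sqnorm z by rewrite sumr_ge0// => j _; exact: sqr_ge0.
(* [y] is within [eps / 4] of [t], and subtracting [|z|^2] costs at most [eps / 4] more; [t >= eps]
   keeps the height above [eps / 2]. *)
have height x y z : square 0 t rho (x +i* y) -> polysquare n dl z ->
    eps / 2 <= y - sqnorm z /\ J (y - sqnorm z).
  move=> /sqy/andP[y1 y2] /sq_z; have := sqn0 z; rewrite /J /= in_itv/=.
  by move: (sqnorm z) => m m0 m1; clear -m0 m1 y1 y2 eps0 et; split; [lra|apply/andP; split; lra].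
have inner x y : square 0 t rho (x +i* y) ->
    ((nc (Phi (siegel_translate h ((x +i* y), 0))))%:E <= c%:E * \int[lebesgue_Cn n]_z Lz x y z)%E.
  move=> xy; pose F z := Phi (siegel_translate h ((x +i* y : Cplx R), z)).
  have h1 : line_holo (polysquare n dl) F.
    move=> p d z Pz.
    have E (w : Cplx R) : ((x +i* y : Cplx R), p + w *: d) = ((x +i* y : Cplx R), p) + w *: ((0 : Cplx R), d).
      by congr pair; rewrite /= scaler0 addr0.
    rewrite (_ : (fun w : R[i] => _) = (fun w : R[i] => (Phi \o siegel_translate h) (((x +i* y : Cplx R), p) + (w : Cplx R) *: ((0 : Cplx R), d)))).
      apply: (line_holo_translate h hol); rewrite -E siegelE siegel_siegel_pi /=.
      by case: (height x y _ xy Pz) => + _; apply: lt_le_trans; rewrite divr_gt0.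
    by apply/funext => w; rewrite /F E.
  have h2 : measurable_fun setT (Lz x y).
    apply: (measurableT_comp mLT); apply: measurable_fun_pair => //; exact: pair1_measurable.
  have h3 z : polysquare n dl z -> ((nc (F z))%:E <= Lz x y z)%E.
    move=> Pz; rewrite /F /Lz /LT /T /L /= siegelE /= -siegel_pi_mul.
    have [e1 e2] := height x y z xy Pz.
    by rewrite indicE mem_set// mule1; exact: PhiK.
  have H := Cn_mean dl0 h1 h2 (fun z => LT0 _) h3.
  have ri : (0 <= (((dl ^+ 2) ^+ n)^-1)%:E :> \bar R)%E by rewrite lee_fin invr_ge0 ltW.
  have := lee_wpmul2l ri H; rewrite -EFinM mulrA mulVf ?gt_eqF// mul1r => /le_trans; apply.
  by rewrite muleA -EFinM /c mulrC.
pose K' (w : Rm * Rm) := (c%:E * \int[lebesgue_Cn n]_z Lz w.1 w.2 z)%E.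
have mI : measurable_fun setT (fun w : Rm * Rm => \int[lebesgue_Cn n]_z Lz w.1 w.2 z)%E.
  apply: (@measurable_fun_fubini_tonelli_F _ _ (Rm * Rm)%type 'rV[Cplx R]_n R (lebesgue_Cn n)
    (fun p => LT (p.1.2, (p.1.1, p.2)))) => //.
  apply: (measurableT_comp mLT); apply: measurable_fun_pair.
    exact: measurableT_comp measurable_snd measurable_fst.
  by apply: measurable_fun_pair => //; exact: measurableT_comp measurable_fst measurable_fst.
have mK' : measurable_fun setT K' by exact: emeasurable_funM.
have I0 w : (0 <= \int[lebesgue_Cn n]_z Lz w.1 w.2 z)%E by apply: integral_ge0 => z _; exact: LT0.
have c0' : 0 <= c by exact: ltW.
have K'0 w : (0 <= K' w)%E by rewrite mule_ge0.
pose g (w : R[i]) := (Phi \o siegel_translate h) (0 + (w : Cplx R) *: ((1 : Cplx R), (0 : 'rV[Cplx R]_n))).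
have gE (w : R[i]) : 0 + (w : Cplx R) *: ((1 : Cplx R), (0 : 'rV[Cplx R]_n)) = ((w : Cplx R), 0).
  by rewrite add0r; congr pair; [exact: mulr1|rewrite /= scaler0].
have sq0 : sqnorm (0 : 'rV[Cplx R]_n) = 0.
  by rewrite /sqnorm big1// => j _; rewrite mxE nc0 expr0n.
have dg w : square 0 t rho w -> cdiff g w.
  case: w => x y xy; apply: (line_holo_translate h hol); rewrite gE siegelE siegel_siegel_pi sq0 subr0 /=.
  by case/andP: (sqy x y xy) => y1 _; apply: lt_le_trans y1; clear -eps0 et; lra.
have bound x y : square 0 t rho (x +i* y) -> ((nc (g (x +i* y)))%:E <= K' (x, y))%E.
  by move=> xy; rewrite /g gE; exact: inner.
have := square_mean_le rho0 dg mK' K'0 bound.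
rewrite (_ : g (0 +i* t) = Phi (siegel_pi t h)); last first.
  rewrite /g gE /= siegelE -siegel_pi_mul sq0 subr0 /=.
  by congr (Phi (siegel_pi _ _)); exact: heis_mulg0.
move=> H.
have c8 : (0 <= 8%:E :> \bar R)%E by rewrite lee_fin ler0n.
have H2 := le_trans H (lee_wpmul2l c8 (square_integral_le_plane 0 t rho mK' K'0)).
have IE : (\int[sfprod mu mu]_w \int[lebesgue_Cn n]_z Lz w.1 w.2 z =
    \int[mu]_(eta in J) \int[lebesgue_heis R n]_g K (eta, g))%E.
  rewrite integral_sfprod2//.
  transitivity (\int[sfprod mu (lebesgue_heis R n)]_p LT p)%E.
    rewrite [RHS]integral_sfprod1//; apply: eq_integral => y _.
    rewrite [RHS](@integral_sfprod1 R _ _ Rm 'rV[Cplx R]_n mu (lebesgue_Cn n) (fun q => LT (y, q)))//.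
    exact: (measurableT_comp mLT (pair1_measurable _)).
  rewrite translate (integral_sfprod1 _ _ mL L0) [RHS]integral_mkcond; apply: eq_integral => eta _.
  rewrite /L /patch /= indicE; case: ifPn => etaJ; last first.
    by rewrite integral0_eq// => g' _; rewrite mule0.
  under eq_integral do rewrite mule1.
  apply: (preserves_heis_mull h (G := fun g => K (eta, g))) => //.
  exact: (measurableT_comp mK (pair1_measurable _)).
rewrite ge0_integralZl_EFin// IE in H2.
have rr0 : 0 < rho ^+ 2 by rewrite exprn_gt0.
have ri : (0 <= ((rho ^+ 2)^-1)%:E :> \bar R)%E by rewrite lee_fin invr_ge0 ltW.
have := lee_wpmul2l ri H2; rewrite -EFinM mulrA mulVf ?gt_eqF// mul1r => /le_trans; apply.
rewrite !muleA -!EFinM le_eqVlt; apply/orP; left; apply/eqP; congr (_%:E * _)%E.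
by rewrite -mulrA mulrC.
Qed.

End siegel_mean.

Section hardy.
Context {R : realType} {n1 n2 : nat}.
Notation mu := (@lebesgue_measure R).
Notation Rm := (measurableTypeR R).
Notation Hm n := (measurableTypeR R * 'rV[Cplx R]_n)%type.
Notation H := (heis R n1 * heis R n2)%type.
Implicit Types f : (R * R) * H -> Cplx R.

Lemma U_pi_inv_siegel t1 t2 (g1 : heis R n1) (g2 : heis R n2) :
  U_pi_inv (siegel_pi t1 g1, siegel_pi t2 g2) = ((t1, t2), (g1, g2)).
Proof. exact: (U_piK ((t1, t2), (g1, g2))). Qed.

Lemma line_holo_fst f t2 g2 : holomorphic_on_U f -> 0 < t2 ->
  line_holo (siegel R n1) (fun p => f (U_pi_inv (p, siegel_pi t2 g2))).
Proof.
move=> hf t20 p d z Sp.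
have E (w : Cplx R) : (p + w *: d, siegel_pi t2 g2) = (p, siegel_pi t2 g2) + w *: (d, 0).
  by congr pair; rewrite /= scaler0 addr0.
rewrite (_ : (fun w : R[i] => _) = (fun w : R[i] => (f \o U_pi_inv) ((p, siegel_pi t2 g2) + (w : Cplx R) *: (d, 0)))).
  by apply: cdiff_line; rewrite -E; apply: hf; split => //=; rewrite siegel_siegel_pi.
by apply/funext => w; rewrite /= E.
Qed.

Lemma line_holo_snd f t1 g1 : holomorphic_on_U f -> 0 < t1 ->
  line_holo (siegel R n2) (fun p => f (U_pi_inv (siegel_pi t1 g1, p))).
Proof.
move=> hf t10 p d z Sp.
have E (w : Cplx R) : (siegel_pi t1 g1, p + w *: d) = (siegel_pi t1 g1, p) + w *: (0, d).
  by congr pair; rewrite /= scaler0 addr0.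
rewrite (_ : (fun w : R[i] => _) = (fun w : R[i] => (f \o U_pi_inv) ((siegel_pi t1 g1, p) + (w : Cplx R) *: (0, d)))).
  by apply: cdiff_line; rewrite -E; apply: hf; split => //=; rewrite siegel_siegel_pi.
by apply/funext => w; rewrite /= E.
Qed.

Lemma measurable_slice f t1 t2 : holomorphic_on_U f -> 0 < t1 -> 0 < t2 ->
  measurable_fun setT (fun g : Hm n1 * Hm n2 => nc (f ((t1, t2), g))).
Proof.
move=> hf t10 t20.
have h : measurable_fun setT (fun g : Hm n1 * Hm n2 => nc (f ((t1, t2), (g.1, g.2)))).
  by apply: (measurable_holomorphic hf (t1 := fun=> t1) (t2 := fun=> t2) (g1 := fst) (g2 := snd)).
by apply: eq_measurable_fun h => -[g1 g2].
Qed.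

Lemma integral_swap_le d (X : measurableType d) (nu : {sigma_finite_measure set X -> \bar R})
    (h : X * Rm -> \bar R) (a b N : R) : a <= b -> 0 <= N -> measurable_fun setT h ->
  (forall p, 0 <= h p)%E -> (forall y, y \in `[a, b] -> \int[nu]_x h (x, y) <= N%:E)%E ->
  (\int[nu]_x \int[mu]_(y in `[a, b]) h (x, y) <= (N * (b - a))%:E)%E.
Proof.
move=> ab N0 mh h0 hN.
pose k (p : X * Rm) := (h p * (\1_`[a, b]%classic p.2)%:E)%E.
have mk : measurable_fun setT k.
  apply: emeasurable_funM => //; apply/measurable_EFinP; apply: measurable_indic_snd.
  exact: measurable_segment.
have k0 p : (0 <= k p)%E by rewrite mule_ge0.
have -> : (\int[nu]_x \int[mu]_(y in `[a, b]) h (x, y) = \int[nu]_x \int[mu]_y k (x, y))%E.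
  apply: eq_integral => x _; rewrite integral_mkcond; apply: eq_integral => y _.
  by rewrite /k /patch indicE; case: ifPn; rewrite ?mule1 ?mule0.
rewrite (fubini_tonelli k)// EFinM -integral_segment_cst// [leRHS]integral_mkcond.
apply: ge0_le_integral => //.
- by move=> y _; exact: integral_ge0.
- exact: measurable_fun_fubini_tonelli_G.
- apply: ((measurable_restrictT _ (measurable_segment a b)).1 _); exact: measurable_cst.
move=> y _; rewrite /k /patch /= indicE; case: ifPn => yab; last first.
  by rewrite integral0_eq// => x _; rewrite mule0.
by under eq_integral do rewrite mule1; apply: hN; rewrite inE in yab.
Qed.

(** The mean inequality in each factor bounds a value by an integral over the group and over two
    intervals of heights of length [eps]; for fixed heights the group integral is at most the Hardy
    norm. *)
Lemma hardy_bounded f (eps : R) : hardy1 f -> 0 < eps ->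
  exists B : R, forall t1 t2 g1 g2, eps <= t1 -> eps <= t2 -> nc (f ((t1, t2), (g1, g2))) <= B.
Proof.
move=> [hf foo] eps0.
have [C1 C10 M1] := @siegel_mean R n1 eps eps0; have [C2 C20 M2] := @siegel_mean R n2 eps eps0.
(* Truncating the heights from below makes the integrand total and measurable; the heights in use
   are unaffected. *)
pose m (eta : R) := Num.max eta (eps / 2).
have e20 : 0 < eps / 2 by rewrite divr_gt0.
have m0 eta : 0 < m eta by rewrite lt_max e20 orbT.
have mE eta : eps / 2 <= eta -> m eta = eta by move=> h; rewrite /m max_l.
have mm : measurable_fun setT (m : Rm -> Rm) by apply: measurable_maxr.
have N0 : (0 <= hardy1_norm f)%E.
  apply: le_ereal_sup_tmp; exists (\int[lebesgue_H]_g (nc (f ((1, 1), g)))%:E)%E; first by exists (1, 1).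
  by apply: integral_ge0 => g _; rewrite lee_fin nc_ge0.
pose N := fine (hardy1_norm f).
have NE : hardy1_norm f = N%:E by rewrite fineK// ge0_fin_numE.
have N0' : 0 <= N by rewrite -lee_fin -NE.
pose K (p : ((Rm * Hm n1) * Rm) * Hm n2) := (nc (f ((m p.1.1.1, m p.1.2), (p.1.1.2, p.2))))%:E.
have mK : measurable_fun setT K.
  have m11 : measurable_fun setT (fun p : ((Rm * Hm n1) * Rm) * Hm n2 => p.1.1).
    exact: measurableT_comp measurable_fst measurable_fst.
  have m12 : measurable_fun setT (fun p : ((Rm * Hm n1) * Rm) * Hm n2 => p.1.2).
    exact: measurableT_comp measurable_snd measurable_fst.
  apply/measurable_EFinP; apply: (measurable_holomorphic hf (t1 := fun p => m p.1.1.1)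
    (t2 := fun p => m p.1.2) (g1 := fun p => p.1.1.2) (g2 := snd)) => //.
  - exact: measurableT_comp mm (measurableT_comp measurable_fst m11).
  - exact: measurableT_comp mm m12.
  - exact: measurableT_comp measurable_snd m11.
have K0 p : (0 <= K p)%E by rewrite lee_fin nc_ge0.
pose K2 (q : (Rm * Hm n1) * Rm) := (\int[lebesgue_heis R n2]_g2 K (q, g2))%E.
have mK2 : measurable_fun setT K2.
  exact: (@measurable_fun_fubini_tonelli_F _ _ _ (Hm n2) R (lebesgue_heis R n2) K).
have K20 q : (0 <= K2 q)%E by exact: integral_ge0.
suff key t1 t2 g1 g2 : eps <= t1 -> eps <= t2 ->
    ((nc (f ((t1, t2), (g1, g2))))%:E <= (C1 * (C2 * (N * eps) * eps))%:E)%E.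
  by exists (C1 * (C2 * (N * eps) * eps)) => t1 t2 g1 g2 h1 h2; rewrite -lee_fin; exact: key.
move=> et1 et2.
have len t : (t + eps / 2) - (t - eps / 2) = eps :> R by lra.
have le t : t - eps / 2 <= t + eps / 2 :> R by lra.
have hlow t eta : eps <= t -> eta \in `[t - eps / 2, t + eps / 2] -> eps / 2 <= eta.
  by move=> et; rewrite in_itv/= => /andP[h _]; lra.
pose J : set Rm := `[t2 - eps / 2, t2 + eps / 2]%classic.
pose K1 (p : Rm * Hm n1) := (C2%:E * \int[mu]_(eta in J) K2 (p, eta))%E.
have mI : measurable_fun setT (fun p : Rm * Hm n1 => \int[mu]_(eta in J) K2 (p, eta))%E.
  by apply: measurable_partial_integral => //; exact: measurable_segment.
have mK1 : measurable_fun setT K1 by exact: emeasurable_funM.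
have K10 p : (0 <= K1 p)%E by rewrite mule_ge0 ?integral_ge0// lee_fin ltW.
have stepA eta h1 : eps / 2 <= eta -> ((nc (f ((eta, t2), (h1, g2))))%:E <= K1 (eta, h1))%E.
  move=> he; have eta0 := lt_le_trans e20 he.
  have := M2 _ (fun p => K (((eta, h1), p.1), p.2)) t2 g2 (line_holo_snd h1 hf eta0) et2.
  rewrite U_pi_inv_siegel; apply.
  - apply: (measurableT_comp mK); apply: measurable_fun_pair => //.
    by apply: measurable_fun_pair.
  - by move=> p; exact: K0.
  by move=> eta2 h2 he2; rewrite U_pi_inv_siegel /K /= !mE.
have t20 : 0 < t2 by rewrite (lt_le_trans eps0).
have := M1 _ K1 t1 g1 (line_holo_fst g2 hf t20) et1 mK1 K10.
rewrite U_pi_inv_siegel => /(_ _)/le_trans; apply.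
  by move=> eta h1 he; rewrite U_pi_inv_siegel; exact: stepA.
rewrite EFinM; apply: lee_wpmul2l; first by rewrite lee_fin ltW.
have inner eta : eta \in `[t1 - eps / 2, t1 + eps / 2] ->
    (\int[lebesgue_heis R n1]_h1 K1 (eta, h1) <= (C2 * (N * eps))%:E)%E.
  move=> /(hlow _ _ et1) he.
  rewrite ge0_integralZl_EFin//; last 3 first.
  - by move=> h1 _; exact: integral_ge0.
  - exact: (measurableT_comp mI (pair1_measurable _)).
  - exact: ltW.
  rewrite EFinM; apply: lee_wpmul2l; first by rewrite lee_fin ltW.
  have mKe : measurable_fun setT (fun q : Hm n1 * Rm => K2 ((eta, q.1), q.2)).
    apply: (measurableT_comp mK2); apply: measurable_fun_pair => //.
    by apply: measurable_fun_pair.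
  have := @integral_swap_le _ (Hm n1) (lebesgue_heis R n1) (fun q => K2 ((eta, q.1), q.2))
     _ _ N (le t2) N0' mKe (fun q => K20 _).
  rewrite len; apply => eta2 /(hlow _ _ et2) he2.
  rewrite -NE; apply: (@le_trans _ _ (\int[lebesgue_H]_g (nc (f ((eta, eta2), g)))%:E)%E).
    rewrite le_eqVlt; apply/orP; left; apply/eqP.
    rewrite /lebesgue_H [RHS](@integral_sfprod1 R _ _ (Hm n1) (Hm n2)).
    - by apply: eq_integral => h1 _; apply: eq_integral => h2 _; rewrite /K /= !mE.
    - apply/measurable_EFinP; apply: measurable_slice => //; [exact: lt_le_trans he|exact: lt_le_trans he2].
    - by move=> g; rewrite lee_fin nc_ge0.
  apply: ereal_sup_ubound; exists (eta, eta2) => //.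
  by split; [exact: lt_le_trans he|exact: lt_le_trans he2].
apply: (@le_trans _ _ (\int[mu]_(eta in `[(t1 - eps / 2)%R, (t1 + eps / 2)%R]) (C2 * (N * eps))%:E)%E).
  apply: ge0_le_integral => //.
  - by move=> eta _; exact: integral_ge0.
  - apply: measurable_funTS.
    exact: (@measurable_fun_fubini_tonelli_F _ _ Rm (Hm n1) R (lebesgue_heis R n1) K1).
by rewrite integral_segment_cst// len.
Qed.

End hardy.

(** * The maximal function *)

Section limits.
Context {R : realType}.
Local Open Scope ereal_scope.

Lemma limn_einf_ge (u : (\bar R)^nat) (a : \bar R) N : (forall k, (N <= k)%N -> a <= u k) ->
  a <= limn_einf u.
Proof.
move=> au; rewrite limn_einf_lim (cvg_lim _ (@cvg_einfs_sup R u))//.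
apply: le_ereal_sup_tmp; exists (einfs u N); first by exists N.
by apply: le_ereal_inf_tmp => _ [k /= Nk <-]; exact: au.
Qed.

Lemma limn_einf_le (u : (\bar R)^nat) (c : \bar R) : (forall k, u k <= c) -> limn_einf u <= c.
Proof.
move=> uc; rewrite limn_einf_lim (cvg_lim _ (@cvg_einfs_sup R u))//.
apply: ge_ereal_sup => _ [k _ <-]; apply: le_trans (uc k).
by apply: ereal_inf_lbound; exists k => /=.
Qed.

(** The integral of a nonnegative function is the supremum over the simple functions below it, which
    is monotone for arbitrary functions. It serves for [maximal_fun f], a supremum over an
    uncountable family. *)
Lemma ge0_le_integral_nonmeasurable d (T : measurableType d) (mu : {measure set T -> \bar R})
    (f g : T -> \bar R) : (forall x, 0 <= f x) -> (forall x, f x <= g x) ->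
  \int[mu]_x f x <= \int[mu]_x g x.
Proof.
move=> f0 fg; rewrite !ge0_integralTE//; last by move=> x; exact: le_trans (fg x).
apply: ereal_sup_le => _ [h hf <-]; exists h => // x.
exact: le_trans (hf x) (fg x).
Qed.

End limits.

Section heis_norm.
Context {R : realType} {n : nat}.
Implicit Types g h k : heis R n.

(** Writes a point of the cone as a right translate of its vertex, the form to which [pointwise]
    applies. *)
Lemma heis_mul_inv_mul g h : heis_mul g (heis_inv (heis_mul (heis_inv h) g)) = h.
Proof.
rewrite !heis_mulE /heis_inv /= !omegaNl !(omegaNr, omegaDr) omega_self.
case: h => h1 h2 /=; congr pair; last by rewrite opprD opprK addrC subrK.
by rewrite (omegaN h2 g.2) ; ring.
Qed.

Lemma heis_norm_ge0 k : 0 <= heis_norm k.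
Proof. exact: powR_ge0. Qed.

Lemma heis_norm4 k : heis_norm k ^+ 4 = sqnorm k.2 ^+ 2 + k.1 ^+ 2.
Proof.
have E : Cn_norm k.2 ^+ 4 = sqnorm k.2 ^+ 2 by rewrite -Cn_normE -exprM.
have a0 : 0 <= sqnorm k.2 ^+ 2 + k.1 ^+ 2 by rewrite addr_ge0// sqr_ge0.
by rewrite -powR_mulrn ?heis_norm_ge0// /heis_norm E -powRrM mulVf ?powRr1.
Qed.

(** Turns the cone condition into the hypotheses of [pointwise] with both apertures equal to 1. *)
Lemma heis_norm_lt k t : heis_norm k ^+ 2 < t ->
  [/\ 0 < t, `|k.1| <= t & forall i, nc (k.2 ord0 i) <= Num.sqrt t].
Proof.
move=> kt; have t0 : 0 < t by exact: le_lt_trans (sqr_ge0 _) kt.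
have k4 : sqnorm k.2 ^+ 2 + k.1 ^+ 2 <= t ^+ 2.
  rewrite -heis_norm4 -[4%N]/(2 * 2)%N exprM lerXn2r ?nnegrE ?sqr_ge0 ?(ltW t0)//.
  exact: ltW.
have q0 : 0 <= sqnorm k.2 by rewrite sumr_ge0// => j _; exact: sqr_ge0.
split=> //.
  rewrite -(@ler_pXn2r _ 2)// ?nnegrE ?(ltW t0)// real_normK ?num_real//.
  by rewrite (le_trans _ k4)// lerDr sqr_ge0.
move=> i; have qt : sqnorm k.2 <= t.
  rewrite -(@ler_pXn2r _ 2)// ?nnegrE ?(ltW t0)//.
  by rewrite (le_trans _ k4)// lerDl sqr_ge0.
rewrite -(@ler_pXn2r _ 2)// ?nnegrE ?nc_ge0 ?sqrtr_ge0// sqr_sqrtr ?(ltW t0)//.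
rewrite (le_trans _ qt)// /sqnorm (bigD1 i)//= lerDl sumr_ge0// => j _; exact: sqr_ge0.
Qed.

Lemma heis_norm0 : heis_norm ((0, 0) : heis R n) = 0.
Proof.
have /eqP := heis_norm4 ((0, 0) : heis R n).
rewrite /= /sqnorm big1 => [|j _]; last by rewrite mxE nc0 expr0n.
by rewrite expr0n addr0 expf_eq0/= => /eqP.
Qed.

End heis_norm.

Section maximal.
Context {R : realType} {n1 n2 : nat}.
Notation Rm := (measurableTypeR R).
Notation Hm n := (measurableTypeR R * 'rV[Cplx R]_n)%type.
Notation H := (heis R n1 * heis R n2)%type.
Notation X := (Hm n1 * Hm n2)%type.
Implicit Types f : (R * R) * H -> Cplx R.

Definition flow1 (k : heis R n1) (u : R) (x : X) : X := (rflow k u x.1, x.2).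
Definition flow2 (k : heis R n2) (u : R) (x : X) : X := (x.1, rflow k u x.2).

Lemma measure_flow1 k : measure_flow (@lebesgue_H R n1 n2) (flow1 k).
Proof. exact: measure_flow_fst (measure_flow_heis k). Qed.

Lemma measure_flow2 k : measure_flow (@lebesgue_H R n1 n2) (flow2 k).
Proof. exact: measure_flow_snd (measure_flow_heis k). Qed.

Lemma maximal_majorant : exists2 C : R, 0 < C &
  forall f, hardy1 f -> forall eps : R, 0 < eps -> exists G : X -> \bar R,
  [/\ measurable_fun setT G, (forall g, 0 <= G g)%E,
    (\int[lebesgue_H]_g G g <= C%:E * hardy1_norm f)%E &
    forall g t1 t2 h1 h2, heis_norm (heis_mul (heis_inv h1) g.1) ^+ 2 < t1 ->
      heis_norm (heis_mul (heis_inv h2) g.2) ^+ 2 < t2 ->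
      ((nc (f ((t1 + eps, t2 + eps), (h1, h2))))%:E <= G g)%E].
Proof.
have [C1 C10 P1] := @pointwise R n1 _ X (@lebesgue_H R n1 n2) fst flow1
  (fun _ _ _ => erefl) measure_flow1 (enum 'I_n1) 1 1 ler01 ler01.
have [C2 C20 P2] := @pointwise R n2 _ X (@lebesgue_H R n1 n2) snd flow2
  (fun _ _ _ => erefl) measure_flow2 (enum 'I_n2) 1 1 ler01 ler01.
pose L1 := heis_flows flow1 (enum 'I_n1); pose L2 := heis_flows flow2 (enum 'I_n2).
pose s1 : R := 96 ^+ size L1; pose s2 : R := 96 ^+ size L2.
have s10 : 0 < s1 by rewrite exprn_gt0// ltr0n.
have s20 : 0 < s2 by rewrite exprn_gt0// ltr0n.
pose c : R := C1 * (C2 * 1); have c0 : 0 < c by rewrite !mulr_gt0.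
exists (c ^+ 2 * (s1 * s2)); first exact: mulr_gt0 (exprn_gt0 2 c0) (mulr_gt0 s10 s20).
move=> f Hf eps eps0; have [hf foo] := Hf.
have [B fB] := hardy_bounded Hf eps0.
pose F (g : X) := (Num.sqrt (nc (f ((eps, eps), g))))%:E.
have mF : measurable_fun setT F.
  apply/measurable_EFinP; apply: (measurableT_comp (f := @Num.sqrt R)).
    by apply: continuous_measurable_fun; exact: sqrt_continuous.
  exact: measurable_slice.
have FN g : (0 <= F g <= (Num.sqrt B)%:E)%E.
  rewrite !lee_fin sqrtr_ge0/= ler_wsqrtr//.
  by case: g => g1 g2; exact: fB.
have hL1 phi : List.In phi L1 -> measure_flow (@lebesgue_H R n1 n2) phi.
  exact: (measure_heis_flows measure_flow1).
have hL2 phi : List.In phi L2 -> measure_flow (@lebesgue_H R n1 n2) phi.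
  exact: (measure_heis_flows measure_flow2).
pose W2 := iter_maximal L2 F; have [mW2 W2N] := iter_maximal_bounds hL2 mF FN.
pose W := iter_maximal L1 W2; have [mW WN] := iter_maximal_bounds hL1 mW2 W2N.
have W0 g : (0 <= W g)%E by case/andP: (WN g).
have cc0 : 0 <= c ^+ 2 by exact: sqr_ge0.
(* The square undoes the square root: an L^2 bound for [W] is an L^1 bound for this majorant, and
   the integral of [F^2] is the integral of [|f|] at height [eps] in both factors. *)
exists (fun g => (c ^+ 2)%:E * (W g * W g))%E; split.
- by apply: emeasurable_funM => //; exact: emeasurable_funM.
- by move=> g; rewrite mule_ge0 ?mule_ge0// lee_fin.
- rewrite ge0_integralZl_EFin//; last 2 first.
  + by move=> g _; exact: mule_ge0.
  + exact: emeasurable_funM.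
  rewrite (EFinM (c ^+ 2)) -[leRHS]muleA; apply: lee_wpmul2l; first by rewrite lee_fin.
  apply: le_trans (iter_maximal_L2 hL1 mW2 W2N) _.
  rewrite (EFinM s1) -[leRHS]muleA; apply: lee_wpmul2l; first by rewrite lee_fin ltW.
  apply: le_trans (iter_maximal_L2 hL2 mF FN) _.
  apply: lee_wpmul2l; first by rewrite lee_fin ltW.
  apply: ereal_sup_ubound; exists (eps, eps) => //.
  by apply: eq_integral => g _; rewrite /F -EFinM -expr2 sqr_sqrtr ?nc_ge0.
move=> g t1 t2 h1 h2 /heis_norm_lt[t10 k1t k1i] /heis_norm_lt[t20 k2t k2i].
set k1 := heis_mul (heis_inv h1) g.1 in k1t k1i; set k2 := heis_mul (heis_inv h2) g.2 in k2t k2i.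
have h1E : heis_mul g.1 (- k1.1, - k1.2) = h1 by exact: heis_mul_inv_mul.
have h2E : heis_mul g.2 (- k2.1, - k2.2) = h2 by exact: heis_mul_inv_mul.
have nin n (i : 'I_n) (z : 'rV[Cplx R]_n) : i \notin enum 'I_n -> z ord0 i = 0.
  by rewrite mem_enum.
(* Second factor, over every [g1] at height [eps]: this is the control at base height that the first
   factor needs, with [W2] in the role of [F]. *)
have second (g1 : heis R n1) :
    ((Num.sqrt (nc (f ((eps, t2 + eps), (g1, h2)))))%:E <= (C2 * 1)%:E * W2 (g1, g.2))%E.
  have ctl : @controlled R n2 _ X snd flow2 (fun p => f (U_pi_inv (siegel_pi eps g1, p))) eps F 1
      [set x | x.1 = g1].
    split => //.
    - exact: line_holo_snd.
    - by exists B => t g' et; rewrite U_pi_inv_siegel; exact: fB.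
    - by exists (Num.sqrt B).
    - by move=> [x1 x2] /= ->; rewrite U_pi_inv_siegel mul1e.
  have := P2 _ _ _ _ _ ctl t2 (g1, g.2) (- k2.1) (- k2.2) t20 erefl.
  rewrite /= U_pi_inv_siegel h2E; apply.
  - by rewrite normrN mul1r.
  - by move=> i; exact: nin.
  - by move=> i; rewrite mxE ncN mul1r.
have ctl : @controlled R n1 _ X fst flow1 (fun p => f (U_pi_inv (p, siegel_pi (t2 + eps) h2))) eps W2
    (C2 * 1) [set x | x.2 = g.2].
  split => //.
  - by apply: line_holo_fst => //; exact: addr_gt0.
  - by exists B => t g' et; rewrite U_pi_inv_siegel; apply: fB => //; rewrite lerDr ltW.
  - by exists (Num.sqrt B).
  - by rewrite mulr1 ltW.
  - by move=> [x1 x2] /= ->; rewrite U_pi_inv_siegel; exact: second.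
have := P1 _ _ _ _ _ ctl t1 g (- k1.1) (- k1.2) t10 erefl.
rewrite /= U_pi_inv_siegel h1E => main.
have {}main : ((Num.sqrt (nc (f ((t1 + eps, t2 + eps), (h1, h2)))))%:E <= c%:E * W g)%E.
  apply: main.
  - by rewrite normrN mul1r.
  - by move=> i; exact: nin.
  - by move=> i; rewrite mxE ncN mul1r.
rewrite -(sqr_sqrtr (nc_ge0 (f _))) expr2 EFinM.
have s0 : (0 <= (Num.sqrt (nc (f ((t1 + eps, t2 + eps), (h1, h2)))))%:E)%E by rewrite lee_fin sqrtr_ge0.
apply: le_trans (lee_pmul s0 s0 main main) _.
by rewrite muleACA -EFinM -expr2.
Qed.

End maximal.

Theorem proposition5p1 (R : realType) (n1 n2 : nat)
    (hn1 : (1 <= n1)%N) (hn2 : (1 <= n2)%N) :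
  exists C : R, 0 < C /\
    forall f : (R * R) * (heis R n1 * heis R n2) -> Cplx R, hardy1 f ->
      ('N[lebesgue_H]_1[maximal_fun f] <= C%:E * hardy1_norm f)%E.
Proof.
have [C C0 maj] := @maximal_majorant R n1 n2; exists C; split=> // f Hf.
pose eps (k : nat) : R := k.+1%:R^-1.
have eps0 k : 0 < eps k by rewrite invr_gt0.
have /choice[G HG] := fun k => maj f Hf (eps k) (eps0 k).
(* The cone contains the point above its vertex at heights 1, so the supremum is not over the empty
   set. *)
have f0 g : (0 <= maximal_fun f g)%E.
  apply: le_ereal_sup_tmp; exists (nc (f ((1, 1), g)))%:E; last by rewrite lee_fin nc_ge0.
  exists ((1, 1), g) => //; split; first by split => //; split.
  by rewrite /= !heis_mulVg !heis_norm0 expr0n.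
rewrite Lnorm1; under eq_integral do rewrite gee0_abs//.
apply: (@le_trans _ _ (\int[lebesgue_H]_g limn_einf (G ^~ g))%E).
  apply: ge0_le_integral_nonmeasurable => // g; apply: ge_ereal_sup => _ [[[t1 t2] [h1 h2]] + <-].
  move=> [[[_ _] _]] /= [d1 d2].
  (* The cone conditions are strict: lowering both heights by [eps k < gap] preserves them, so
     [G k g] dominates the value for all large [k]. *)
  pose gap := Num.min (t1 - heis_norm (heis_mul (heis_inv h1) g.1) ^+ 2)
    (t2 - heis_norm (heis_mul (heis_inv h2) g.2) ^+ 2).
  have gap0 : 0 < gap by rewrite lt_min !subr_gt0 d1.
  apply: (@limn_einf_ge _ _ _ (Num.truncn gap^-1)) => k hk.
  have epsg : eps k < gap.
    rewrite /eps -(invrK gap) ltf_pV2 ?posrE ?invr_gt0//.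
    by rewrite (lt_le_trans (truncnS_gt _))// ler_nat ltnS.
  have [_ _ _ bnd] := HG k.
  have := bnd g (t1 - eps k) (t2 - eps k) h1 h2; rewrite !subrK; apply.
    by rewrite ltrBrDr -ltrBrDl (lt_le_trans epsg)// ge_min lexx.
  by rewrite ltrBrDr -ltrBrDl (lt_le_trans epsg)// ge_min lexx orbT.
apply: le_trans (fatou _ _ _ _) _ => //.
- by move=> k; case: (HG k).
- by move=> k g _; case: (HG k).
by apply: limn_einf_le => k; case: (HG k).
Qed.
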